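(* Let $\phi$ be a father wavelet that is of bounded $p$-variation for some $1\le p<\infty$ and vanishes outside a bounded interval $(B_1,B_2]$, and assume that $\phi$ and the associated mother wavelet $\psi$ satisfy Condition 1(T) for some integer $0\le T<\infty$. Assume that the density $p_0$ of $P$ is a bounded function, in which case set $t=0$, or that $p_0\in B^t_{\infty\infty}(\mathbb R)$ for some $t$ with $0<t<T+1$. Let $0<d<\infty$ and let $L,\Lambda_0$ be finite positive constants having property (E) of the context (such constants exist). Let $\mathcal F_R=\{f:\mathbb R\to\mathbb R\text{ right continuous}:\|f\|_\infty+v_1(f)\le1\}$. Then for all $n\in\mathbb N$, all $j\in\mathbb N$ with $2^{-j}\ge d(\log n)/n$ and all $\lambda\ge\Lambda_0\max(\sqrt{j2^{-j}},\sqrt n\,2^{-j(t+1)})$ we have, with $P_n^W$ built with resolution level $j$, $$\Pr\left(\sqrt n\,\|P_n^W-P_n\|_{\mathcal F_R}>\lambda\right)\le L\exp\left\{-\frac{\min(2^j\lambda^2,\sqrt n\lambda)}{L}\right\}.$$ If furthermore $j=j_n$ (with $2^{-j_n}\ge d(\log n)/n$) satisfies $\sqrt n\,2^{-j_n(t+1)}\to0$ as $n\to\infty$, and if $\mathcal F=\{f:\mathbb R\to\mathbb R\text{ measurable}:\|f\|_\infty+v_1(f)\le1\}$, then also $$\sqrt n\,(P_n^W-P)\rightsquigarrow_{\ell^\infty(\mathcal F)}G_P.$$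
   Context: $X_1,X_2,\dots$ are i.i.d. with absolutely continuous law $P$ on $\mathbb R$ with density $p_0$ (coordinate projections of $(\mathbb R^{\mathbb N},\mathcal B^{\mathbb N},P^{\mathbb N})$, $\Pr=P^{\mathbb N}$); $P_n=n^{-1}\sum_{i=1}^n\delta_{X_i}$, $F_n(s)=P_n((-\infty,s])$. For a measure $\mu$, $\mu f=\int f\,d\mu$ and $\|\mu\|_{\mathcal F}=\sup_{f\in\mathcal F}|\mu f|$. $\|h\|_\infty=\sup_x|h(x)|$. Father wavelet: $\phi\in\mathcal L^2(\mathbb R)$ such that $\{\phi(\cdot-k):k\in\mathbb Z\}$ is orthonormal in $\mathcal L^2(\mathbb R)$ and the spaces $V_0=\{\sum_kc_k\phi(\cdot-k):\{c_k\}\in\ell^2\}$, $V_j=\{f(2^j\cdot):f\in V_0\}$ are nested ($V_{j-1}\subseteq V_j$) with $\bigcup_{j\ge0}V_j$ dense in $\mathcal L^2(\mathbb R)$. Associated mother wavelet: $\psi$ such that, with $\psi_{lk}(x)=2^{l/2}\psi(2^lx-k)$, for each $l\ge 0$ $\{\psi_{lk}:k\in\mathbb Z\}$ is an orthonormal basis of the orthogonal complement of $V_l$ in $V_{l+1}$. $v_p(h)=\sup\{\sum_{i=1}^n|h(x_i)-h(x_{i-1})|^p:n\in\mathbb N,\ -\infty<x_0<\dots<x_n<\infty\}$; $h$ is of bounded $p$-variation if $v_p(h)<\infty$. Condition 1(S) ($S\ge0$ an integer): $\phi$ and $\psi$ are bounded with compact support and at least one of the following holds: (i) $\phi$ has weak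 derivatives up to order $S$ that are in $\mathcal L^p(\mathbb R)$ for some $1\le p\le\infty$; (ii) $\int x^i\psi(x)\,dx=0$ for $i=0,\dots,S$. Estimator: $K(y,x)=\sum_{k\in\mathbb Z}\phi(y-k)\phi(x-k)$; with resolution level $j$, $p_n(y)=\frac1n\sum_{i=1}^n2^{j}K(2^{j}y,2^{j}X_i)$, $dP_n^W(y)=p_n(y)\,dy$, $F_n^W(s)=\int_{-\infty}^sp_n(y)\,dy$. In the limit theorem $j=j_n\in\mathbb N$ with $j_n\nearrow\infty$. Property (E): $L$ depends only on $\|p_0\|_\infty,\phi,d$ and $\Lambda_0$ only on $\|p_0\|_{t,\infty},\phi,d$ (where $\|p_0\|_{t,\infty}=\|p_0\|_{t,\infty,\infty}$ if $t>0$ and $\|p_0\|_{0,\infty}=\|p_0\|_\infty$), and for all $n\in\mathbb N$, all $j\in\mathbb N$ with $2^{-j}\ge d(\log n)/n$ and all $\lambda\ge\Lambda_0\max(\sqrt{j2^{-j}},\sqrt n\,2^{-j(t+1)})$ one has $\Pr(\sqrt n\|F_n^W-F_n\|_\infty>\lambda)\le L\exp\{-\min(2^j\lambda^2,\sqrt n\lambda)/L\}$. Besov spaces: for $1\le p,q\le\infty$, $s>0$, choose an integer $S>s$ and a (possibly different) pair $\phi,\psi$ satisfying Condition 1(S) with its part (i); with $\alpha_k(f)=\int f(x)\phi(x-k)\,dx$, $\beta_{lk}(f)=\int f\psi_{lk}$, $B^s_{pq}(\mathbb R)$ is the set of $f\in\mathcal L^p(\mathbb R)$ with $\|f\|_{s,p,q}=\|\alpha_{(\cdot)}(f)\|_{\ell^p}+\big(\sum_{l\ge0}(2^{l(s+1/2-1/p)}\|\beta_{l(\cdot)}(f)\|_{\ell^p})^q\big)^{1/q}<\infty$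 (supremum over $l$ if $q=\infty$). The space is independent of the choice of $\phi,\psi$, with equivalent norms. $\ell^\infty(\mathcal F)$ is the space of bounded real functions on $\mathcal F$ with the sup norm; $\rightsquigarrow_{\ell^\infty(\mathcal F)}$ is convergence in law there in the empirical-process (Hoffmann-Jørgensen) sense. $G_P$ is the centered Gaussian process on $\mathcal F$ with covariance $EG_P(f)G_P(g)=P[(f-Pf)(g-Pg)]$. *)

(* Defs.v *)
From HB Require Import structures.
From mathcomp Require Import all_boot all_order all_algebra.
From mathcomp Require Import all_classical all_reals all_analysis.
Set Implicit Arguments.
Unset Strict Implicit.
Unset Printing Implicit Defensive.
Import Order.TTheory GRing.Theory Num.Theory.
Import numFieldNormedType.Exports.
Local Open Scope classical_set_scope.
Local Open Scope ring_scope.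

Section norms.
Context {R : realType}.
Local Open Scope ereal_scope.

Definition sup_norm (h : R -> R) : \bar R :=
  ereal_sup (range (fun x => `|h x|%:E)).

Definition p_variation (p : R) (h : R -> R) : \bar R :=
  ereal_sup [set y | exists (n : nat) (x : nat -> R),
    [/\ (0 < n)%N, forall i, (i < n)%N -> (x i < x i.+1)%R
      & y = (\sum_(i < n) `|h (x i.+1) - h (x i)| `^ p)%R%:E]].

(* The l^p norm of an extended-real family; only 1 <= p <= +oo is meant, and
   the value at -oo is junk. *)
Definition lp_norm (I : choiceType) (p : \bar R) (a : I -> \bar R) : \bar R :=
  match p with
  | r%:E => (\esum_(i in [set: I]) `|a i| `^ r) `^ (r^-1)%R
  | +oo => ereal_sup (range (fun i => `|a i|))
  | -oo => 0
  end.

End norms.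

Section wavelets.
Context {R : realType}.
Local Notation mu := (@lebesgue_measure R).
Implicit Types (phi psi f g h : R -> R) (e : int -> R -> R).

Definition inner f g : R := \int[mu]_x (f x * g x).

Definition L2_norm f : \bar R := ('N[mu]_2%:E[EFin \o f])%E.

Definition orthonormal e : Prop :=
  (forall k, e k \in Lfun mu 2%:E) /\
  (forall k k', inner (e k) (e k') = (k == k')%:R).

(* f = sum_k (c k) e_k with convergence in L^2 of the symmetric partial sums;
   for an orthonormal family and square-summable c the convergence is
   unconditional, so the order of summation is immaterial. *)
Definition L2_expansion e (c : int -> R) f : Prop :=
  L2_norm (fun x =>
     f x - \sum_(k \in [set k : int | `|k| <= N%:Z]) c k * e k x)
    @[N --> \oo] --> 0%E.

Definition square_summable (c : int -> R) : Prop :=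
  (\esum_(k in [set: int]) (c k ^+ 2)%:E < +oo)%E.

Definition translate phi (k : int) : R -> R := fun x => phi (x - k%:~R).

Definition V0 phi : set (R -> R) :=
  [set f | f \in Lfun mu 2%:E /\
     exists2 c, square_summable c & L2_expansion (translate phi) c f].

Definition V phi (j : nat) : set (R -> R) :=
  [set g | exists2 f, V0 phi f & g = (fun x => f (2 ^+ j * x))].

Definition father_wavelet phi : Prop :=
  [/\ phi \in Lfun mu 2%:E,
      orthonormal (translate phi),
      forall j, V phi j `<=` V phi j.+1
    & forall f, f \in Lfun mu 2%:E -> forall eps : R, 0 < eps ->
        exists j, exists2 g, V phi j g
          & (L2_norm (f \- g)%R < eps%:E)%E].

Definition wavelet psi (l : nat) (k : int) : R -> R :=
  fun x => 2 `^ (l%:R / 2) * psi (2 ^+ l * x - k%:~R).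

Definition W phi (l : nat) : set (R -> R) :=
  [set g | V phi l.+1 g /\ forall f, V phi l f -> inner f g = 0].

Definition orthonormal_basis e (E : set (R -> R)) : Prop :=
  [/\ forall k, E (e k), orthonormal e
    & forall f, E f -> exists2 c, square_summable c & L2_expansion e c f].

Definition mother_wavelet phi psi : Prop :=
  forall l : nat, orthonormal_basis (wavelet psi l) (W phi l).

Definition compact_support f : Prop := compact (closure (f @^-1` [set~ 0])).

Definition test_function h : Prop :=
  (forall n x, derivable (derive1n n h) x 1) /\ compact_support h.

Definition weak_derivative (m : nat) f g : Prop :=
  [/\ locally_integrable [set: R] f, locally_integrable [set: R] g
    & forall h, test_function h ->
        \int[mu]_x (f x * derive1n m h x) = (-1) ^+ m * \int[mu]_x (g x * h x)].

Definition bounded_compactly_supported f : Prop :=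
  bounded_fun f /\ compact_support f.

Definition weakly_smooth (S : nat) phi : Prop :=
  exists2 p : \bar R, (1 <= p)%E & forall m, (m <= S)%N ->
    exists2 g, g \in Lfun mu p & weak_derivative m phi g.

Definition vanishing_moments (S : nat) psi : Prop :=
  forall i, (i <= S)%N -> \int[mu]_x (x ^+ i * psi x) = 0.

Definition condition1 (S : nat) phi psi : Prop :=
  [/\ bounded_compactly_supported phi, bounded_compactly_supported psi
    & weakly_smooth S phi \/ vanishing_moments S psi].

(* The wavelet pairs admitted in the definition of the Besov spaces of
   smoothness s. *)
Definition besov_pair (s : R) (S : nat) phi psi : Prop :=
  [/\ s < S%:R, father_wavelet phi, mother_wavelet phi psi,
      condition1 S phi psi & weakly_smooth S phi].

Definition besov_norm phi psi (s : R) (p q : \bar R) f : \bar R :=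
  (lp_norm p (fun k => (inner f (translate phi k))%:E) +
   lp_norm q (fun l : nat =>
     (2 `^ (l%:R * (s + 2^-1 - fine p^-1)))%:E *
       lp_norm p (fun k => (inner f (wavelet psi l k))%:E)))%E.

Definition besov phi psi (s : R) (p q : \bar R) : set (R -> R) :=
  [set f | f \in Lfun mu p /\ (besov_norm phi psi s p q f < +oo)%E].

(* The norm ||.||_{t,oo}, which is the sup norm when t = 0. *)
Definition smoothness_norm phi psi (t : R) f : \bar R :=
  if t == 0 then sup_norm f else besov_norm phi psi t +oo%E +oo%E f.

End wavelets.

Section sample_space.
Context {R : realType}.

Definition coordinate_cylinders : set (set (nat -> R)) :=
  \bigcup_i preimage_set_system [set: nat -> R] (fun x => x i) measurable.

(* R^N with its product sigma-algebra; the observation X_(i+1) is the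
   coordinate projection x |-> x i. *)
Definition sample_space := g_sigma_algebraType coordinate_cylinders.

(* Pr = P^N; these cylinder probabilities determine Pr. *)
Definition infinite_product (P : probability R R)
    (Pr : probability sample_space R) : Prop :=
  forall (n : nat) (A : nat -> set R), (forall i, measurable (A i)) ->
    Pr [set x | forall i, (i < n)%N -> A i (x i)] =
    (\prod_(i < n) P (A i))%E.

Definition has_density (P : probability R R) (p0 : R -> R) : Prop :=
  [/\ measurable_fun [set: R] p0, forall x, 0 <= p0 x
    & forall A, measurable A ->
        P A = (\int[lebesgue_measure]_(x in A) (p0 x)%:E)%E].

End sample_space.
Arguments sample_space : clear implicits.

Section estimators.
Context {R : realType}.
Local Notation mu := (@lebesgue_measure R).
Implicit Types (phi f : R -> R) (x : sample_space R) (n j : nat).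

(* P_n f, the integral of f against the empirical measure of x 0 .. x (n-1). *)
Definition emp n x f : R := n%:R^-1 * \sum_(i < n) f (x i).

Definition emp_cdf n x (s : R) : R := emp n x \1_`]-oo, s].

(* For phi with bounded support the sum has finitely many nonzero terms. *)
Definition wkernel phi (y x : R) : R :=
  \sum_(k \in [set: int]) phi (y - k%:~R) * phi (x - k%:~R).

Definition wdensity phi j n x (y : R) : R :=
  n%:R^-1 * \sum_(i < n) 2 ^+ j * wkernel phi (2 ^+ j * y) (2 ^+ j * x i).

(* P_n^W f. *)
Definition wemp phi j n x f : R := \int[mu]_y (f y * wdensity phi j n x y).

Definition wemp_cdf phi j n x (s : R) : R :=
  \int[mu]_(y in `]-oo, s]) wdensity phi j n x y.

Definition cdf_dist phi j n x : \bar R :=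
  sup_norm (fun s => wemp_cdf phi j n x s - emp_cdf n x s).

Definition class_dist phi j n x (F : set (R -> R)) : \bar R :=
  ereal_sup [set `|wemp phi j n x f - emp n x f|%:E | f in F].

Definition bv_ball : set (R -> R) :=
  [set f : R -> R | measurable_fun [set: R] f /\
           (sup_norm f + p_variation 1 f <= 1)%E].

Definition bv_ball_rc : set (R -> R) :=
  [set f : R -> R | right_continuous f /\ (sup_norm f + p_variation 1 f <= 1)%E].

(* 2^-j >= d (log n) / n *)
Definition admissible_level (d : R) n j : Prop :=
  d * ln n%:R / n%:R <= 2 ^- j.

Definition threshold (t : R) n j : R :=
  Num.max (Num.sqrt (j%:R * 2 ^- j)) (Num.sqrt n%:R * 2 `^ (- (j%:R * (t + 1)))).

(* The outer measure mu_ext Pr is used so that the probability of an event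
   makes sense before its measurability is established; it agrees with Pr on
   measurable events. *)
Definition cdf_exponential_inequality (Pr : probability (sample_space R) R)
    phi (d t L Lambda0 : R) : Prop :=
  forall (n j : nat) (lambda : R), (0 < n)%N -> (0 < j)%N ->
    admissible_level d n j -> Lambda0 * threshold t n j <= lambda ->
    (mu_ext Pr [set x |
        lambda%:E < (Num.sqrt n%:R)%:E * cdf_dist phi j n x] <=
     (L * expR (- (Num.min (2 ^+ j * lambda ^+ 2)
                           (Num.sqrt n%:R * lambda) / L)))%:E)%E.

End estimators.

Section convergence_in_law.
Context {R : realType} (T : choiceType).

(* l^oo(T) is the subspace [linf] of the functions T -> R with the topology of
   uniform convergence. *)
Definition linf : set {uniform T -> R} :=
  [set z | exists M : R, forall t, `|z t| <= M].

Definition uniform_borel := g_sigma_algebraType (@open {uniform T -> R}).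

Definition tight_on_linf (gamma : probability uniform_borel R) : Prop :=
  gamma linf = 1%E /\
  forall eps : R, 0 < eps -> exists K : set {uniform T -> R},
    [/\ compact K, K `<=` linf & (gamma (~` K) <= eps%:E)%E].

Context d (Omega : measurableType d) (Pr : probability Omega R).

(* For bounded h, restricting to integrable majorants does not change the
   infimum over all measurable majorants whose expectation exists. *)
Definition outer_expectation (h : Omega -> R) : \bar R :=
  ereal_inf [set (\int[Pr]_w U w)%E | U in
    [set U : Omega -> \bar R | Pr.-integrable [set: Omega] U /\
                               forall w, ((h w)%:E <= U w)%E]].

(* Convergence in law of Z_n to gamma in the Hoffmann-Jorgensen sense. *)
Definition cvg_in_law (Z : nat -> Omega -> {uniform T -> R})
    (gamma : probability uniform_borel R) : Prop :=
  [/\ forall n w, linf (Z n w), tight_on_linf gamma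
    & forall H : {uniform T -> R} -> R,
        {within linf, continuous H} ->
        (exists M : R, forall z, linf z -> `|H z| <= M) ->
        outer_expectation (fun w => H (Z n w)) @[n --> \oo] -->
          (\int[gamma]_(z in linf) (H z)%:E)%E].

End convergence_in_law.

Section gaussian.
Context {R : realType}.

(* Point masses are Gaussian; they are listed separately because normal_prob
   is not a point mass when its standard deviation is 0. *)
Definition gaussian_law (nu : set R -> \bar R) : Prop :=
  (exists m : R, forall B, measurable B -> nu B = \d_m B) \/
  (exists m s : R, 0 < s /\
     forall B, measurable B -> nu B = normal_prob m s B).

(* gamma is the law of G_P, the centred Gaussian process indexed by F with
   covariance P[(f - Pf)(g - Pg)]. *)
Definition law_of_GP (P : probability R R) (F : set (R -> R))
    (gamma : probability (uniform_borel (R := R) F) R) : Prop :=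
  [/\ forall m (f : 'I_m -> F) (a : 'I_m -> R),
        gaussian_law (fun B =>
          gamma [set z : {uniform F -> R} | B (\sum_(i < m) a i * z (f i))]),
      forall f : F, ('E_gamma[fun z : {uniform F -> R} => z f] = 0)%E
    & forall f g : F,
        ('E_gamma[fun z : {uniform F -> R} => (z f * z g)%R] =
         covariance P (set_val f) (set_val g))%E].

Definition wemp_process (P : probability R R) (F : set (R -> R))
    (phi : R -> R) (j : nat -> nat) (n : nat) (x : sample_space R) :
    {uniform F -> R} :=
  fun f => Num.sqrt n%:R *
    (wemp phi (j n) n x (set_val f) - \int[P]_y (set_val f) y).

End gaussian.

(* Main.v *)
Require Import Defs.
From HB Require Import structures.
From mathcomp Require Import all_boot all_order all_algebra.
From mathcomp Require Import all_classical all_reals all_analysis.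
From mathcomp Require Import measurable_realfun.
From mathcomp Require Import ring lra zify.
Set Implicit Arguments.
Unset Strict Implicit.
Unset Printing Implicit Defensive.
Import Order.TTheory GRing.Theory Num.Theory.
Import numFieldNormedType.Exports.
Local Open Scope classical_set_scope.
Local Open Scope ring_scope.


(** If ‖f‖_∞ + v_1(f) ≤ 1, integration by parts bounds the integral of f against the signed measure
    P_n^W - P_n by the sup norm of F_n^W - F_n. So [class_dist] is at most [cdf_dist] for every
    sample ([class_dist_le_cdf_dist], from [bv_functional_le]), and the assumed exponential
    inequality for distribution functions carries over to the class.

    For the limit theorem, the exponential inequality at a fixed level shows that √n times
    [cdf_dist] tends to 0 in outer probability ([cdf_dist_small]). Hence √n (P_n^W - P) is uniformly
    close on the ball to the empirical process ν_n = √n (P_n - P), and it remains to show that the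
    ball is P-Donsker. This is done with a Haar expansion. The continuous distribution function of P
    cuts the line into dyadic cells of mass 2^-l, and the resulting Haar functions are orthonormal
    in L^2(P). The oscillations of a function of the ball over the cells of level l sum to at most
    1, so its Haar coefficients of level l sum in absolute value to at most 2^(-l/2) ≤ (5/7)^l.
    Fourth moments show that, outside an event of small probability, |ν_n(h)| ≤ (5/4)^l for all Haar
    functions h of all levels l between l0 and log_2 n at once. Since (5/7)(5/4) = 25/28 < 1,
    finitely many Haar coordinates determine ν_n up to a small error, uniformly over the ball
    ([empirical_haar_approx]).

    These coordinates converge jointly, by a central limit theorem for cosine transforms ([clt_cos],
    [cvg_cos_haar_coord]). The limit process is the series of the Haar coefficients of f against
    independent standard normal variables. The same geometric decay makes the series converge
    uniformly and puts almost all of its law on images of compact boxes, which gives tightness;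
    Parseval's identity gives the covariance of G_P ([haar_covariance], [law_of_GP_bridge]).

    Finally [cvg_in_law_series] passes from coordinates to the process. A continuous functional is
    replaced near a compact set by a Lipschitz one and evaluated at partial sums; expectations of
    Lipschitz functions of finitely many coordinates converge because such functions are
    trigonometric up to a small error on boxes ([lipschitz_approx], [cvg_exp_lipschitz]). *)

(** * Expectations of bounded measurable functions *)

Section bounded_measurable.
Context d (T : measurableType d) (R : realType).
Implicit Types f g : T -> R.

(** A class stable under the algebraic operations used below, whose members are integrable under
    every probability, so that identities between expectations carry a single kind of side
    condition. *)
Definition bounded_measurable f :=
  measurable_fun [set: T] f /\ exists M, forall x, `|f x| <= M.

Local Notation bm := bounded_measurable.

Lemma measurable_set_lt f g : measurable_fun [set: T] f ->
  measurable_fun [set: T] g -> measurable [set x | f x < g x].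
Proof.
move=> mf mg; rewrite -[X in measurable X]setTI.
exact: (measurable_fun_ltr mf mg measurableT (Y := [set true])).
Qed.

Lemma bm_cst r : bm (fun=> r).
Proof. by split; [exact: measurable_cst|exists `|r|]. Qed.

Lemma bmD f g : bm f -> bm g -> bm (fun x => f x + g x).
Proof.
move=> [mf [M fM]] [mg [N gN]]; split; first exact: measurable_funD.
by exists (M + N) => x; rewrite (le_trans (ler_normD _ _))// lerD.
Qed.

Lemma bmM f g : bm f -> bm g -> bm (fun x => f x * g x).
Proof.
move=> [mf [M fM]] [mg [N gN]]; split; first exact: measurable_funM.
by exists (M * N) => x; rewrite normrM ler_pM.
Qed.

Lemma bmN f : bm f -> bm (fun x => - f x).
Proof.
move=> [mf [M fM]]; split; first exact: measurableT_comp.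
by exists M => x; rewrite normrN.
Qed.

Lemma bmB f g : bm f -> bm g -> bm (fun x => f x - g x).
Proof. by move=> bf bg; apply: bmD => //; exact: bmN. Qed.

Lemma bmZ r f : bm f -> bm (fun x => r * f x).
Proof. by move=> bf; apply: bmM => //; exact: bm_cst. Qed.

Lemma bmX n f : bm f -> bm (fun x => f x ^+ n).
Proof.
move=> bf; elim: n => [|n IH]; first exact: bm_cst.
by under eq_fun do rewrite exprS; exact: bmM.
Qed.

Lemma bm_abs f : bm f -> bm (fun x => `|f x|).
Proof.
move=> [mf [M fM]]; split; first exact: measurableT_comp.
by exists M => x; rewrite normr_id.
Qed.

Lemma bm_indic A : measurable A -> bm (\1_A : T -> R).
Proof.
move=> mA; split; first exact: measurable_indic.
by exists 1 => x; rewrite indicE; case: (_ \in _); rewrite ?normr1 ?normr0.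
Qed.

Lemma bm_sum (I : Type) (r : seq I) (Q : pred I) (F : I -> T -> R) :
  (forall i, Q i -> bm (F i)) -> bm (fun x => \sum_(i <- r | Q i) F i x).
Proof.
move=> bF; elim: r => [|i r IH].
  by under eq_fun do rewrite big_nil; exact: bm_cst.
have [Qi|Qi] := boolP (Q i).
  under eq_fun do rewrite big_cons Qi.
  by apply: bmD => //; exact: bF.
by under eq_fun do rewrite big_cons (negbTE Qi).
Qed.

Lemma bm_cos f : measurable_fun setT f -> bm (fun x => cos (f x)).
Proof.
move=> mf; split; last by exists 1 => x; rewrite ler_norml cos_geN1 cos_le1.
apply: measurableT_comp => //; apply: continuous_measurable_fun; exact: continuous_cos.
Qed.

Lemma bm_sin f : measurable_fun setT f -> bm (fun x => sin (f x)).
Proof.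
move=> mf; split; last by exists 1 => x; rewrite ler_norml sin_geN1 sin_le1.
apply: measurableT_comp => //; apply: continuous_measurable_fun; exact: continuous_sin.
Qed.

Variable P : probability T R.

Lemma bm_integrable f : bm f -> P.-integrable [set: T] (EFin \o f).
Proof.
move=> [mf [M fM]]; apply: measurable_bounded_integrable => //.
  by rewrite [X in (X < _)%E]probability_setT ltry.
exists M; split => [|N MN x _ /=]; first exact: num_real.
by rewrite (le_trans (fM x))// ltW.
Qed.

Lemma expD f g : bm f -> bm g ->
  \int[P]_x (f x + g x) = \int[P]_x f x + \int[P]_x g x.
Proof. by move=> bf bg; rewrite RintegralD//; exact: bm_integrable. Qed.

Lemma expB f g : bm f -> bm g ->
  \int[P]_x (f x - g x) = \int[P]_x f x - \int[P]_x g x.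
Proof. by move=> bf bg; rewrite RintegralB//; exact: bm_integrable. Qed.

Lemma expZ r f : bm f -> \int[P]_x (r * f x) = r * \int[P]_x f x.
Proof. by move=> bf; rewrite RintegralZl//; exact: bm_integrable. Qed.

Lemma exp_cst r : \int[P]_x r = r.
Proof. by rewrite Rintegral_cst// [X in fine X]probability_setT/= mulr1. Qed.

Lemma exp_sum (I : Type) (r : seq I) (Q : pred I) (F : I -> T -> R) :
  (forall i, Q i -> bm (F i)) ->
  \int[P]_x (\sum_(i <- r | Q i) F i x) = \sum_(i <- r | Q i) \int[P]_x F i x.
Proof.
move=> bF; elim: r => [|i r IH].
  by under eq_Rintegral do rewrite big_nil; rewrite exp_cst big_nil.
rewrite big_cons -IH; case: ifP => Qi; last first.
  by apply: eq_Rintegral => x _; rewrite big_cons Qi.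
rewrite -expD//; [|exact: bF|exact: bm_sum].
by apply: eq_Rintegral => x _; rewrite big_cons Qi.
Qed.

Lemma exp_le f g : bm f -> bm g -> (forall x, f x <= g x) ->
  \int[P]_x f x <= \int[P]_x g x.
Proof. by move=> bf bg fg; apply: le_Rintegral => //; exact: bm_integrable. Qed.

Lemma exp_abs f : bm f -> `|\int[P]_x f x| <= \int[P]_x `|f x|.
Proof. by move=> bf; apply: le_normr_Rintegral => //; exact: bm_integrable. Qed.

Lemma exp_absB f g (e : R) : bm f -> bm g -> (forall x, `|f x - g x| <= e) ->
  `|\int[P]_x f x - \int[P]_x g x| <= e.
Proof.
move=> bf bg fg; rewrite -expB// (le_trans (exp_abs _))//; first exact: bmB.
rewrite -[leRHS]exp_cst exp_le//; first by apply: bm_abs; exact: bmB.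
exact: bm_cst.
Qed.

Lemma exp_indic (A : set T) : measurable A -> \int[P]_x (\1_A x : R) = fine (P A).
Proof. by move=> mA; rewrite /Rintegral integral_indic// setIT. Qed.

Lemma markov_bm f (e : R) : bm f -> (forall x, 0 <= f x) -> 0 < e ->
  (P [set x | (e < f x)%R] <= (\int[P]_x f x / e)%:E)%E.
Proof.
move=> bf f0 e0; have mA : measurable [set x | e < f x].
  by apply: measurable_set_lt => //; exact: bf.1.
rewrite -[leLHS]fineK ?fin_num_measure// lee_fin ler_pdivlMr// -exp_indic//.
rewrite mulrC -expZ; last exact: bm_indic.
apply: exp_le => //; first by apply: bmZ; exact: bm_indic.
move=> x; rewrite indicE; have [|] := boolP (x \in _); last by rewrite mulr0.
by rewrite inE/= mulr1 => /ltW.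
Qed.

Lemma exp_dominated (f : nat -> T -> R) g (M : R) :
  (forall n, measurable_fun setT (f n)) -> (forall n x, `|f n x| <= M) ->
  (forall x, f n x @[n --> \oo] --> g x) ->
  \int[P]_x f n x @[n --> \oo] --> \int[P]_x g x.
Proof.
move=> mf fM fg; have mg : measurable_fun setT g.
  by apply: (measurable_fun_cvg (h := f)) => // x _; exact: fg.
apply: fine_cvg; rewrite fineK; last first.
  apply: integrable_fin_num => //; apply: bm_integrable; split=> //.
  exists M => x.
  have /cvgr_to_le : `|f n x| @[n --> \oo] --> `|g x| by apply: cvg_norm.
  by apply; apply: nearW => n; exact: fM.
have [|||||_ _ //] := @dominated_convergence _ _ _ P setT measurableT
  (fun n x => (f n x)%:E) (EFin \o g) (fun=> M%:E).
- by move=> n; exact/measurable_EFinP.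
- exact/measurable_EFinP.
- apply: aeW => x _ /=; apply: cvg_EFin; first exact: nearW.
  exact: (fg x).
- exact: (bm_integrable (bm_cst M)).
- by apply: aeW => x n _ /=; rewrite lee_fin.
Qed.

End bounded_measurable.
Arguments bm_cst {d T R} r.

(** * Image laws and independence *)

Section transfer.
Context d d' (T : measurableType d) (T' : measurableType d') (R : realType).
Variables (P : probability T R) (X : T -> T').
Hypothesis mX : measurable_fun [set: T] X.

Definition image_law : probability T' R :=
  distribution P (HB.pack X (isMeasurableFun.Build _ _ _ _ X mX) : {mfun T >-> T'}).

Lemma image_lawE A : image_law A = P (X @^-1` A). Proof. by []. Qed.

Lemma bm_comp (f : T' -> R) : bounded_measurable f ->
  bounded_measurable (fun x => f (X x)).
Proof.
by move=> [mf [M fM]]; split; [exact: measurableT_comp|exists M => x].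
Qed.

Lemma integral_image_law (f : T' -> \bar R) : measurable_fun [set: T'] f ->
  P.-integrable [set: T] (f \o X) ->
  (\int[image_law]_y f y = \int[P]_x f (X x))%E.
Proof. by move=> mf intf; rewrite integral_distribution. Qed.

Lemma ge0_integral_image_law (f : T' -> \bar R) : measurable_fun [set: T'] f ->
  (forall y, 0 <= f y)%E -> (\int[image_law]_y f y = \int[P]_x f (X x))%E.
Proof. by move=> mf f0; rewrite ge0_integral_distribution. Qed.

Lemma exp_image_law (f : T' -> R) : bounded_measurable f ->
  \int[image_law]_y f y = \int[P]_x f (X x).
Proof.
move=> bf; rewrite /Rintegral integral_image_law//.
  by apply/measurable_EFinP; exact: bf.1.
by apply: bm_integrable; exact: bm_comp.
Qed.

End transfer.

Lemma eq_exp d (T : measurableType d) (R : realType) (P Q : probability T R)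
    (f : T -> R) : (forall A, measurable A -> P A = Q A) ->
  \int[P]_x f x = \int[Q]_x f x.
Proof.
move=> PQ; congr fine; apply: eq_measure_integral => A mA _; exact: PQ.
Qed.

Section product_expectation.
Context d d1 d2 (T : measurableType d) (T1 : measurableType d1)
  (T2 : measurableType d2) (R : realType).
Variables (P : probability T R) (P1 : probability T1 R) (P2 : probability T2 R).
Variables (X1 : T -> T1) (X2 : T -> T2).
Hypotheses (mX1 : measurable_fun [set: T] X1) (mX2 : measurable_fun [set: T] X2).
Hypothesis indep : forall A B, measurable A -> measurable B ->
  P (X1 @^-1` A `&` X2 @^-1` B) = (P1 A * P2 B)%E.

(** The law of the pair agrees with the product measure on rectangles, hence everywhere, and
    Fubini's theorem factors the integral. *)
Lemma exp_indep (u : T1 -> R) (w : T2 -> R) :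
  bounded_measurable u -> bounded_measurable w ->
  \int[P]_x (u (X1 x) * w (X2 x)) = (\int[P1]_x u x) * (\int[P2]_x w x).
Proof.
move=> bu bw.
have mX : measurable_fun setT (fun x => (X1 x, X2 x)).
  exact: measurable_fun_pair.
have buw : bounded_measurable (fun z : T1 * T2 => u z.1 * w z.2).
  by apply: bmM; [exact: (bm_comp measurable_fst)|exact: (bm_comp measurable_snd)].
rewrite -(exp_image_law P mX buw).
have H := @product_measure_unique _ _ _ _ _ P1 P2 (image_law P mX).
rewrite /Rintegral.
rewrite -(@eq_measure_integral _ _ _ _ _ (P1 \x P2)%E); last first.
  by move=> A mA _; apply: H.
have int2 : (P1 \x P2)%E.-integrable setT (EFin \o (fun z : T1 * T2 => u z.1 * w z.2)).
  exact: bm_integrable.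
rewrite -integral12_prod_meas1//.
rewrite (_ : (fun x => _) = (fun x => (\int[P2]_x w x * u x)%:E)); last first.
  apply/funext => x; rewrite /fubini_F mulrC -RintegralZl//; last exact: bm_integrable.
  by rewrite /Rintegral fineK//; apply: integrable_fin_num => //; apply: bm_integrable; exact: bmZ.
by have := expZ P1 (\int[P2]_x w x) bu; rewrite /Rintegral mulrC.
Qed.

End product_expectation.

(** * The i.i.d. sample and the past of an observation *)

Section sample.
Context (R : realType) (P : probability R R) (Pr : probability (sample_space R) R).
Hypothesis HPr : infinite_product P Pr.

Lemma measurable_coord i : measurable_fun [set: sample_space R] (fun x => x i).
Proof.
move=> _ B mB; apply: sub_sigma_algebra; exists i => //.
by exists B.
Qed.

Definition past_sets k : set (set (nat -> R)) :=
  [set E | exists A : nat -> set R, (forall i, measurable (A i)) /\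
     E = [set x | forall i, (i < k)%N -> A i (x i)]].

(* The sample space with the sigma-algebra generated by its first k coordinates. *)
Definition past_space k := g_sigma_algebraType (past_sets k).

Definition past k (f : sample_space R -> R) :=
  measurable_fun [set: past_space k] f.

Lemma measurable_past_sets k (E : set (sample_space R)) :
  past_sets k E -> measurable E.
Proof.
move=> [A [mA ->]].
rewrite (_ : mkset _ = \bigcap_(i in [set i | (i < k)%N])
    ((fun x : sample_space R => x i) @^-1` A i)).
  by apply: bigcap_measurableType => i _; rewrite -[X in measurable X]setTI;
    exact: measurable_coord.
by apply/seteqP; split=> x /= H i; exact: H.
Qed.

Lemma past_coord k i (g : R -> R) : (i < k)%N -> measurable_fun [set: R] g ->
  past k (fun x => g (x i)).
Proof.
move=> ik mg; apply: (@measurableT_comp _ _ _ (past_space k) R R g) => //.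
move=> _ B mB; apply: sub_sigma_algebra.
exists (fun j => if j == i then B else setT); split.
  by move=> j; case: ifP.
apply/seteqP; split=> x /=.
  by move=> [_ Bx] j jk; case: eqP => // ->.
by move=> /(_ i ik); rewrite eqxx.
Qed.

Lemma measurable_past_id k :
  measurable_fun [set: sample_space R] (id : sample_space R -> past_space k).
Proof.
apply: (@measurability _ _ _ (past_space k) _ _ (past_sets k)) => // _ [E GE <-].
rewrite setTI preimage_id. apply: (measurable_past_sets GE).
Qed.

Lemma past_measurable k f : past k f -> measurable_fun [set: sample_space R] f.
Proof. move=> pf; exact: (@measurableT_comp _ _ _ (sample_space R) (past_space k) R
  f setT id pf (@measurable_past_id k)). Qed.

(** For fixed [B], both sides are finite measures in [E] that agree on the cylinders of
    [past_sets k], a family stable under intersection that generates the past. *)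
Lemma past_indep k (E : set (sample_space R)) (B : set R) :
  <<s past_sets k >> E -> measurable B ->
  Pr (E `&` [set x | B (x k)]) = (Pr E * P B)%E.
Proof.
move=> sE mB.
have mBk : measurable [set x : sample_space R | B (x k)].
  by rewrite -[X in measurable X]setTI; exact: measurable_coord.
have PBfin : P B \is a fin_num by rewrite fin_num_measure.
pose r : {nonneg R} := NngNum (fine_ge0 (measure_ge0 P B)).
have rE : (r%:num)%:E = P B by rewrite /= fineK.
rewrite muleC -rE.
pose m1 := mrestr Pr mBk.
pose m2 := mscale r Pr.
rewrite -[LHS]/(m1 E) -[RHS]/(m2 E).
apply: (@g_sigma_algebra_measure_unique _ R (sample_space R) (past_sets k) _
  (fun=> setT) _ _ m1 m2 _ _ _ E sE) => //.
- exact: measurable_past_sets.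
- by move=> _; exists (fun=> setT); split=> //; apply/seteqP; split.
- by rewrite bigcup_const//; exists 0%N.
- move=> _ _ [A [mA ->]] [C [mC ->]]; exists (fun i => A i `&` C i); split.
    by move=> i; exact: measurableI.
  apply/seteqP; split=> x /=; first by move=> [Ax Cx] i ik; split; [exact: Ax|exact: Cx].
  by move=> H; split=> i ik; have [] := H i ik.
- move=> _ [A [mA ->]].
  rewrite /m1 /m2 /= /mrestr /mscale/= [in RHS]HPr// rE muleC.
  have -> : [set x : sample_space R | forall i, (i < k)%N -> A i (x i)] `&`
      [set x | B (x k)] = [set x | forall i, (i < k.+1)%N ->
        (if i == k then B else A i) (x i)].
    apply/seteqP; split=> x /=.
      move=> [Ax Bx] i; case: eqP => [-> //|/eqP ik]; rewrite ltnS leq_eqVlt (negbTE ik)/=.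
      exact: Ax.
    move=> H; split=> [i ik|]; first by have := H i (ltnW ik); rewrite ltn_eqF.
    by have := H k (ltnSn k); rewrite eqxx.
  rewrite (@HPr k.+1 (fun i => if i == k then B else A i)); last first.
    by move=> i; case: ifP.
  rewrite big_ord_recr/= eqxx; congr (_ * _)%E.
  by apply: eq_bigr => i _; rewrite ltn_eqF.
- by move=> _; rewrite /m1 /= /mrestr setTI; apply: le_lt_trans (ltry 1); exact: probability_le1.
Qed.

(** The form in which independence is used: sums over the sample are treated by recursion, splitting
    off the last observation. *)
Lemma exp_past k (u : sample_space R -> R) (w : R -> R) :
  past k u -> bounded_measurable u -> bounded_measurable w ->
  \int[Pr]_x (u x * w (x k)) = (\int[Pr]_x u x) * (\int[P]_x w x).
Proof.
move=> pu bu bw.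
have bu' : @bounded_measurable _ (past_space k) R u by split=> //; exact: bu.2.
have mid := @measurable_past_id k.
rewrite (@exp_indep _ _ _ _ (past_space k) _ R Pr (image_law Pr mid) P id
  (fun x => x k) mid (@measurable_coord k) _ u w)//.
  by rewrite exp_image_law.
by move=> A B mA mB; exact: (past_indep mA mB).
Qed.

Lemma exp_coord k (w : R -> R) : bounded_measurable w ->
  \int[Pr]_x w (x k) = \int[P]_x w x.
Proof.
move=> bw; have := @exp_past k (fun=> 1) w _ _ bw.
under eq_Rintegral do rewrite mul1r.
rewrite exp_cst mul1r; apply; first exact: measurable_cst.
exact: bm_cst.
Qed.

Lemma measure_coord k (B : set R) : measurable B -> Pr [set x | B (x k)] = P B.
Proof.
move=> mB; have := @past_indep k setT B; rewrite setTI => -> //.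
  by rewrite probability_setT mul1e.
by apply: sub_sigma_algebra; exists (fun=> setT); split=> //; apply/seteqP; split.
Qed.

End sample.

(** * Taylor bounds with explicit remainders *)

Section elementary_inequalities.
Context {R : realType}.
Implicit Types (f df : R -> R) (x y w h : R).

Lemma mvt_bound f df (K w : R) : (forall x, is_derive x (1 : R) f (df x)) ->
  (forall x, `|x| <= `|w| -> `|df x| <= K) -> `|f w - f 0| <= K * `|w|.
Proof.
move=> dfE dfK.
have cf A : {within A, continuous f}.
  apply: continuous_subspaceT => x; apply: differentiable_continuous.
  by apply/derivable1_diffP; have [] := dfE x.
have [w0|w0] := leP 0 w.
  have [c cw ->] := MVT_segment w0 (fun x _ => dfE x) (cf _).
  rewrite subr0 normrM ler_wpM2r// dfK//.
  by move: cw; rewrite in_itv/= => /andP[c0 cw]; rewrite !ger0_norm.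
have [c cw H] := MVT_segment (ltW w0) (fun x _ => dfE x) (cf _).
rewrite -normrN opprB H sub0r normrM normrN ler_wpM2r// dfK//.
move: cw; rewrite in_itv/= => /andP[c0 cw].
by rewrite (ltr0_norm w0) ler0_norm// lerN2.
Qed.

Lemma normr_sin_le w : `|sin w| <= `|w|.
Proof.
have := @mvt_bound (@sin R) cos 1 w _ (fun x _ => cos_max x).
by rewrite sin0 subr0 mul1r; apply.
Qed.

Lemma normr_cosB1_le w : `|cos w - 1| <= w ^+ 2.
Proof.
have := @mvt_bound cos (fun x => - sin x) `|w| w _.
rewrite cos0 -expr2 real_normK ?num_real//; apply => x xw.
by rewrite normrN (le_trans (normr_sin_le x)).
Qed.

Lemma normr_sinB_le w : `|sin w - w| <= `|w| ^+ 3.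
Proof.
have := @mvt_bound (fun x => sin x - x) (fun x => cos x - 1) (w ^+ 2) w.
rewrite sin0 !subr0 (exprS _ 2) real_normK ?num_real// (mulrC `|w|).
apply => x xw; rewrite (le_trans (normr_cosB1_le x))//.
by rewrite -(real_normK (num_real x)) -(real_normK (num_real w)) lerXn2r ?nnegrE.
Qed.

Lemma normr_cosB_le w : `|cos w - 1 + w ^+ 2 / 2| <= w ^+ 4.
Proof.
have := @mvt_bound (fun x => cos x + 2^-1 * (x * x)) (fun x => - (sin x - x))
  (`|w| ^+ 3) w.
rewrite cos0 !mulr0 addr0 -exprSr.
rewrite (_ : `|w| ^+ 4 = w ^+ 4); last by rewrite -normrX ger0_norm// exprn_even_ge0.
rewrite (_ : cos w + _ - _ = cos w - 1 + w ^+ 2 / 2); last by rewrite expr2; ring.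
apply => x.
  apply: trigger_derive; rewrite /GRing.scale/=. lra.
move=> xw; rewrite normrN (le_trans (normr_sinB_le x))//.
by rewrite lerXn2r ?nnegrE.
Qed.

Lemma normr_sin_ge w : `|w| <= 2^-1 -> `|w| / 2 <= `|sin w|.
Proof.
move=> w2; have := normr_sinB_le w.
have : `|w| - `|sin w - w| <= `|sin w|.
  rewrite lerBlDr; have := ler_normB (sin w) (sin w - w).
  by rewrite opprB addrCA subrr addr0.
have w0 := normr_ge0 w.
have : `|w| ^+ 3 <= `|w| * (2^-1 * 2^-1).
  by rewrite exprS ler_wpM2l// expr2 ler_pM.
by move=> *; lra.
Qed.

Lemma expR_taylor1 y : `|expR y - 1 - y| <= y ^+ 2 * expR `|y|.
Proof.
have ge0 : 0 <= expR y - 1 - y by have := expR_ge1Dx y; lra.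
rewrite ger0_norm//.
have H : expR y - 1 <= y * expR y.
  have := expR_ge1Dx (- y); rewrite expRN => H.
  have e0 := expR_gt0 y.
  have : (1 - y) * expR y <= (expR y)^-1 * expR y by rewrite ler_pM2r.
  by rewrite mulVf ?gt_eqF//; lra.
have [y0|y0] := leP 0 y.
  rewrite ger0_norm// (@le_trans _ _ (y * (expR y - 1)))//.
    by rewrite mulrBr mulr1; lra.
  by rewrite expr2 -mulrA ler_wpM2l//.
have -> : `|y| = - y by rewrite ltr0_norm.
rewrite (@le_trans _ _ (y * (expR y - 1)))//.
  by rewrite mulrBr mulr1; lra.
have h1 : y * (expR y - 1) <= y ^+ 2.
  by rewrite expr2 ler_wnM2l ?(ltW y0)//; have := expR_ge1Dx y; lra.
apply: (le_trans h1); rewrite ler_peMr ?sqr_ge0//.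
by have := expR_ge1Dx (- y); lra.
Qed.

(** Stands in for differentiation under the integral sign: integrating a pointwise Taylor bound
    yields a remainder of order [h ^+ 2], which identifies the derivative. *)
Lemma is_derive_quad f x (A K : R) :
  (forall h, `|h| <= 1 -> `|f (x + h) - f x - h * A| <= K * h ^+ 2) ->
  is_derive x (1 : R) f A.
Proof.
move=> H.
suff cvgA : h^-1 *: (f (h *: (1 : R) + x) - f x) @[h --> 0^'] --> A.
  by apply: DeriveDef; [apply/cvg_ex; exists A|exact: cvg_lim].
apply/cvgrPdist_le => e e0; near=> h.
have h0 : h != 0 by near: h; exact: nbhs_dnbhs_neq.
have h1 : `|h| <= 1.
  near: h; apply: dnbhs0_le; exact: ltr01.
have he : `|h| <= e / (`|K| + 1).
  by near: h; apply: dnbhs0_le; rewrite divr_gt0// ltr_wpDl.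
rewrite /GRing.scale/= mulr1 (addrC h x).
rewrite (_ : A - _ = - (h^-1 * (f (x + h) - f x - h * A))); last first.
  by field.
rewrite normrN normrM normfV ler_pdivrMl ?normr_gt0//.
rewrite (le_trans (H h h1))// -(real_normK (num_real h)) expr2 mulrCA ler_wpM2l//.
rewrite (@le_trans _ _ ((`|K| + 1) * `|h|))//.
  by rewrite ler_wpM2r// (le_trans (ler_norm K))// lerDl.
by rewrite mulrC -ler_pdivlMr// ltr_wpDl.
Unshelve. all: by end_near. Qed.

End elementary_inequalities.

(** * The centred normal law: cosine transform and moments *)

Section normal_law.
Context {R : realType}.
Local Notation mu := (@lebesgue_measure R).

Lemma ge0_integral_normal_prob (m s : R) (f : R -> \bar R) :
  measurable_fun [set: R] f -> (forall x, 0 <= f x)%E ->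
  (\int[normal_prob m s]_x f x = \int[mu]_x (f x * (normal_pdf m s x)%:E))%E.
Proof.
move=> mf f0; have dom := normal_prob_dominates m s.
rewrite -(Radon_Nikodym_SigmaFinite.change_of_variables dom)//.
have fint := Radon_Nikodym_SigmaFinite.f_integrable dom.
apply: ae_eq_integral => //.
- by apply: emeasurable_funM => //; exact: (measurable_int mu).
- apply: emeasurable_funM => //; apply/measurable_EFinP.
  exact: measurable_normal_pdf.
- apply: ae_eqe_mul2l => /=; apply: integral_ae_eq => //.
  + by apply/measurable_EFinP; exact: measurable_normal_pdf.
  + by move=> E _ mE; rewrite -Radon_Nikodym_SigmaFinite.f_integral.
Qed.

Lemma integral_lebesgue_shift (m : R) (g : R -> R) : continuous g ->
  (forall x, 0 <= g x) ->
  (\int[mu]_x (g x)%:E = \int[mu]_x (g (x + m))%:E)%E.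
Proof.
move=> cg g0.
have dE : (fun x : R => x + m)^`()%classic = cst 1.
  apply/funext => x; rewrite derive1E deriveD//.
  by rewrite derive_id derive_cst addr0.
rewrite (@increasing_ge0_integration_by_substitutionT _ (fun x => x + m) g)//.
- by apply: eq_integral => x _; rewrite dE /= mulr1.
- by move=> x y; rewrite ltrD2r.
- by rewrite dE => x; exact: cvg_cst.
- by rewrite dE; exact: is_cvg_cst.
- by rewrite dE; exact: is_cvg_cst.
- exact: cvg_addrr_Ny.
- exact: cvg_addrr.
Qed.

Variables (s : R).
Hypothesis s0 : 0 < s.
Local Notation N := (normal_prob 0 s).

Let measurable_shift (g : R -> R) (m : R) : measurable_fun [set: R] g ->
  measurable_fun [set: R] (fun x : R => g (x + m)).
Proof.
move=> mg; apply: (@measurableT_comp _ _ _ R R R g _ (fun x : R => x + m)) => //.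
exact: measurable_funD.
Qed.

Let measurable_scale (g : R -> R) (m : R) : measurable_fun [set: R] g ->
  measurable_fun [set: R] (fun x : R => g (m * x)).
Proof.
move=> mg; apply: (@measurableT_comp _ _ _ R R R g _ (fun x : R => m * x)) => //.
exact: measurable_funM.
Qed.

(** Completing the square: exp (t x) times the density centred at 0 is a constant times the density
    centred at s^2 t, and a translation recentres it. *)
Lemma normal_tilt (t : R) (g : R -> R) : continuous g -> (forall x, 0 <= g x) ->
  (\int[N]_x (expR (t * x) * g x)%:E =
   (expR (s ^+ 2 * t ^+ 2 / 2))%:E * \int[N]_x (g (x + s ^+ 2 * t))%:E)%E.
Proof.
move=> cg g0; have sn0 : s != 0 by rewrite gt_eqF.
have mg : measurable_fun setT g by exact: continuous_measurable_fun.
have mgs : measurable_fun setT (fun x : R => g (x + s ^+ 2 * t)).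
  exact: measurable_shift.
have cpdf m : continuous (normal_pdf m s) by exact: continuous_normal_pdf.
rewrite ge0_integral_normal_prob; last 2 first.
- apply/measurable_EFinP; apply: measurable_funM => //.
  exact: measurable_scale.
- by move=> x; rewrite lee_fin mulr_ge0// expR_ge0.
rewrite ge0_integral_normal_prob//; last 2 first.
- exact/measurable_EFinP.
- by move=> x; rewrite lee_fin.
rewrite -ge0_integralZl//; last 2 first.
- apply: emeasurable_funM; apply/measurable_EFinP => //.
  exact: measurable_normal_pdf.
- by move=> x _; rewrite -EFinM lee_fin mulr_ge0// normal_pdf_ge0.
under [LHS]eq_integral do rewrite -EFinM.
rewrite (@integral_lebesgue_shift (s ^+ 2 * t)).
- apply: eq_integral => x _; rewrite -[RHS]/((_ * (_ * _))%:E); congr (_%:E).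
  rewrite !normal_pdfE// /normal_fun.
  set a := expR _; set b := expR _; set c := expR _; set e := expR _.
  have E : a * b = c * e by rewrite /a /b /c /e -!expRD; congr expR; field.
  have -> : a * g (x + s ^+ 2 * t) * (normal_peak s * b) =
    g (x + s ^+ 2 * t) * normal_peak s * (a * b) by ring.
  by rewrite E; ring.
- move=> x; apply: cvgM; last exact: cpdf.
  apply: cvgM; last exact: cg.
  apply: (@continuous_comp _ _ _ (fun x => t * x) expR).
    exact: mulrl_continuous.
  exact: continuous_expR.
- by move=> x; rewrite !mulr_ge0// ?expR_ge0 ?normal_pdf_ge0.
Qed.

Let normal_tilt1 (t : R) :
  (\int[N]_x (expR (t * x))%:E = (expR (s ^+ 2 * t ^+ 2 / 2))%:E)%E.
Proof.
have := @normal_tilt t (fun=> 1) (fun=> cvg_cst _) (fun=> ler01).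
rewrite integral_cst//= mul1e [X in (_ * X)%E]probability_setT mule1 => <-.
by apply: eq_integral => x _; rewrite mulr1.
Qed.

Lemma normal_integrable_expR (t : R) :
  N.-integrable [set: R] (EFin \o (fun x => expR (t * x))).
Proof.
apply/integrableP; split.
  by apply/measurable_EFinP; exact: measurable_scale.
under eq_integral do rewrite /= ger0_norm ?expR_ge0//.
by rewrite normal_tilt1 ltry.
Qed.

Lemma normal_mgf (t : R) :
  \int[N]_x expR (t * x) = expR (s ^+ 2 * t ^+ 2 / 2).
Proof. by rewrite /Rintegral normal_tilt1. Qed.

Definition gauss_cos (a b : R) : R := \int[N]_x cos (a * x + b).

Lemma bm_gauss_cos (a b : R) : bounded_measurable (fun x : R => cos (a * x + b)).
Proof. by apply: bm_cos; apply: measurable_funD => //; exact: measurable_funM. Qed.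

Lemma normal_integrable_expRM (t : R) (f : R -> R) : bounded_measurable f ->
  N.-integrable [set: R] (EFin \o (fun x => expR (t * x) * f x)).
Proof.
move=> [mf [M fM]].
have := integrableMl measurableT (normal_integrable_expR t) mf.
rewrite /=; apply; exists M; split; first exact: num_real.
by move=> K MK x _; apply: (le_trans (fM x)); exact: ltW.
Qed.

Lemma normal_tilt_cos (t a b : R) :
  \int[N]_x (expR (t * x) * cos (a * x + b)) =
  expR (s ^+ 2 * t ^+ 2 / 2) * gauss_cos a (b + a * (s ^+ 2 * t)).
Proof.
(* [normal_tilt] asks for a nonnegative function; the 1 added here is cancelled at the end by
   [normal_mgf]. *)
have cg : continuous (fun x : R => 1 + cos (a * x + b)).
  move=> x; apply: cvgD; first exact: cvg_cst.
  apply: (@continuous_comp _ _ _ (fun x => a * x + b) cos); last exact: continuous_cos.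
  by apply: cvgD; [exact: mulrl_continuous|exact: cvg_cst].
have g0 x : 0 <= 1 + cos (a * x + b) by have := cos_geN1 (a * x + b); lra.
have bc : bounded_measurable (fun x : R => cos (a * (x + s ^+ 2 * t) + b)).
  apply: bm_cos; apply: measurable_funD => //; apply: measurable_funM => //.
  exact: measurable_funD.
have b1c := bmD (bm_cst 1) bc.
have := normal_tilt t cg g0.
move=> /(congr1 fine); rewrite fineM//; last first.
  by apply: integrable_fin_num => //; exact: (bm_integrable N b1c).
rewrite -![fine (integral _ _ _)]/(Rintegral _ _ _) /=.
under eq_Rintegral do rewrite mulrDr mulr1.
rewrite RintegralD//; last 2 first.
- exact: normal_integrable_expR.
- by apply: normal_integrable_expRM; exact: bm_gauss_cos.
rewrite normal_mgf (expD N (bm_cst 1) bc).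
rewrite exp_cst mulrDr mulr1 => /addrI ->; congr (_ * _).
by apply: eq_Rintegral => x _; congr cos; ring.
Qed.

Lemma gauss_cosD (a b u : R) :
  gauss_cos a (b + u) = cos u * gauss_cos a b + sin u * gauss_cos a (b + pi / 2).
Proof.
rewrite /gauss_cos -!expZ; try exact: bm_gauss_cos.
rewrite -expD; try by apply: bmZ; exact: bm_gauss_cos.
apply: eq_Rintegral => x _.
rewrite (addrA _ b u) (addrA _ b (pi / 2)) cosDpihalf cosD; ring.
Qed.

(* Dominates 1, |x|, x^2, x^4 and x^2 e^|x|. *)
Let D (x : R) := 256 * (expR x + expR (- x)) ^+ 2.

Let D_integrable : N.-integrable [set: R] (EFin \o D).
Proof.
rewrite (_ : EFin \o D = (fun x => 256%:E * ((expR (2 * x))%:E +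
    (2%:E + (expR ((-2) * x))%:E)))%E).
  apply: integrableZl => //; apply: integrableD => //.
    exact: normal_integrable_expR.
  apply: integrableD => //; last exact: normal_integrable_expR.
  exact: (bm_integrable _ (bm_cst 2)).
apply/funext => x; rewrite /D /= -!EFinD -EFinM; congr (_%:E).
rewrite mulNr (_ : 2 * x = x + x); last by ring.
rewrite opprD !expRD sqrrD -!expr2.
by have := expRxMexpNx_1 x => ->; ring.
Qed.

Let e_ge (x : R) : expR `|x| <= expR x + expR (- x).
Proof.
have [x0|x0] := leP 0 x; first by rewrite ger0_norm// lerDl expR_ge0.
by rewrite ltr0_norm// lerDr expR_ge0.
Qed.

Let e_abs_ge1 (x : R) : 1 <= expR `|x|.
Proof. by have := expR_ge1Dx `|x|; have := normr_ge0 x; lra. Qed.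

Let D_x4 (x : R) : x ^+ 4 <= D x.
Proof.
have h : `|x| / 4 <= expR (`|x| / 4) by have := expR_ge1Dx (`|x| / 4); lra.
have h4 : (`|x| / 4) ^+ 4 <= expR (`|x| / 4) ^+ 4.
  by rewrite lerXn2r ?nnegrE ?expR_ge0 ?divr_ge0.
move: h4; rewrite -expRM_natr divfK// expr_div_n => h4.
have -> : x ^+ 4 = `|x| ^+ 4 by rewrite -normrX ger0_norm// exprn_even_ge0.
move: h4; rewrite ler_pdivrMr// => h4; apply: (le_trans h4).
rewrite /D mulrC; apply: ler_pM => //; rewrite ?expR_ge0//; first by lra.
have := e_ge x; have := e_abs_ge1 x => h1 h2; rewrite expr2.
by rewrite (le_trans h2)// ler_peMr ?(le_trans h1)//; exact: le_trans h2.
Qed.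

Let D_x2e (x : R) : x ^+ 2 * expR `|x| <= D x.
Proof.
have h : `|x| / 2 <= expR (`|x| / 2) by have := expR_ge1Dx (`|x| / 2); lra.
have h4 : (`|x| / 2) ^+ 2 <= expR (`|x| / 2) ^+ 2.
  by rewrite lerXn2r ?nnegrE ?expR_ge0 ?divr_ge0.
move: h4; rewrite -expRM_natr divfK// expr_div_n ler_pdivrMr// real_normK ?num_real// => h4.
have h2 := e_ge x; have h0 := expR_ge0 `|x|.
have h3 : expR `|x| ^+ 2 <= (expR x + expR (- x)) ^+ 2.
  by rewrite lerXn2r ?nnegrE// (le_trans h0 h2).
have : x ^+ 2 * expR `|x| <= expR `|x| * 2 ^+ 2 * expR `|x| by rewrite ler_wpM2r.
move: h3; rewrite /D !expr2; set A := _ * _; set B := (_ + _) * _ => h3 h5.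
have A0 : 0 <= A by rewrite mulr_ge0.
rewrite (le_trans h5)// (_ : _ * _ * _ = 4 * A); last by rewrite /A; ring.
by lra.
Qed.

Let D_x2 (x : R) : x ^+ 2 <= D x.
Proof. by rewrite (le_trans _ (D_x2e x))// ler_peMr ?sqr_ge0. Qed.

Let D_x1 (x : R) : `|x| <= D x.
Proof.
have h := D_x2e x; have h1 := e_abs_ge1 x; have h2 := e_ge x.
have h3 : `|x| <= expR `|x| by have := expR_ge1Dx `|x|; lra.
rewrite /D; apply: (le_trans h3); apply: (le_trans h2).
have h4 : 1 <= expR x + expR (- x) by lra.
rewrite expr2; set y := expR x + _ in h4 *; nra.
Qed.

Lemma normal_integrable_dominated (f : R -> R) : measurable_fun [set: R] f ->
  (forall x, `|f x| <= D x) -> N.-integrable [set: R] (EFin \o f).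
Proof.
move=> mf fD; apply: le_integrable D_integrable => //.
  exact/measurable_EFinP.
by move=> x _ /=; rewrite lee_fin (le_trans (fD x))// ler_norm.
Qed.

Lemma normal_integrable_id : N.-integrable [set: R] (EFin \o id).
Proof. by apply: normal_integrable_dominated => //; exact: D_x1. Qed.

Lemma normal_integrable_sqr : N.-integrable [set: R] (EFin \o (fun x => x ^+ 2)).
Proof.
apply: normal_integrable_dominated => // x.
by rewrite ger0_norm ?sqr_ge0.
Qed.

Lemma normal_integrable_pow4 : N.-integrable [set: R] (EFin \o (fun x => x ^+ 4)).
Proof.
apply: normal_integrable_dominated => // x.
by rewrite ger0_norm// exprn_even_ge0.
Qed.

Lemma normal_integrable_idM (f : R -> R) : measurable_fun [set: R] f ->
  (forall x, `|f x| <= 1) -> N.-integrable [set: R] (EFin \o (fun x => x * f x)).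
Proof.
move=> mf f1; apply: normal_integrable_dominated; first exact: measurable_funM.
by move=> x; rewrite normrM (le_trans _ (D_x1 x))// ler_piMr.
Qed.

(* Gaussian integration by parts, obtained by differentiating
   [normal_tilt_cos] at [t = 0]. *)
Lemma normal_stein (a b : R) :
  \int[N]_x (x * cos (a * x + b)) = a * s ^+ 2 * gauss_cos a (b + pi / 2).
Proof.
pose F t := \int[N]_x (expR (t * x) * cos (a * x + b)).
have mc : measurable_fun setT (fun x : R => cos (a * x + b)).
  by have [] := bm_gauss_cos a b.
have c1 x : `|cos (a * x + b)| <= 1 by exact: cos_max.
have d1 : is_derive (0 : R) (1 : R) F (\int[N]_x (x * cos (a * x + b))).
  apply: (@is_derive_quad _ _ _ _ (\int[N]_x D x)) => h h1.
  have ixc := normal_integrable_idM mc c1.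
  have i0 : N.-integrable setT (EFin \o (fun x => expR (h * x) * cos (a * x + b))).
    by apply: normal_integrable_expRM; exact: bm_gauss_cos.
  have i1 : N.-integrable setT (EFin \o (fun x => cos (a * x + b))).
    by apply: bm_integrable; exact: bm_gauss_cos.
  rewrite add0r /F -RintegralZl//.
  rewrite [X in _ - X - _](_ : _ = \int[N]_x (cos (a * x + b))); last first.
    by apply: eq_Rintegral => x _; rewrite mul0r expR0 mul1r.
  rewrite -RintegralB// -RintegralB//; last 2 first.
  - by have := integrableB measurableT i0 i1.
  - by have := integrableZl measurableT h ixc.
  have mG : measurable_fun setT (fun x : R => expR (h * x) * cos (a * x + b) -
     cos (a * x + b) - h * (x * cos (a * x + b))).
    have me : measurable_fun setT (fun x : R => expR (h * x)).
      exact: measurable_scale.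
    apply: measurable_funB; first by apply: measurable_funB => //; exact: measurable_funM.
    by apply: measurable_funM => //; exact: measurable_funM.
  have GD x : `|expR (h * x) * cos (a * x + b) -
     cos (a * x + b) - h * (x * cos (a * x + b))| <= h ^+ 2 * D x.
    rewrite (_ : _ - _ = (expR (h * x) - 1 - h * x) * cos (a * x + b)); last by ring.
    rewrite normrM (@le_trans _ _ ((h * x) ^+ 2 * expR `|h * x|))//.
      rewrite (le_trans _ (expR_taylor1 (h * x)))// ler_piMr//.
    rewrite exprMn -mulrA ler_wpM2l ?sqr_ge0// (le_trans _ (D_x2e x))//.
    by rewrite ler_wpM2l ?sqr_ge0// ler_expR normrM ler_piMl.
  have iD : N.-integrable setT (EFin \o (fun x => h ^+ 2 * D x)).
    by have := integrableZl measurableT (h ^+ 2) D_integrable.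
  have iG : N.-integrable setT (EFin \o (fun x : R => expR (h * x) * cos (a * x + b) -
     cos (a * x + b) - h * (x * cos (a * x + b)))).
    apply: le_integrable iD => //; first exact/measurable_EFinP.
    by move=> x _ /=; rewrite lee_fin (le_trans (GD x))// ler_norm.
  rewrite (le_trans (le_normr_Rintegral _ iG))// mulrC -RintegralZl//.
  by apply: le_Rintegral => //; have := integrable_norm iG.
have d2 : is_derive (0 : R) (1 : R) F (a * s ^+ 2 * gauss_cos a (b + pi / 2)).
  rewrite (_ : F = (fun t => expR (s ^+ 2 / 2 * (t * t)) *
     (cos (a * s ^+ 2 * t) * gauss_cos a b +
      sin (a * s ^+ 2 * t) * gauss_cos a (b + pi / 2)))); last first.
    apply/funext => t; rewrite /F normal_tilt_cos gauss_cosD.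
    by congr (expR _ * (cos _ * _ + sin _ * _)); rewrite ?expr2; ring.
  apply: trigger_derive; rewrite /GRing.scale/= !mulr0 expR0 cos0 sin0.
  by ring.
by rewrite -(@derive_val _ _ _ _ _ _ _ d1) -(@derive_val _ _ _ _ _ _ _ d2).
Qed.

(** By [normal_stein], y(a) = [gauss_cos a b] solves y' = - a s^2 y, so its product with exp (s^2
    a^2 / 2) is constant, equal to its value cos b at a = 0. *)
Lemma gauss_cosE (a b : R) : gauss_cos a b = expR (- (a ^+ 2 * s ^+ 2 / 2)) * cos b.
Proof.
have d1 x : is_derive x (1 : R) (fun y => gauss_cos y b) (- (x * s ^+ 2) * gauss_cos x b).
  have -> : - (x * s ^+ 2) * gauss_cos x b = \int[N]_y (y * cos (x * y + (b + pi / 2))).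
    rewrite normal_stein mulNr -mulrN; congr (_ * _).
    rewrite /gauss_cos -[LHS]mulN1r -expZ; last exact: bm_gauss_cos.
    apply: eq_Rintegral => y _.
    by rewrite addrA (addrA _ b) !cosDpihalf sinDpihalf mulN1r.
  apply: (@is_derive_quad _ _ _ _ (\int[N]_x D x)) => h h1.
  rewrite /gauss_cos.
  have mc : measurable_fun setT (fun y : R => cos (x * y + (b + pi / 2))).
    by have [] := bm_gauss_cos x (b + pi / 2).
  have c1 y : `|cos (x * y + (b + pi / 2))| <= 1 by exact: cos_max.
  have ixc := normal_integrable_idM mc c1.
  have bmB1 := bmB (bm_gauss_cos (x + h) b) (bm_gauss_cos x b).
  rewrite -expB; try exact: bm_gauss_cos.
  rewrite -RintegralZl// -RintegralB//; last 2 first.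
  - exact: bm_integrable.
  - by have := integrableZl measurableT h ixc.
  set G := fun y => _.
  have mG : measurable_fun setT G.
    apply: measurable_funB; first by have [] := bmB1.
    by apply: measurable_funM => //; exact: measurable_funM.
  have GD y : `|G y| <= h ^+ 2 * D y.
    rewrite /G; set A := x * y + b; set w := h * y.
    have -> : (x + h) * y + b = A + w by rewrite /A /w; ring.
    have -> : x * y + (b + pi / 2) = A + pi / 2 by rewrite /A; ring.
    rewrite cosD cosDpihalf.
    rewrite (_ : _ - _ = cos A * (cos w - 1) - sin A * (sin w - w)); last first.
      by rewrite /w; ring.
    rewrite (le_trans (ler_normB _ _))// !normrM.
    have hc : `|cos A| * `|cos w - 1| <= w ^+ 2.
      by rewrite (le_trans _ (normr_cosB1_le w))// ler_piMl// cos_max.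
    have hs : `|sin A| * `|sin w - w| <= `|w| ^+ 3.
      by rewrite (le_trans _ (normr_sinB_le w))// ler_piMl// sin_max.
    apply: (le_trans (lerD hc hs)).
    have -> : w ^+ 2 + `|w| ^+ 3 = h ^+ 2 * (y ^+ 2 * (1 + `|h| * `|y|)).
      rewrite (exprS _ 2) real_normK ?num_real// /w normrM exprMn; ring.
    rewrite ler_wpM2l ?sqr_ge0// (le_trans _ (D_x2e y))// ler_wpM2l ?sqr_ge0//.
    by rewrite (le_trans _ (expR_ge1Dx _))// lerD2l ler_piMl.
  have iD : N.-integrable setT (EFin \o (fun x => h ^+ 2 * D x)).
    by have := integrableZl measurableT (h ^+ 2) D_integrable.
  have iG : N.-integrable setT (EFin \o G).
    apply: le_integrable iD => //; first exact/measurable_EFinP.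
    by move=> y _ /=; rewrite lee_fin (le_trans (GD y))// ler_norm.
  rewrite (le_trans (le_normr_Rintegral _ iG))// mulrC -RintegralZl//.
  by apply: le_Rintegral => //; have := integrable_norm iG.
have d2 x : is_derive x (1 : R) (fun y => expR (s ^+ 2 / 2 * (y * y)) * gauss_cos y b) 0.
  apply: trigger_derive; rewrite /GRing.scale/=.
  by field.
have := is_derive_0_is_cst a 0 d2.
rewrite !mulr0 expR0 mul1r [in RHS]/gauss_cos.
under [in RHS]eq_Rintegral do rewrite mul0r add0r.
rewrite exp_cst => <-; rewrite mulrA -expRD.
rewrite (_ : _ + _ = 0); first by rewrite expR0 mul1r.
by field.
Qed.

Lemma normal_mean : \int[N]_x x = 0.
Proof.
have := normal_stein 0 0; rewrite !mul0r => H; rewrite -[RHS]H.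
by apply: eq_Rintegral => x _; rewrite mul0r addr0 cos0 mulr1.
Qed.

(** The second moment is the derivative at t = 0 of the mean of x sin (t x), which [normal_stein]
    makes explicit; the phase - pi / 2 turns its cosine into a sine. *)
Lemma normal_second_moment : \int[N]_x (x ^+ 2) = s ^+ 2.
Proof.
pose F t := \int[N]_x (x * cos (t * x + - (pi / 2))).
have FE t : F t = t * s ^+ 2 * expR (- (t ^+ 2 * s ^+ 2 / 2)).
  by rewrite /F normal_stein addNr gauss_cosE cos0 mulr1.
have d1 : is_derive (0 : R) (1 : R) F (\int[N]_x (x ^+ 2)).
  apply: (@is_derive_quad _ _ _ _ (\int[N]_x (x ^+ 4))) => h h1.
  rewrite add0r (FE 0) !mul0r subr0 /F -RintegralZl//; last exact: normal_integrable_sqr.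
  have mc : measurable_fun setT (fun y : R => cos (h * y + - (pi / 2))).
    by have [] := bm_gauss_cos h (- (pi / 2)).
  have c1 y : `|cos (h * y + - (pi / 2))| <= 1 by exact: cos_max.
  rewrite -RintegralB//; last 2 first.
  - exact: normal_integrable_idM.
  - by have := integrableZl measurableT h normal_integrable_sqr.
  set G := fun y => _.
  have mG : measurable_fun setT G.
    apply: measurable_funB; first exact: measurable_funM.
    by apply: measurable_funM.
  have GD y : `|G y| <= h ^+ 2 * y ^+ 4.
    rewrite /G cosBpihalf (_ : _ - _ = y * (sin (h * y) - h * y)); last by ring.
    rewrite normrM (@le_trans _ _ (`|y| * `|h * y| ^+ 3))//.
      by rewrite ler_wpM2l// normr_sinB_le.
    rewrite normrM exprMn.
    have -> : `|y| * (`|h| ^+ 3 * `|y| ^+ 3) = `|h| * ((`|h| ^+ 2) * `|y| ^+ 4) by ring.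
    rewrite -[`|y| ^+ 4]normrX [`|y ^+ 4|]ger0_norm ?exprn_even_ge0//.
    by rewrite real_normK ?num_real// ler_piMl// mulr_ge0 ?sqr_ge0// exprn_even_ge0.
  have iD : N.-integrable setT (EFin \o (fun x => h ^+ 2 * x ^+ 4)).
    by have := integrableZl measurableT (h ^+ 2) normal_integrable_pow4.
  have iG : N.-integrable setT (EFin \o G).
    apply: le_integrable iD => //; first exact/measurable_EFinP.
    by move=> y _ /=; rewrite lee_fin (le_trans (GD y))// ler_norm.
  rewrite (le_trans (le_normr_Rintegral _ iG))// mulrC -RintegralZl//; last exact: normal_integrable_pow4.
  by apply: le_Rintegral => //; have := integrable_norm iG.
have d2 : is_derive (0 : R) (1 : R) F (s ^+ 2).
  rewrite (_ : F = (fun t => t * (s ^+ 2 * expR (- (s ^+ 2 / 2) * (t * t))))); last first.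
    by apply/funext => t; rewrite FE -mulrA; congr (_ * (_ * expR _)); ring.
  apply: trigger_derive; rewrite /GRing.scale/= !mulr0 expR0.
  by ring.
by rewrite -(@derive_val _ _ _ _ _ _ _ d1) -(@derive_val _ _ _ _ _ _ _ d2).
Qed.

End normal_law.

(** * Measurability of functions of finitely many coordinates *)

Section cylinder_measurability.
Context d (T : measurableType d) (R : realType).

Lemma measurable_fun_gt (f : T -> R) :
  (forall c, measurable [set w | c < f w]) -> measurable_fun [set: T] f.
Proof.
move=> mf; move=> mT; apply: (measurability _ (RGenOInfty.measurableE R)) => //.
move=> _ [_ [c ->] <-]; rewrite setTI.
rewrite (_ : _ @^-1` _ = [set w | c < f w])//.
by apply/seteqP; split=> x /=; rewrite in_itv/= andbT.
Qed.

Variable V : T -> nat -> R.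
Hypothesis mV : forall i, measurable_fun [set: T] (V ^~ i).

Lemma measurable_box (N : nat) (x : nat -> R) (e : R) :
  measurable [set w | forall i, (i < N)%N -> `|V w i - x i| < e].
Proof.
rewrite (_ : mkset _ = \bigcap_(i in [set i | (i < N)%N])
    [set w | `|V w i - x i| < e]); last first.
  by apply/seteqP; split=> w /= H i; exact: H.
apply: bigcap_measurableType => i _.
apply: measurable_set_lt => //; apply: measurableT_comp => //.
exact: measurable_funB.
Qed.

(* A relatively open set of sequences is a countable union of rational boxes. *)
Lemma measurable_locally_determined (S O : set (nat -> R)) :
  (forall x, S x -> O x -> exists (N : nat) (e : R), 0 < e /\
     forall y, S y -> (forall i, (i < N)%N -> `|y i - x i| < e) -> O y) ->
  measurable [set w | S (V w)] -> measurable [set w | S (V w) /\ O (V w)].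
Proof.
move=> HO mS.
pose box (qm : seq rat * nat) (y : nat -> R) := forall i, (i < size qm.1)%N ->
  `|y i - ratr (nth 0 qm.1 i)| < qm.2.+1%:R^-1.
pose good qm := forall y, S y -> box qm y -> O y.
pose U n : set T := [set w | exists qm : seq rat * nat, unpickle n = Some qm /\
   good qm /\ box qm (V w)].
have -> : [set w | S (V w) /\ O (V w)] = [set w | S (V w)] `&` \bigcup_n U n.
  apply/seteqP; split=> w /= [SV].
    move=> /(HO _ SV)[N [e [e0 He]]]; split=> //.
    have [m me] : exists m : nat, m.+1%:R^-1 < e / 2.
      have /ltr_add_invr[m] : 0 < e / 2 by rewrite divr_gt0.
      by rewrite add0r => ?; exists m.
    have /choice[q Hq] : forall i, exists q : rat, `|V w i - ratr q| < m.+1%:R^-1.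
      move=> i; have m0 : 0 < m.+1%:R^-1 :> R by rewrite invr_gt0.
      have /rat_in_itvoo[q] : V w i - m.+1%:R^-1 < V w i + m.+1%:R^-1.
        by rewrite ltrBlDr -addrA ltrDl addr_gt0.
      rewrite inE/= => /itvP qV; exists q.
      by rewrite distrC ltr_distl !qV.
    exists (pickle (mkseq q N, m)) => //; exists (mkseq q N, m); split; first by rewrite pickleK.
    split.
      move=> y Sy /= By; apply: He => // i iN.
      have := By i; rewrite /= size_mkseq => /(_ iN); rewrite nth_mkseq// => h1.
      have h2 := Hq i; rewrite (le_lt_trans (ler_distD (ratr (q i)) _ _))//.
      by rewrite (distrC (ratr (q i))) [e]splitr ltrD// (lt_trans _ me).
    by move=> i /=; rewrite size_mkseq => iN; rewrite nth_mkseq.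
  move=> [n _ [qm [_ [gqm bqm]]]]; split=> //; exact: gqm.
apply: measurableI => //; apply: bigcupT_measurable => n.
rewrite /U; case: (unpickle n) => [qm|]; last first.
  by rewrite (_ : mkset _ = set0)//; apply/seteqP; split=> w // [? []].
have [gqm|ngqm] := pselect (good qm); last first.
  rewrite (_ : mkset _ = set0)//; apply/seteqP; split=> w // -[? [[<-] [? _]]].
  exact: ngqm.
rewrite (_ : mkset _ = [set w | box qm (V w)]); first exact: measurable_box.
apply/seteqP; split=> w /=; first by move=> [? [[<-] []]].
by move=> b; exists qm.
Qed.

Lemma measurable_lipschitz (N : nat) (C : R) (g : (nat -> R) -> R) :
  (forall x y, `|g x - g y| <= C * \sum_(i < N) `|x i - y i|) ->
  measurable_fun [set: T] (fun w => g (V w)).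
Proof.
move=> gC; apply: measurable_fun_gt => c.
rewrite (_ : mkset _ = [set w | [set: nat -> R] (V w) /\ [set x | c < g x] (V w)]).
  apply: measurable_locally_determined; last first.
    by rewrite (_ : mkset _ = setT)//; apply/seteqP; split.
  move=> x _ /= cx; exists N; exists ((g x - c) / ((`|C| + 1) * (N%:R + 1))).
  have D0 : 0 < (`|C| + 1) * (N%:R + 1) by rewrite mulr_gt0// ltr_wpDl.
  split; first by rewrite divr_gt0// subr_gt0.
  move=> y _ H; have : `|g y - g x| < g x - c.
    apply: (le_lt_trans (gC _ _)).
    apply: (@le_lt_trans _ _ (`|C| * \sum_(i < N) `|y i - x i|)).
      by rewrite ler_wpM2r ?ler_norm// sumr_ge0.
    apply: (@le_lt_trans _ _ (`|C| * (N%:R * ((g x - c) / ((`|C| + 1) * (N%:R + 1)))))).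
      rewrite ler_wpM2l// -[X in X%:R * _](card_ord N) -sumr_const mulr_suml.
      by apply: ler_sum => i _; rewrite mul1r ltW// H.
    have -> : `|C| * (N%:R * ((g x - c) / ((`|C| + 1) * (N%:R + 1)))) =
      (g x - c) * ((`|C| * N%:R) / ((`|C| + 1) * (N%:R + 1))) by ring.
    rewrite gtr_pMr ?subr_gt0//.
    rewrite ltr_pdivrMr// mul1r.
    by have := normr_ge0 C; have : 0 <= N%:R :> R by []; nra.
  by rewrite ltr_norml => /andP[]; lra.
by apply/seteqP; split=> x //= [].
Qed.

End cylinder_measurability.

(** * Uniform approximation by trigonometric sums *)

Section trigonometric_approximation.
Context {R : realType}.
Variable N : nat.
Implicit Types f g h : (nat -> R) -> R.

(** Sums of cosines of affine forms: the expectations of these functions are what cosine transforms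
    control. The phase [b] covers sines, and the product formula for cosines makes the class an
    algebra ([trigM]). *)
Inductive trig : ((nat -> R) -> R) -> Prop :=
| trig_cos (c : R) (a : nat -> R) (b : R) :
    trig (fun x : nat -> R => c * cos (\sum_(i < N) a i * x i + b))
| trig_add f g : trig f -> trig g -> trig (fun x : nat -> R => f x + g x).

Lemma eq_trig f g : g =1 f -> trig f -> trig g.
Proof. by move=> /funext ->. Qed.

Lemma trig_bounded f : trig f -> exists M, forall x, `|f x| <= M.
Proof.
elim=> [c a b|{}f g _ [M1 H1] _ [M2 H2]].
  by exists `|c| => x; rewrite normrM ler_piMr// cos_max.
by exists (M1 + M2) => x; rewrite (le_trans (ler_normD _ _))// lerD.
Qed.

Lemma trig_cosM (c : R) (a : nat -> R) (b : R) f : trig f ->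
  trig (fun x : nat -> R => c * cos (\sum_(i < N) a i * x i + b) * f x).
Proof.
elim=> [c' a' b'|{}f g _ tf _ tg].
  apply: (eq_trig (f := fun x : nat -> R =>
      c * c' / 2 * cos (\sum_(i < N) (a i + a' i) * x i + (b + b')) +
      c * c' / 2 * cos (\sum_(i < N) (a i - a' i) * x i + (b - b')))); last first.
    exact: (trig_add (trig_cos _ (fun i => a i + a' i) _)
      (trig_cos _ (fun i => a i - a' i) _)).
  move=> x.
  under [in RHS]eq_bigr do rewrite mulrDl.
  under [X in cos (X + (b - b'))]eq_bigr do rewrite mulrBl.
  rewrite big_split/= sumrB.
  set A := \sum_(i < N) a i * x i; set A' := \sum_(i < N) a' i * x i.
  have -> : A + A' + (b + b') = (A + b) + (A' + b') by ring.
  have -> : A - A' + (b - b') = (A + b) - (A' + b') by ring.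
  by rewrite (cosB (A + b)) (cosD (A + b) (A' + b')); field.
apply: (eq_trig _ (trig_add tf tg)) => x.
by rewrite mulrDr.
Qed.

Lemma trigM f g : trig f -> trig g -> trig (fun x : nat -> R => f x * g x).
Proof.
move=> tf tg; elim: tf => [c a b|f1 f2 _ t1 _ t2]; first exact: trig_cosM.
by apply: (eq_trig _ (trig_add t1 t2)) => x; rewrite mulrDl.
Qed.

Lemma trig_cst c : trig (fun=> c).
Proof.
have := trig_cos c (fun=> 0) 0; congr trig; apply/funext => x.
by rewrite big1 ?addr0 ?cos0 ?mulr1// => i _; rewrite mul0r.
Qed.

(** The approximation is uniform on the whole space and not only on compact sets, so these functions
    are bounded; they form an algebra and a lattice. *)
Definition trig_approx f := forall e : R, 0 < e ->
  exists2 h, trig h & forall x, `|f x - h x| <= e.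

Lemma approx_trig f : trig f -> trig_approx f.
Proof. by move=> tf e e0; exists f => // x; rewrite subrr normr0 ltW. Qed.

Lemma approx_bounded f : trig_approx f -> exists2 M, 0 < M & forall x, `|f x| <= M.
Proof.
move=> /(_ 1 ltr01)[h /trig_bounded[M hM] fh].
exists (`|M| + 1); first by rewrite ltr_wpDl.
move=> x; have := fh x; have := hM x; have := ler_norm M.
have : `|f x| <= `|f x - h x| + `|h x|.
  by have := ler_normD (f x - h x) (h x); rewrite subrK.
by lra.
Qed.

Lemma approx_lim f : (forall e, 0 < e -> exists2 g, trig_approx g &
  forall x, `|f x - g x| <= e) -> trig_approx f.
Proof.
move=> H e e0; have e2 : 0 < e / 2 by rewrite divr_gt0.
have [g ag fg] := H _ e2; have [h th gh] := ag _ e2.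
exists h => // x; have := fg x; have := gh x.
have := ler_distD (g x) (f x) (h x); lra.
Qed.

Lemma approxD f g : trig_approx f -> trig_approx g ->
  trig_approx (fun x : nat -> R => f x + g x).
Proof.
move=> af ag e e0; have e2 : 0 < e / 2 by rewrite divr_gt0.
have [f' tf ff'] := af _ e2; have [g' tg gg'] := ag _ e2.
exists (fun x : nat -> R => f' x + g' x); first exact: trig_add.
move=> x; have := ff' x; have := gg' x.
have := ler_normD (f x - f' x) (g x - g' x).
rewrite (_ : f x - f' x + _ = f x + g x - (f' x + g' x)); last by ring.
lra.
Qed.

Lemma approxM f g : trig_approx f -> trig_approx g ->
  trig_approx (fun x : nat -> R => f x * g x).
Proof.
move=> af ag; have [M1 M10 fM] := approx_bounded af.
have [M2 M20 gM] := approx_bounded ag.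
move=> e e0; pose e1 := Num.min 1 (e / (M1 + M2 + 1)).
have D0 : 0 < M1 + M2 + 1 by rewrite !addr_gt0.
have e10 : 0 < e1 by rewrite lt_min ltr01 divr_gt0.
have e11 : e1 <= 1 by rewrite ge_min lexx.
have e1e : e1 * (M1 + M2 + 1) <= e.
  by rewrite -ler_pdivlMr// ge_min lexx orbT.
have [f' tf ff'] := af _ e10; have [g' tg gg'] := ag _ e10.
exists (fun x : nat -> R => f' x * g' x); first exact: trigM.
move=> x; rewrite (_ : _ - _ = f x * (g x - g' x) + (f x - f' x) * g' x); last by ring.
rewrite (le_trans (ler_normD _ _))// !normrM.
have h1 : `|f x| * `|g x - g' x| <= M1 * e1 by apply: ler_pM.
have g'M : `|g' x| <= M2 + 1.
  have := gg' x; have := gM x; have := ler_normB (g x) (g x - g' x).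
  by rewrite opprB addrCA subrr addr0; lra.
have h2 : `|f x - f' x| * `|g' x| <= e1 * (M2 + 1) by apply: ler_pM.
by nra.
Qed.

Lemma approxZ c f : trig_approx f -> trig_approx (fun x : nat -> R => c * f x).
Proof. by move=> af; apply: approxM => //; apply/approx_trig/trig_cst. Qed.

Lemma approx_sum (I : Type) (r : seq I) (F : I -> (nat -> R) -> R) :
  (forall i, trig_approx (F i)) -> trig_approx (fun x : nat -> R => \sum_(i <- r) F i x).
Proof.
move=> aF; elim: r => [|i r IH].
  by under eq_fun do rewrite big_nil; apply/approx_trig/trig_cst.
by under eq_fun do rewrite big_cons; exact: approxD.
Qed.

(* The iterates of [p |-> p + (t^2 - p^2) / 2] converge to |t| uniformly
   for |t| <= 1. *)
Let abs_seq f := fix p n : (nat -> R) -> R :=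
  if n is m.+1 then fun x => p m x + 2^-1 * (f x * f x + (-1) * (p m x * p m x))
  else fun=> 0.

(** The error u = t - p, with t = |f x|, becomes u (1 - (t + p) / 2) ≤ u (1 - u / 2) in one
    iteration, hence decays at least as fast as 2 / (n + 2). *)
Let abs_seqP f n x : `|f x| <= 1 ->
  0 <= abs_seq f n x /\ 0 <= `|f x| - abs_seq f n x <= 2 / n.+2%:R.
Proof.
move=> f1; elim: n => [|n [IH0 /andP[IH1 IH2]]] /=.
  by rewrite subr0 normr_ge0 divff.
set p := abs_seq f n x in IH0 IH1 IH2 *.
have -> : f x * f x = `|f x| * `|f x| by rewrite -!expr2 real_normK ?num_real.
set t := `|f x| in f1 IH1 IH2 *.
have t0 : 0 <= t by exact: normr_ge0.
split; first by nra.
set u := t - p in IH1 IH2.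
have -> : t - (p + 2^-1 * (t * t + -1 * (p * p))) = u * (1 - (t + p) / 2) by rewrite /u; field.
have u1 : u <= 1 by rewrite /u; lra.
have tp : p <= t by rewrite /u in IH1; lra.
apply/andP; split; first by apply: mulr_ge0 => //; lra.
apply: (@le_trans _ _ (u * (1 - u / 2))).
  by apply: ler_wpM2l => //; rewrite /u; lra.
set m := n.+2%:R in IH2 *; have m2 : 2 <= m by rewrite /m ler_nat.
have -> : n.+3%:R = m + 1 :> R by rewrite /m -natr1.
set v := 2 / m in IH2 *.
apply: (@le_trans _ _ (v * (1 - v / 2))).
  have v1 : v <= 1 by rewrite /v ler_pdivrMr ?mul1r; lra.
  by nra.
rewrite /v (_ : 2 / m * (1 - 2 / m / 2) = 2 * (m - 1) / (m * m)); last first.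
  by field; lra.
rewrite ler_pdivrMr; last by nra.
rewrite mulrAC ler_pdivlMr; last by lra.
by nra.
Qed.

Let abs_seq_approx f n : trig_approx f -> trig_approx (abs_seq f n).
Proof.
move=> af; elim: n => [|n IH] /=; first exact/approx_trig/trig_cst.
apply: approxD => //; apply: approxZ; apply: approxD; first exact: approxM.
by apply: approxZ; exact: approxM.
Qed.

Lemma approx_abs f : trig_approx f -> trig_approx (fun x : nat -> R => `|f x|).
Proof.
move=> af; have [M M0 fM] := approx_bounded af.
pose g x := M^-1 * f x.
have ag : trig_approx g by exact: approxZ.
have g1 x : `|g x| <= 1.
  by rewrite normrM gtr0_norm ?invr_gt0// ler_pdivrMl// mulr1.
suff ah : trig_approx (fun x : nat -> R => `|g x|).
  have := approxZ M ah; congr trig_approx; apply/funext => x.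
  by rewrite /g normrM gtr0_norm ?invr_gt0// mulVKf// gt_eqF.
apply: approx_lim => e e0.
have [n ne] : exists n : nat, 2 / n.+2%:R <= e.
  have /ltr_add_invr[n] : 0 < e / 2 by rewrite divr_gt0.
  rewrite add0r => ne; exists n; rewrite mulrC -ler_pdivlMr// (le_trans _ (ltW ne))//.
  by rewrite lef_pV2 ?posrE// ler_nat.
exists (abs_seq g n); first exact: abs_seq_approx.
by move=> x; have [_ /andP[h1 h2]] := abs_seqP n (g1 x); rewrite ger0_norm// (le_trans h2).
Qed.

Lemma approxN f : trig_approx f -> trig_approx (fun x : nat -> R => - f x).
Proof. by move=> af; under eq_fun do rewrite -mulN1r; exact: approxZ. Qed.

Lemma approx_max f g : trig_approx f -> trig_approx g ->
  trig_approx (fun x : nat -> R => Num.max (f x) (g x)).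
Proof.
move=> af ag.
have -> : (fun x => Num.max (f x) (g x)) =
    (fun x => 2^-1 * ((f x + g x) + `|f x + (- g x)|)).
  by apply/funext => x; rewrite maxr_absE mulrC.
apply: approxZ; apply: approxD; first exact: approxD.
by apply: approx_abs; apply: approxD => //; exact: approxN.
Qed.

Lemma approx_min f g : trig_approx f -> trig_approx g ->
  trig_approx (fun x : nat -> R => Num.min (f x) (g x)).
Proof.
move=> af ag.
have -> : (fun x => Num.min (f x) (g x)) = (fun x => - Num.max (- f x) (- g x)).
  by apply/funext => x; rewrite oppr_max !opprK.
by apply: approxN; apply: approx_max; exact: approxN.
Qed.

Lemma approx_bigmin (I : Type) (r : seq I) (M : R) (F : I -> (nat -> R) -> R) :
  (forall i, trig_approx (F i)) ->
  trig_approx (fun x : nat -> R => \big[Num.min/M]_(i <- r) F i x).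
Proof.
move=> aF; elim: r => [|i r IH].
  by under eq_fun do rewrite big_nil; apply/approx_trig/trig_cst.
by under eq_fun do rewrite big_cons; exact: approx_min.
Qed.

Lemma trig_sin (i : nat) (s y : R) : (i < N)%N -> trig (fun x : nat -> R => sin ((x i - y) / s)).
Proof.
move=> iN.
have := trig_cos 1 (fun j => (j == i)%:R / s) (- (y / s) - pi / 2).
congr trig; apply/funext => x.
rewrite mul1r addrA cosBpihalf; congr sin.
rewrite (bigD1 (Ordinal iN))//= eqxx big1 ?addr0; last first.
  by move=> j; rewrite -val_eqE/= => /negbTE ->; rewrite mul0r mul0r.
by rewrite mulrBl /= mul1r mulrC.
Qed.

(* A Lipschitz function is the lower envelope of the cones
   [g y + C * dist (x, y)]; on a box the distance is comparable with a
   trigonometric pseudo-distance, and finitely many apexes [y] suffice. *)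
Lemma lipschitz_approx g (C M rho : R) : 0 < rho -> 0 <= C -> 0 <= M ->
  (forall x y, `|g x - g y| <= C * \sum_(i < N) `|x i - y i|) ->
  (forall x, `|g x| <= M) -> forall e, 0 < e ->
  exists h, [/\ trig_approx h, forall x, `|h x| <= M &
    forall x, (forall i, (i < N)%N -> `|x i| <= rho) -> `|g x - h x| <= e].
Proof.
move=> rho0 C0 M0 gC gM e e0.
(* At this scale |(x_i - y_i) / s| ≤ 1/2 for points of the box, the range in which [normr_sin_ge]
   applies. *)
pose s := 4 * rho.
have s0 : 0 < s by rewrite /s mulr_gt0.
(* The net of apexes has mesh 2 rho / (K + 1). The factor 3 is 1 for the Lipschitz bound of [g] plus
   2 for the slope of the cones. *)
have [K Ke] : exists K : nat, C * (N%:R * (3 * (2 * rho / K.+1%:R))) <= e.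
  have /ltr_add_invr[K] : 0 < e / (C * N%:R * 3 * 2 * rho + 1).
    by rewrite divr_gt0// ltr_wpDl// !mulr_ge0// ltW.
  rewrite add0r => Ke; exists K.
  have -> : C * (N%:R * (3 * (2 * rho / K.+1%:R))) =
    (C * N%:R * 3 * 2 * rho) * K.+1%:R^-1 by ring.
  move: Ke; rewrite ltr_pdivlMr; last by rewrite ltr_wpDl// !mulr_ge0// ltW.
  rewrite mulrDr mulr1 mulrC => Ke; apply: ltW; apply: lt_trans Ke.
  by rewrite ltrDl.
pose net := {ffun 'I_N -> 'I_K.+2}.
pose pt (k : net) (i : nat) : R :=
  if insub i is Some j then - rho + 2 * rho / K.+1%:R * (k j)%:R else 0.
have ptE (k : net) (i : 'I_N) : pt k i = - rho + 2 * rho / K.+1%:R * (k i)%:R.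
  by rewrite /pt valK.
have pt_rho (k : net) (i : 'I_N) : `|pt k i| <= rho.
  rewrite ptE ler_norml.
  have : 0 <= 2 * rho / K.+1%:R * (k i)%:R <= 2 * rho.
    rewrite mulr_ge0 ?divr_ge0 ?mulr_ge0 ?(ltW rho0)//= -mulrA ler_piMr//.
      by rewrite mulr_ge0// ltW.
    by rewrite mulrC ler_pdivrMr// mul1r ler_nat -ltnS.
  by set q := _ * _ => /andP[q1 q2]; apply/andP; split; lra.
pose cone (k : net) x := g (pt k) + \sum_(i < N) (C * (2 * s)) * `|sin ((x i - pt k i) / s)|.
(* Clipping to [-M, M] keeps [h] bounded outside the box, where the cones say nothing about [g]. *)
pose h x := Num.max (- M) (\big[Num.min/M]_(k <- enum net) cone k x).
exists h; split.
- apply: approx_max; first exact/approx_trig/trig_cst.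
  apply: approx_bigmin => k; apply: approxD; first exact/approx_trig/trig_cst.
  apply: approx_sum => i; apply: approxZ; apply: approx_abs; apply: approx_trig.
  exact: trig_sin.
- move=> x; rewrite ler_norml /h le_max lexx/= ge_max ge0_cp// andTb.
  by elim/big_rec: _ => // j y _ yM; rewrite ge_min yM orbT.
- move=> x xrho.
  have sle (k : net) (i : 'I_N) : `|x i - pt k i| <= (2 * s) * `|sin ((x i - pt k i) / s)|.
    have w2 : `|(x i - pt k i) / s| <= 2^-1.
      rewrite normrM [`|s^-1|]gtr0_norm ?invr_gt0// ler_pdivrMr// /s.
      rewrite (_ : 2^-1 * (4 * rho) = rho + rho); last by field.
      by rewrite (le_trans (ler_normB _ _))// lerD// xrho.
    have := normr_sin_ge w2; rewrite normrM [`|s^-1|]gtr0_norm ?invr_gt0//.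
    rewrite ler_pdivrMr// ler_pdivrMr// => H; lra.
  have sge (k : net) (i : 'I_N) : (2 * s) * `|sin ((x i - pt k i) / s)| <= 2 * `|x i - pt k i|.
    have := normr_sin_le ((x i - pt k i) / s).
    rewrite normrM [`|s^-1|]gtr0_norm ?invr_gt0// ler_pdivlMr// => H; lra.
  have lower k : g x <= cone k x.
    have := gC x (pt k); rewrite ler_norml => /andP[_]; rewrite lerBlDl => H.
    rewrite (le_trans H)// lerD2l mulr_sumr; apply: ler_sum => i _.
    by rewrite -mulrA ler_wpM2l.
  have [k Hk] : exists k : net, forall i : 'I_N, `|x i - pt k i| <= 2 * rho / K.+1%:R.
    have /choice[k Hk] : forall i : 'I_N, exists j : 'I_K.+2,
        `|x i - (- rho + 2 * rho / K.+1%:R * j%:R)| <= 2 * rho / K.+1%:R.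
      move=> i; have := xrho i (ltn_ord i); rewrite ler_norml => /andP[x1 x2].
      pose w := (x i + rho) / (2 * rho / K.+1%:R).
      have q0 : 0 < 2 * rho / K.+1%:R by rewrite divr_gt0// mulr_gt0.
      have w0 : 0 <= w by rewrite divr_ge0 ?(ltW q0)//; lra.
      have wK : w <= K.+1%:R.
        rewrite /w ler_pdivrMr// mulrC divfK// ?pnatr_eq0//; lra.
      have tK : (Num.truncn w < K.+2)%N.
        rewrite ltnS -(ler_nat R); apply: le_trans wK.
        by rewrite truncn_le.
      exists (Ordinal tK) => /=.
      have := truncn_itv w0 => /andP[t1 t2].
      have xE : x i = w * (2 * rho / K.+1%:R) - rho.
        by rewrite /w divfK ?gt_eqF//; ring.
      rewrite xE (_ : _ - _ = (2 * rho / K.+1%:R) * (w - (Num.truncn w)%:R)); last by ring.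
      rewrite normrM gtr0_norm// ler_piMr//; first exact: ltW.
      rewrite ger0_norm; last by rewrite subr_ge0.
      by rewrite lerBlDr -(natr1 (Num.truncn w)) in t2 *; rewrite addrC ltW// addrC natr1.
    exists [ffun i => k i] => i; rewrite ptE ffunE; exact: Hk.
  have upper : cone k x <= g x + e.
    have := gC (pt k) x; rewrite ler_norml => /andP[_]; rewrite lerBlDl => H.
    apply: (@le_trans _ _ (g x + (C * \sum_(i < N) `|pt k i - x i| +
       C * \sum_(i < N) 2 * `|x i - pt k i|))).
      rewrite addrA lerD// mulr_sumr; apply: ler_sum => i _.
      by rewrite -mulrA ler_wpM2l.
    rewrite lerD2l (le_trans _ Ke)// -mulrDr ler_wpM2l// -big_split/=.
    rewrite -[X in X%:R * _](card_ord N) -sumr_const mulr_suml.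
    apply: ler_sum => i _; rewrite mul1r (distrC (pt k i)); have Hki := Hk i.
    by set q := 2 * rho / _ in Hki *; lra.
  have gMx := gM x; move: gMx; rewrite ler_norml => /andP[gM1 gM2].
  have bl : g x <= \big[Num.min/M]_(k <- enum net) cone k x.
    by elim/big_rec: _ => // k' y _ yM; rewrite le_min lower.
  have bu : \big[Num.min/M]_(k <- enum net) cone k x <= cone k x.
    have : k \in enum net by rewrite mem_enum.
    elim: (enum net) => // k' r IH; rewrite inE big_cons ge_min => /orP[/eqP <-|/IH ->].
      by rewrite lexx.
    by rewrite orbT.
  rewrite /h; have -> : Num.max (- M) (\big[Num.min/M]_(k0 <- enum net) cone k0 x) =
     \big[Num.min/M]_(k0 <- enum net) cone k0 x.
    by apply/max_r; exact: le_trans bl.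
  rewrite ler_norml; apply/andP; split; last by lra.
  by lra.
Qed.

End trigonometric_approximation.

(** * From cosine transforms to weak convergence in finite dimension *)

Section weak_convergence.
Context {R : realType} (N : nat).

Lemma measurable_linear d (T : measurableType d) (V : T -> nat -> R)
    (a : nat -> R) (b : R) : (forall i, measurable_fun [set: T] (V ^~ i)) ->
  measurable_fun [set: T] (fun w => \sum_(i < N) a i * V w i + b).
Proof.
move=> mV; apply: measurable_funD => //; apply: measurable_sum => i.
by apply: measurable_funM.
Qed.

Lemma trig_bm d (T : measurableType d) (V : T -> nat -> R) h :
  (forall i, measurable_fun [set: T] (V ^~ i)) -> trig N h ->
  bounded_measurable (fun w => h (V w)).
Proof.
move=> mV; elim=> [c a b|f g _ bf _ bg]; last exact: bmD.
by apply: bmZ; apply: bm_cos; exact: measurable_linear.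
Qed.

Lemma approx_bm d (T : measurableType d) (V : T -> nat -> R) h :
  (forall i, measurable_fun [set: T] (V ^~ i)) -> trig_approx N h ->
  bounded_measurable (fun w => h (V w)).
Proof.
move=> mV ah; split; last by have [M _ hM] := approx_bounded ah; exists M => w.
have /choice[t Ht] : forall n : nat, exists t, trig N t /\
    forall x, `|h x - t x| <= n.+1%:R^-1.
  by move=> n; have [|t tt Ht] := ah n.+1%:R^-1; [rewrite invr_gt0|exists t].
apply: (@measurable_fun_cvg _ _ _ _ (fun n w => t n (V w))).
  by move=> n; have [] := trig_bm mV (Ht n).1.
move=> w _; apply/cvgrPdist_le => e e0.
have : n.+1%:R^-1 @[n --> \oo] --> (0 : R) by exact: cvg_harmonic.
move=> /cvgr0Pnorm_le /(_ e e0); apply: filterS => n ne.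
apply: (le_trans ((Ht n).2 (V w))); exact: le_trans (ler_norm _) ne.
Qed.

Definition escapes (rho : R) (x : nat -> R) := exists2 i, (i < N)%N & rho < `|x i|.

Lemma measurable_escapes d (T : measurableType d) (V : T -> nat -> R) rho :
  (forall i, measurable_fun [set: T] (V ^~ i)) ->
  measurable [set w | escapes rho (V w)].
Proof.
move=> mV; rewrite (_ : mkset _ = \bigcup_(i in [set i | (i < N)%N])
    [set w | rho < `|V w i|]); last first.
  by apply/seteqP; split=> w /= [i iN H]; exists i.
apply: bigcup_measurable => i _.
by apply: measurable_set_lt => //; exact: measurableT_comp.
Qed.

(** In the box the integrands differ by at most [e1]; outside it they differ by at most 2 M, on an
    event of probability at most [e2]. *)
Lemma exp_box_approx d (T : measurableType d) (P : probability T R)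
    (V : T -> nat -> R) (g h : (nat -> R) -> R) (M e1 e2 rho : R) :
  (forall i, measurable_fun [set: T] (V ^~ i)) ->
  bounded_measurable (fun w => g (V w)) -> bounded_measurable (fun w => h (V w)) ->
  (forall x, `|g x| <= M) -> (forall x, `|h x| <= M) ->
  (forall x, (forall i, (i < N)%N -> `|x i| <= rho) -> `|g x - h x| <= e1) ->
  0 <= e1 ->
  (P [set w | escapes rho (V w)] <= e2%:E)%E ->
  `|\int[P]_w g (V w) - \int[P]_w h (V w)| <= e1 + 2 * M * e2.
Proof.
move=> mV bg bh gM hM gh e10 Pe2.
have mA := measurable_escapes rho mV.
have M0 : 0 <= M by exact: le_trans (gM (fun=> 0)).
rewrite -expB// (le_trans (exp_abs _ _))//; first exact: bmB.
have b1 : bounded_measurable (fun w => 2 * M * \1_([set w | escapes rho (V w)]) w).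
  by apply: bmZ; exact: bm_indic.
apply: (@le_trans _ _ (\int[P]_w (e1 + 2 * M * \1_([set w | escapes rho (V w)]) w))).
  apply: exp_le; first by apply: bm_abs; exact: bmB.
    by apply: bmD => //; exact: bm_cst.
  move=> w; rewrite indicE; have [|] := boolP (w \in _).
    rewrite inE => _; rewrite mulr1 (le_trans (ler_normB _ _))//.
    by have := gM (V w); have := hM (V w); lra.
  rewrite notin_setE => nw; rewrite mulr0 addr0; apply: gh => i iN.
  by rewrite leNgt; apply/negP => H; apply: nw; exists i.
rewrite expD//; last exact: bm_cst.
rewrite exp_cst lerD2l expZ; last exact: bm_indic.
rewrite exp_indic// ler_wpM2l ?mulr_ge0//.
by rewrite -lee_fin fineK// fin_num_measure.
Qed.

Context d1 d2 (T1 : measurableType d1) (T2 : measurableType d2).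
Variables (P1 : probability T1 R) (P2 : probability T2 R).
Variables (V : nat -> T1 -> nat -> R) (Y : T2 -> nat -> R).
Hypothesis mV : forall n i, measurable_fun [set: T1] (fun w => V n w i).
Hypothesis mY : forall i, measurable_fun [set: T2] (Y ^~ i).
Hypothesis cvg_cos : forall (a : nat -> R) (b : R),
  \int[P1]_w cos (\sum_(i < N) a i * V n w i + b) @[n --> \oo] -->
  \int[P2]_w cos (\sum_(i < N) a i * Y w i + b).
Hypothesis tight : forall e : R, 0 < e -> exists2 rho : R, 0 < rho &
  (forall n, P1 [set w | escapes rho (V n w)] <= e%:E)%E /\
  (P2 [set w | escapes rho (Y w)] <= e%:E)%E.

Lemma cvg_exp_trig h : trig N h ->
  \int[P1]_w h (V n w) @[n --> \oo] --> \int[P2]_w h (Y w).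
Proof.
elim=> [c a b|f g tf IHf tg IHg].
  rewrite expZ; last by apply: bm_cos; exact: measurable_linear.
  have E n : \int[P1]_w (c * cos (\sum_(i < N) a i * V n w i + b)) =
      c * \int[P1]_w cos (\sum_(i < N) a i * V n w i + b).
    by rewrite expZ//; apply: bm_cos; exact: (measurable_linear _ _ (mV _)).
  under eq_fun do rewrite E.
  by apply: cvgM; [exact: cvg_cst|exact: (@cvg_cos a b)].
rewrite expD; [|exact: trig_bm|exact: trig_bm].
have E n : \int[P1]_w (f (V n w) + g (V n w)) =
    \int[P1]_w f (V n w) + \int[P1]_w g (V n w).
  by rewrite expD; [|exact: (trig_bm (mV _) tf)|exact: (trig_bm (mV _) tg)].
under eq_fun do rewrite E.
exact: (cvgD IHf IHg).
Qed.

Lemma cvg_exp_approx h : trig_approx N h ->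
  \int[P1]_w h (V n w) @[n --> \oo] --> \int[P2]_w h (Y w).
Proof.
move=> ah; apply/cvgrPdist_le => e e0.
have e3 : 0 < e / 3 by rewrite divr_gt0.
have [t tt ht] := ah _ e3.
have /cvgrPdist_le/(_ _ e3) := cvg_exp_trig tt; apply: filterS => n H.
have H1 : `|\int[P1]_w h (V n w) - \int[P1]_w t (V n w)| <= e / 3.
  by apply: exp_absB => //; [exact: (approx_bm (mV _) ah)|exact: (trig_bm (mV _) tt)].
have H2 : `|\int[P2]_w h (Y w) - \int[P2]_w t (Y w)| <= e / 3.
  by apply: exp_absB => //; [exact: (approx_bm _ ah)|exact: (trig_bm _ tt)].
move: H H1 H2; rewrite !ler_norml => /andP[? ?] /andP[? ?] /andP[? ?].
by apply/andP; split; lra.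
Qed.

(** A form of Lévy's continuity theorem with tightness assumed: on a box that holds almost all the
    mass, uniformly in [n], [g] is replaced by a limit of trigonometric sums, whose expectations
    converge by [cvg_cos]. *)
Lemma cvg_exp_lipschitz (g : (nat -> R) -> R) (C M : R) : 0 <= C ->
  (forall x y, `|g x - g y| <= C * \sum_(i < N) `|x i - y i|) ->
  (forall x, `|g x| <= M) ->
  \int[P1]_w g (V n w) @[n --> \oo] --> \int[P2]_w g (Y w).
Proof.
move=> C0 gC gM; have M0 : 0 <= M by exact: le_trans (gM (fun=> 0)).
apply/cvgrPdist_le => e e0.
have e6 : 0 < e / 6 by rewrite divr_gt0.
have eM : 0 < e / 6 / (2 * M + 1) by rewrite divr_gt0// ltr_wpDl// mulr_ge0.
have [rho rho0 [tV tY]] := tight eM.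
have [h [ah hM gh]] := lipschitz_approx rho0 C0 M0 gC gM e6.
have bgY : bounded_measurable (fun w => g (Y w)).
  by split; [exact: measurable_lipschitz mY _ _ _ gC|exists M => w].
have bgV n : bounded_measurable (fun w => g (V n w)).
  by split; [exact: measurable_lipschitz (mV n) _ _ _ gC|exists M => w].
have /cvgrPdist_le/(_ _ e6) := cvg_exp_approx ah; apply: filterS => n H.
have eME : 2 * M * (e / 6 / (2 * M + 1)) <= e / 6.
  rewrite mulrCA ler_piMr ?(ltW e6)// ler_pdivrMr ?mul1r ?lerDl//.
  by rewrite ltr_wpDl// mulr_ge0.
have H1 := exp_box_approx (mV n) (bgV n) (approx_bm (mV n) ah) gM hM gh (ltW e6) (tV n).
have H2 := exp_box_approx mY bgY (approx_bm mY ah) gM hM gh (ltW e6) tY.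
move: H H1 H2; rewrite !ler_norml => /andP[? ?] /andP[? ?] /andP[? ?].
by apply/andP; split; lra.
Qed.

End weak_convergence.

(** * Cosine transforms determine laws on the line *)

Section uniqueness.
Context {R : realType}.

Lemma tight_prob d (T : measurableType d) (P : probability T R) (f : T -> R) :
  measurable_fun [set: T] f -> forall e : R, 0 < e ->
  exists2 rho : R, 0 < rho & (P [set w | (rho < `|f w|)%R] <= e%:E)%E.
Proof.
move=> mf e e0.
pose A n := [set w | n.+1%:R < `|f w|].
have mA n : measurable (A n).
  by apply: measurable_set_lt => //; exact: measurableT_comp.
have A0 : \bigcap_n A n = set0.
  apply/seteqP; split=> // w H; have := H (Num.bound `|f w|) I.
  rewrite /A/= ltNge => /negP; apply; apply: ltW.
  rewrite (lt_le_trans (archi_boundP (normr_ge0 (f w))))// -natr1.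
  by rewrite lerDl.
have : P (A n) @[n --> \oo] --> 0%E.
  rewrite -(measure0 P) -A0; apply: nonincreasing_cvg_mu => //.
  - by rewrite (le_lt_trans (probability_le1 _ _))// ltry.
  - exact: bigcapT_measurable.
  - move=> m n mn; apply/subsetPset => w; rewrite /A/=; apply: le_lt_trans.
    by rewrite ler_nat.
move=> /fine_cvgP[_ /cvgr0Pnorm_le /(_ e e0)] [n _ /(_ n (leqnn n))] /= H.
exists n.+1%:R => //.
have -> : P [set w | n.+1%:R < `|f w|] = (fine (P (A n)))%:E.
  by rewrite fineK// fin_num_measure.
rewrite lee_fin; exact: le_trans (ler_norm _) H.
Qed.

(** Applied to the constant sequence [P1], the convergence theorem shows that both laws integrate
    bounded Lipschitz functions alike; Lipschitz ramps then converge to the indicators of open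
    rays. *)
Lemma law_unique_cos (P1 P2 : probability R R) :
  (forall a b, \int[P1]_x cos (a * x + b) = \int[P2]_x cos (a * x + b)) ->
  forall A, measurable A -> P1 A = P2 A.
Proof.
move=> Hcos.
pose V (x : R) (i : nat) := x.
have mV i : measurable_fun setT (V ^~ i) by exact: measurable_id.
have Hlip (g : (nat -> R) -> R) (C M : R) : 0 <= C ->
    (forall x y, `|g x - g y| <= C * \sum_(i < 1) `|x i - y i|) ->
    (forall x, `|g x| <= M) -> \int[P1]_x g (V x) = \int[P2]_x g (V x).
  move=> C0 gC gM.
  have cvgg : \int[P1]_x g (V x) @[n --> \oo] --> \int[P2]_x g (V x).
    apply: (@cvg_exp_lipschitz R 1%N _ _ R R P1 P2 (fun=> V) V (fun=> mV) mV _ _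
      g C M C0 gC gM).
      move=> a b; rewrite (_ : \int[P2]_w _ = \int[P1]_w cos (\sum_(i < 1) a i * V w i + b)).
        exact: cvg_cst.
      under eq_Rintegral do rewrite big_ord1.
      by under [RHS]eq_Rintegral do rewrite big_ord1.
    move=> e e0; have [r1 r10 H1] := tight_prob P1 (@measurable_id _ R setT) e0.
    have [r2 r20 H2] := tight_prob P2 (@measurable_id _ R setT) e0.
    exists (Num.max r1 r2); first by rewrite lt_max r10.
    have escE (Q : probability R R) r : (Q [set w | (r < `|w|)%R] <= e%:E)%E ->
        r <= Num.max r1 r2 -> (Q [set w | escapes 1 (Num.max r1 r2) (V w)] <= e%:E)%E.
      move=> HQ rr; apply: le_trans HQ; apply: le_measure; rewrite ?inE.
      - exact: measurable_escapes.
      - apply: measurable_set_lt => //; exact: measurableT_comp.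
      - by move=> w /= [i _]; exact: le_lt_trans.
    split=> [_|]; [apply: escE H1 _|apply: escE H2 _]; rewrite le_max lexx ?orbT//.
  exact: (cvg_unique _ (cvg_cst _) cvgg).
have Hc (c : R) : P1 `]-oo, c[%classic = P2 `]-oo, c[%classic.
  rewrite -[LHS]fineK ?fin_num_measure// -[RHS]fineK ?fin_num_measure//; congr (_%:E).
  rewrite -!exp_indic//.
  pose phi (k : nat) (x : R) := Num.min 1 (Num.max 0 (k%:R * (c - x))).
  have phi01 k x : 0 <= phi k x <= 1.
    by rewrite /phi ge_min lexx le_min ler01 le_max lexx.
  have phiM k x : `|phi k x| <= 1.
    by have /andP[p0 p1] := phi01 k x; rewrite ger0_norm.
  have philip k x y : `|phi k x - phi k y| <= k%:R * `|x - y|.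
    have -> : k%:R * `|x - y| = `|k%:R * (c - x) - k%:R * (c - y)|.
      by rewrite -mulrBr normrM ger0_norm// distrC; congr (_ * `|_|); ring.
    rewrite /phi; set a := _ * (c - x); set b := _ * (c - y).
    have D1 := ler_norm (a - b); have := ler_norm (- (a - b)); rewrite normrN => D2.
    have D0 := normr_ge0 (a - b); set D := `|a - b| in D1 D2 D0 *.
    have clip (z : R) : Num.min 1 (Num.max 0 z) = if 1 < z then 1 else if 0 < z then z else 0.
      rewrite /Num.max; case: (ltP 0 z) => z0; rewrite /Num.min; last first.
        by rewrite ltr10 ltNge (le_trans z0 ler01).
      by [].
    rewrite !clip ler_norml; apply/andP.
    by case: (ltP 1 a) => ?; case: (ltP 1 b) => ?; case: (ltP 0 a) => ?;
      case: (ltP 0 b) => ?; split; lra.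
  have phicvg x : phi k x @[k --> \oo] --> (\1_`]-oo, c[ x : R).
    rewrite indicE mem_setE in_itv/=; have [xc|cx] := ltP x c; last first.
      apply: cvg_near_cst; apply: nearW => k; rewrite /phi max_l ?min_r//.
      by rewrite mulr_ge0_le0// subr_le0.
    apply: cvg_near_cst; near=> k; rewrite /phi min_l// le_max; apply/orP; right.
    rewrite -ler_pdivrMr ?subr_gt0// mul1r; near: k; exact: nbhs_infty_ger.
  have mphi k : measurable_fun setT (phi k).
    apply: measurable_minr => //; apply: measurable_maxr => //.
    by apply: measurable_funM => //; exact: measurable_funB.
  have E k : \int[P1]_x phi k x = \int[P2]_x phi k x.
    apply: (Hlip (fun z => phi k (z 0%N)) k%:R 1) => //.
    by move=> x y; rewrite big_ord1.
  have c1 := exp_dominated (P := P1) mphi phiM phicvg.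
  have c2 := exp_dominated (P := P2) mphi phiM phicvg.
  have EF : (fun k => \int[P1]_x phi k x) = (fun k => \int[P2]_x phi k x).
    exact/funext.
  by rewrite EF in c1; exact: (cvg_unique _ c1 c2).
move=> A mA.
apply: (measure_unique (@RGenInftyO.G R) (fun n => `]-oo, n%:R[%classic)) => //.
- exact: RGenInftyO.measurableE.
- move=> _ _ [a ->] [b ->]; exists (Num.min a b).
  by apply/seteqP; split=> x /=; rewrite !in_itv/= lt_min => /andP.
- by move=> n; exists n%:R.
- apply/seteqP; split=> // x _; exists (Num.bound `|x|) => //=.
  by rewrite in_itv/= (le_lt_trans (ler_norm x))// archi_boundP.
- by move=> _ [c ->]; exact: Hc.
- by move=> n; rewrite (le_lt_trans (probability_le1 _ _))// ltry.
Unshelve. all: by end_near. Qed.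

End uniqueness.

(** * Moments of partial sums and the central limit theorem *)

Section partial_sums.
Context (R : realType) (P : probability R R) (Pr : probability (sample_space R) R).
Hypothesis HPr : infinite_product P Pr.

Definition psum (g : nat -> R -> R) (n : nat) (x : nat -> R) : R :=
  \sum_(i < n) g i (x i).

Lemma past_psum g n : (forall i, bounded_measurable (g i)) ->
  past (R := R) n (psum g n).
Proof.
move=> bg; rewrite /past /psum.
apply: (@measurable_sum _ (past_space R n)) => i.
by apply: past_coord; [exact: ltn_ord|exact: (bg i).1].
Qed.

Lemma bm_psum g n : (forall i, bounded_measurable (g i)) ->
  @bounded_measurable _ (sample_space R) R (psum g n).
Proof.
move=> bg; apply: (@bm_sum _ (sample_space R)) => i _.
exact: (bm_comp (@measurable_coord R i) (bg i)).
Qed.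

Lemma exp_psumM g n (u : R -> R) (w : R -> R) : (forall i, bounded_measurable (g i)) ->
  measurable_fun [set: R] u ->
  @bounded_measurable _ (sample_space R) R (fun x => u (psum g n x)) ->
  bounded_measurable w ->
  \int[Pr]_x (u (psum g n x) * w (x n)) =
  (\int[Pr]_x u (psum g n x)) * \int[P]_x w x.
Proof.
move=> bg mu bu bw; apply: (exp_past HPr) => //.
apply: (@measurableT_comp _ _ _ (past_space R n) R R u setT (psum g n)) => //.
exact: past_psum.
Qed.

Section moments.
Variable g : R -> R.
Hypotheses (bg : bounded_measurable g) (g0 : \int[P]_x g x = 0).
Local Notation S := (psum (fun=> g)).

Let bS n k : @bounded_measurable _ (sample_space R) R (fun x => S n x ^+ k).
Proof. by apply: bmX; exact: bm_psum. Qed.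

Let bgn n k : @bounded_measurable _ (sample_space R) R (fun x => g (x n) ^+ k).
Proof. by apply: bmX; exact: (bm_comp (@measurable_coord R n)). Qed.

Let ESM n k l : \int[Pr]_x (S n x ^+ k * g (x n) ^+ l) =
  (\int[Pr]_x (S n x ^+ k)) * \int[P]_x (g x ^+ l).
Proof.
apply: (@exp_psumM (fun=> g) n (fun y => y ^+ k) (fun y => g y ^+ l)) => //.
exact: bmX.
Qed.

Lemma psumS n x : S n.+1 x = S n x + g (x n).
Proof. by rewrite /psum big_ord_recr. Qed.

Lemma exp_psum n : \int[Pr]_x S n x = 0.
Proof.
rewrite exp_sum; last first.
  by move=> i _; exact: (bm_comp (@measurable_coord R i)).
by rewrite big1// => i _; rewrite (exp_coord HPr).
Qed.

Lemma exp_psum_sqr n : \int[Pr]_x (S n x ^+ 2) = n%:R * \int[P]_x (g x ^+ 2).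
Proof.
elim: n => [|n IH].
  rewrite mul0r; under eq_Rintegral do rewrite /psum big_ord0 expr0n.
  exact: exp_cst.
have -> : \int[Pr]_x (S n.+1 x ^+ 2) = \int[Pr]_x (S n x ^+ 2 * g (x n) ^+ 0 +
    (2 * (S n x ^+ 1 * g (x n) ^+ 1) + S n x ^+ 0 * g (x n) ^+ 2)).
  by apply: eq_Rintegral => x _; rewrite psumS; ring.
rewrite expD; last 2 first.
- by apply: bmM.
- by apply: bmD; [apply: bmZ|]; apply: bmM.
rewrite expD; last 2 first.
- by apply: bmZ; apply: bmM.
- by apply: bmM.
rewrite expZ; last by apply: bmM.
rewrite !ESM.
under [X in _ * X + _]eq_Rintegral do rewrite expr0.
under [X in _ + X * _]eq_Rintegral do rewrite expr0.
under [X in _ + (2 * (X * _) + _)]eq_Rintegral do rewrite expr1.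
rewrite !exp_cst exp_psum IH -(natr1 n); ring.
Qed.

(** Split off the last summand and expand: centring kills the terms in S^3 and in S. As 3 (n + 1)^2
    = 3 n^2 + 6 n + 3, the recursion closes with three times the squared variance to spare. *)
Lemma exp_psum_pow4 n : \int[Pr]_x (S n x ^+ 4) <=
  3 * n%:R ^+ 2 * (\int[P]_x (g x ^+ 2)) ^+ 2 + n%:R * \int[P]_x (g x ^+ 4).
Proof.
elim: n => [|n IH].
  under eq_Rintegral do rewrite /psum big_ord0 expr0n/=.
  by rewrite exp_cst mul0r expr0n/= mulr0 mul0r addr0.
have -> : \int[Pr]_x (S n.+1 x ^+ 4) = \int[Pr]_x (S n x ^+ 4 * g (x n) ^+ 0 +
    (4 * (S n x ^+ 3 * g (x n) ^+ 1) + (6 * (S n x ^+ 2 * g (x n) ^+ 2) +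
    (4 * (S n x ^+ 1 * g (x n) ^+ 3) + S n x ^+ 0 * g (x n) ^+ 4)))).
  by apply: eq_Rintegral => x _; rewrite psumS; ring.
have b k l : @bounded_measurable _ (sample_space R) R
    (fun x => S n x ^+ k * g (x n) ^+ l) by apply: bmM.
have bz c k l : @bounded_measurable _ (sample_space R) R
    (fun x => c * (S n x ^+ k * g (x n) ^+ l)) by apply: bmZ.
have b1 := bmD (bz 4 1%N 3) (b 0%N 4).
have b2 := bmD (bz 6 2 2) b1.
have b3 := bmD (bz 4 3 1%N) b2.
rewrite (expD _ (b 4 0%N) b3) (expD _ (bz _ _ _) b2) (expD _ (bz _ _ _) b1).
rewrite (expD _ (bz _ _ _) (b _ _)) (ESM n 0%N 4) !expZ// !ESM.
have E0 : \int[P]_x (g x ^+ 0) = 1.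
  by under eq_Rintegral do rewrite expr0; rewrite exp_cst.
have E1 : \int[P]_x (g x ^+ 1) = 0.
  by under eq_Rintegral do rewrite expr1.
have E2 : \int[Pr]_x (S n x ^+ 0) = 1.
  by under eq_Rintegral do rewrite expr0; rewrite exp_cst.
have E3 : \int[Pr]_x (S n x ^+ 1) = 0.
  by under eq_Rintegral do rewrite expr1; rewrite exp_psum.
rewrite E0 E1 E2 E3 exp_psum_sqr.
move: IH; set A := \int[Pr]_x _; set m2 := \int[P]_x (g x ^+ 2).
set m4 := \int[P]_x _ => IH.
have m20 : 0 <= m2 ^+ 2 by exact: sqr_ge0.
rewrite -(natr1 n); have -> : 3 * (n%:R + 1) ^+ 2 * m2 ^+ 2 + (n%:R + 1) * m4 =
  (3 * n%:R ^+ 2 * m2 ^+ 2 + n%:R * m4) + (6 * n%:R * m2 ^+ 2 + m4) + 3 * m2 ^+ 2 by ring.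
have -> : A * 1 + (4 * (\int[Pr]_x (S n x ^+ 3) * 0) + (6 * (n%:R * m2 * m2) +
  (4 * (0 * \int[P]_x (g x ^+ 3)) + 1 * m4))) = A + (6 * n%:R * m2 ^+ 2 + m4) by ring.
by lra.
Qed.

End moments.

Section characteristic_function.
Variable g : R -> R.
Hypotheses (bg : bounded_measurable g) (g0 : \int[P]_x g x = 0).
Local Notation S := (psum (fun=> g)).

Let mlin (t b : R) : measurable_fun [set: R] (fun y : R => t * y + b).
Proof. by apply: measurable_funD => //; exact: measurable_funM. Qed.

Let mcos (t b : R) : measurable_fun [set: R] (fun y : R => cos (t * y + b)).
Proof. by have [] := bm_cos (mlin t b). Qed.

Let bScos n (t b : R) :
  @bounded_measurable _ (sample_space R) R (fun x => cos (t * S n x + b)).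
Proof.
apply: bm_cos; apply: measurable_funD => //; apply: measurable_funM => //.
by have [] := @bm_psum (fun=> g) n (fun=> bg).
Qed.

Let cos_step n (t b : R) : \int[Pr]_x cos (t * S n.+1 x + b) =
  (\int[Pr]_x cos (t * S n x + b)) * (\int[P]_x cos (t * g x)) +
  (\int[Pr]_x cos (t * S n x + (b + pi / 2))) * (\int[P]_x sin (t * g x)).
Proof.
have mtg : measurable_fun setT (fun x => t * g x).
  by apply: measurable_funM => //; exact: bg.1.
have bc := bm_cos mtg; have bs := bm_sin mtg.
rewrite -(@exp_psumM (fun=> g) n (fun y => cos (t * y + b)) (fun y => cos (t * g y)))//.
rewrite -(@exp_psumM (fun=> g) n (fun y => cos (t * y + (b + pi / 2)))
  (fun y => sin (t * g y)))//.
have bcn := bm_comp (@measurable_coord R n) bc.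
have bsn := bm_comp (@measurable_coord R n) bs.
rewrite -expD; last 2 first.
- exact: bmM.
- exact: bmM.
apply: eq_Rintegral => x _; rewrite psumS addrA cosDpihalf.
have -> : t * (S n x + g (x n)) + b = (t * S n x + b) + t * g (x n) by ring.
by rewrite (cosD (t * S n x + b) (t * g (x n))); ring.
Qed.

Let m2 := \int[P]_x (g x ^+ 2).
Let m3 := \int[P]_x (`|g x| ^+ 3).
Let m4 := \int[P]_x (g x ^+ 4).
Let K := m4 + (m2 / 2) ^+ 2 * expR (m2 / 2) + m3.

(** For one summand, the cosine transform and the Gaussian factor share the expansion 1 - t^2 m2 / 2
    up to order t^4 ≤ t^3, and centring leaves a sine of order t^3. *)
Let bound1 (t : R) : 0 <= t <= 1 ->
  `|\int[P]_x cos (t * g x) - expR (- (t ^+ 2 * m2 / 2))| +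
  `|\int[P]_x sin (t * g x)| <= K * t ^+ 3.
Proof.
move=> /andP[t0 t1].
have mtg : measurable_fun setT (fun x => t * g x).
  by apply: measurable_funM => //; exact: bg.1.
have bc := bm_cos mtg; have bs := bm_sin mtg.
have m20 : 0 <= m2 by apply: Rintegral_ge0 => x _; exact: sqr_ge0.
have m40 : 0 <= m4 by apply: Rintegral_ge0 => x _; rewrite exprn_even_ge0.
have t43 : t ^+ 4 <= t ^+ 3 by rewrite exprS ler_piMl// exprn_ge0.
have h1 : `|\int[P]_x cos (t * g x) - 1 + t ^+ 2 * m2 / 2| <= m4 * t ^+ 4.
  have -> : \int[P]_x cos (t * g x) - 1 + t ^+ 2 * m2 / 2 =
      \int[P]_x (cos (t * g x) - 1 + t ^+ 2 / 2 * g x ^+ 2).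
    rewrite expD; [|by apply: bmB => //; exact: bm_cst|by apply: bmZ; exact: bmX].
    rewrite expB//; last exact: bm_cst.
    by rewrite exp_cst expZ; [rewrite /m2; ring|exact: bmX].
  have bG : bounded_measurable (fun x => cos (t * g x) - 1 + t ^+ 2 / 2 * g x ^+ 2).
    apply: bmD; last by apply: bmZ; exact: bmX.
    by apply: bmB => //; exact: bm_cst.
  rewrite (le_trans (exp_abs _ bG))// [m4 * _]mulrC /m4 -expZ; last exact: bmX.
  apply: exp_le; [exact: bm_abs|by apply: bmZ; exact: bmX|move=> x].
  have := normr_cosB_le (t * g x); rewrite !exprMn.
  by rewrite mulrAC.
have h2 : `|expR (- (t ^+ 2 * m2 / 2)) - 1 + t ^+ 2 * m2 / 2| <=
    (m2 / 2) ^+ 2 * expR (m2 / 2) * t ^+ 4.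
  have := expR_taylor1 (- (t ^+ 2 * m2 / 2)); rewrite opprK normrN sqrrN => H.
  apply: (le_trans H).
  rewrite ger0_norm; last by rewrite divr_ge0// mulr_ge0 ?sqr_ge0.
  have -> : (t ^+ 2 * m2 / 2) ^+ 2 = (m2 / 2) ^+ 2 * t ^+ 4 by field.
  rewrite mulrAC ler_wpM2r// ?exprn_even_ge0// ler_wpM2l ?sqr_ge0// ler_expR.
  by rewrite -mulrA ler_piMl ?divr_ge0// expr_le1.
have h3 : `|\int[P]_x sin (t * g x)| <= m3 * t ^+ 3.
  have -> : \int[P]_x sin (t * g x) = \int[P]_x (sin (t * g x) - t * g x).
    by rewrite expB//; [rewrite expZ// g0 mulr0 subr0|exact: bmZ].
  have bG : bounded_measurable (fun x => sin (t * g x) - t * g x).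
    by apply: bmB => //; exact: bmZ.
  have b3 : bounded_measurable (fun x => `|g x| ^+ 3) by apply: bmX; exact: bm_abs.
  rewrite (le_trans (exp_abs _ bG))// [m3 * _]mulrC /m3 -expZ//.
  apply: exp_le; [exact: bm_abs|exact: bmZ|move=> x].
  by rewrite (le_trans (normr_sinB_le _))// normrM exprMn (ger0_norm t0).
set c := \int[P]_x cos _ in h1 *; set q := expR (- _) in h2 *.
have h4 : `|c - q| <= `|c - 1 + t ^+ 2 * m2 / 2| + `|q - 1 + t ^+ 2 * m2 / 2|.
  rewrite (_ : c - q = (c - 1 + t ^+ 2 * m2 / 2) - (q - 1 + t ^+ 2 * m2 / 2)).
    exact: ler_normB.
  by ring.
have h5 : m4 * t ^+ 4 <= m4 * t ^+ 3 by rewrite ler_wpM2l.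
have h6 : (m2 / 2) ^+ 2 * expR (m2 / 2) * t ^+ 4 <=
    (m2 / 2) ^+ 2 * expR (m2 / 2) * t ^+ 3.
  by rewrite ler_wpM2l// mulr_ge0 ?sqr_ge0 ?expR_ge0.
by rewrite /K !mulrDl; lra.
Qed.

(** Each summand multiplies the transform by the Gaussian factor up to an error K t^3; this factor
    and all the transforms are at most 1 in absolute value, so the errors only add up. *)
Let iterate (t b : R) n : 0 <= t <= 1 ->
  `|\int[Pr]_x cos (t * S n x + b) - expR (- (t ^+ 2 * m2 / 2)) ^+ n * cos b|
  <= n%:R * (K * t ^+ 3).
Proof.
move=> t01; elim: n => [|n IH].
  rewrite expr0 mul1r mul0r; under eq_Rintegral do rewrite /psum big_ord0 mulr0 add0r.
  by rewrite exp_cst subrr normr0.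
have := bound1 t01; set c := \int[P]_x cos _; set s := \int[P]_x sin _.
rewrite cos_step -/c -/s.
have uM b' : `|\int[Pr]_x cos (t * S n x + b')| <= 1.
  have := @exp_absB _ _ _ Pr (fun x => cos (t * S n x + b')) (fun=> 0) 1 (bScos n t b') (bm_cst 0).
  by rewrite exp_cst subr0; apply => x; rewrite subr0 cos_max.
move: IH; set q := expR _; set u := \int[Pr]_x _; set v := \int[Pr]_x _.
set A := K * t ^+ 3; move=> IH H.
have u1 : `|u| <= 1 by exact: uM.
have v1 : `|v| <= 1 by exact: uM.
have q01 : 0 <= q <= 1.
  rewrite expR_ge0/= expR_le1 oppr_le0 divr_ge0// mulr_ge0 ?sqr_ge0//.
  by apply: Rintegral_ge0 => x _; exact: sqr_ge0.
rewrite (_ : _ - _ = u * (c - q) + v * s + q * (u - q ^+ n * cos b)); last first.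
  by rewrite exprS; ring.
rewrite (le_trans (ler_normD _ _))// -(natr1 n) mulrDl mul1r addrC lerD//.
  rewrite normrM; have /andP[q0 q1] := q01; rewrite (ger0_norm q0) (le_trans _ IH)//.
  by rewrite ler_piMl.
rewrite (le_trans (ler_normD _ _))// (le_trans _ H)// !normrM lerD//.
  by rewrite ler_piMl.
by rewrite ler_piMl.
Qed.

(** At t = n^(-1/2) the n-th power of the Gaussian factor is exp (- m2 / 2), and the accumulated
    error n K t^3 is K n^(-1/2). *)
Lemma clt_cos (b : R) :
  \int[Pr]_x cos ((Num.sqrt n%:R)^-1 * S n x + b) @[n --> \oo] -->
  expR (- (m2 / 2)) * cos b.
Proof.
apply/cvgrPdist_le => e e0.
near=> n.
have n0 : (0 < n)%N by near: n; exact: nbhs_infty_gt.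
have n0' : 0 < n%:R :> R by rewrite ltr0n.
set t := (Num.sqrt n%:R)^-1.
have sn0 : 0 < Num.sqrt n%:R :> R by rewrite sqrtr_gt0.
have t01 : 0 <= t <= 1.
  have : Num.sqrt 1 <= Num.sqrt n%:R :> R by rewrite ler_sqrt ?ler1n ?ler0n.
  by rewrite sqrtr1 invr_ge0 sqrtr_ge0/= invf_le1.
have t2 : t ^+ 2 = n%:R^-1 by rewrite /t exprVn sqr_sqrtr// ler0n.
have := @iterate t b n t01.
rewrite -expRM_natr mulNr (_ : t ^+ 2 * m2 / 2 * n%:R = m2 / 2); last first.
  by rewrite t2; field; rewrite gt_eqF.
rewrite distrC => H; rewrite (le_trans H)// exprS t2.
rewrite (_ : _ * _ = K * t); last by field; rewrite gt_eqF.
rewrite (@le_trans _ _ (`|K| * t))// ?ler_wpM2r ?ler_norm//; first by case/andP: t01.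
rewrite /t ler_pdivrMr// mulrC -ler_pdivrMr//.
rewrite -[leLHS]ger0_norm ?divr_ge0 ?(ltW e0)// -sqrtr_sqr ler_sqrt//.
near: n; exact: nbhs_infty_ger.
Unshelve. all: by end_near. Qed.

End characteristic_function.

(** By the addition formula, splitting off one variable multiplies the transform by its cosine
    expectation; the sine expectation is the transform at phase - pi / 2, which is zero. *)
Lemma gaussian_psum_cos (xi : R -> R) (a : nat -> R) (n : nat) (b : R) :
  measurable_fun [set: R] xi ->
  (forall a b, \int[P]_x cos (a * xi x + b) = expR (- (a ^+ 2 / 2)) * cos b) ->
  \int[Pr]_x cos (\sum_(i < n) a i * xi (x i) + b) =
  expR (- ((\sum_(i < n) a i ^+ 2) / 2)) * cos b.
Proof.
move=> mxi Hxi; elim: n b => [|n IH] b.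
  under eq_Rintegral do rewrite big_ord0 add0r.
  by rewrite exp_cst big_ord0 mul0r oppr0 expR0 mul1r.
have mS : measurable_fun [set: past_space R n]
    (fun x : past_space R n => \sum_(i < n) a i * xi (x i)).
  apply: measurable_sum => i; apply: (@past_coord R n i (fun y => a i * xi y)) => //.
  exact: measurable_funM.
have pc b' : past n (fun x : sample_space R => cos (\sum_(i < n) a i * xi (x i) + b')).
  by apply: (@bm_cos _ (past_space R n) _ _ _).1; exact: measurable_funD.
have bc b' : @bounded_measurable _ (sample_space R) R
    (fun x : sample_space R => cos (\sum_(i < n) a i * xi (x i) + b')).
  split; first exact: past_measurable (pc b').
  by exists 1 => x; exact: cos_max.
have mx : measurable_fun setT (fun x => a n * xi x) by exact: measurable_funM.
have E1 : \int[P]_x cos (a n * xi x) = expR (- (a n ^+ 2 / 2)).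
  have := Hxi (a n) 0; rewrite cos0 mulr1 => <-.
  by apply: eq_Rintegral => x _; rewrite addr0.
have E2 : \int[P]_x sin (a n * xi x) = 0.
  have := Hxi (a n) (- (pi / 2)); rewrite cosN cos_pihalf mulr0 => <-.
  by apply: eq_Rintegral => x _; rewrite cosBpihalf.
rewrite big_ord_recr/= mulrDl opprD expRD.
have b1 := bm_comp (@measurable_coord R n) (bm_cos mx).
have b2 := bm_comp (@measurable_coord R n) (bm_sin mx).
rewrite (_ : \int[Pr]_x _ = \int[Pr]_x (
   cos (\sum_(i < n) a i * xi (x i) + b) * cos (a n * xi (x n)) +
   cos (\sum_(i < n) a i * xi (x i) + (b + pi / 2)) * sin (a n * xi (x n)))); last first.
  apply: eq_Rintegral => x _; rewrite big_ord_recr/= addrA cosDpihalf.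
  rewrite -addrA (addrC (a n * _)) addrA cosD; ring.
rewrite (expD _ (bmM (bc _) b1) (bmM (bc _) b2)).
rewrite (exp_past HPr (w := fun y => cos (a n * xi y)) (pc _) (bc _) (bm_cos mx)).
rewrite (exp_past HPr (w := fun y => sin (a n * xi y)) (pc _) (bc _) (bm_sin mx)).
by rewrite E1 E2 IH mulr0 addr0; ring.
Qed.

End partial_sums.

(** * Functions of bounded variation *)

Section variation.
Context {R : realType}.
Implicit Types f v : R -> R.

(** A chain may here be a single point, whereas [p_variation] asks for at least one increment; thus
    0 is always among the sums over chains that end below a given point. *)
Let chain f (n : nat) (x : nat -> R) (s : R) :=
  (forall i, (i < n)%N -> x i < x i.+1) /\
  s = \sum_(i < n) `|f (x i.+1) - f (x i)|.

Let chain_extend f n x s z : chain f n x s -> x n < z ->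
  exists2 x', chain f n.+1 x' (s + `|f z - f (x n)|) & x' n.+1 = z.
Proof.
move=> [xinc ->] xz; exists (fun i => if (i <= n)%N then x i else z); last by rewrite ltnn.
split.
  move=> i iN; have [-> /=|iN'] := eqVneq i n; first by rewrite leqnn ltnn.
  have iltn : (i < n)%N by rewrite ltn_neqAle iN' -ltnS.
  by rewrite /= (ltnW iltn) iltn; exact: xinc.
rewrite big_ord_recr/= leqnn ltnn; congr (_ + _).
by apply: eq_bigr => i _; rewrite (ltnW (ltn_ord i)) (ltn_ord i).
Qed.

(* [v x] is the total variation of [f] on ]-oo, x]. *)
Lemma variation_function f : (sup_norm f + p_variation 1 f <= 1)%E ->
  exists v : R -> R, [/\ forall x y, x <= y -> `|f y - f x| <= v y - v x,
    forall x, 0 <= v x & forall x y, `|f x| + v y <= 1].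
Proof.
move=> fbv.
pose S (y : R) : set R := [set s | exists n x, chain f n x s /\ x n <= y].
have S0 y : S y 0.
  by exists 0%N, (fun=> y); split=> //; split=> //; rewrite big_ord0.
have pv0 : (0 <= p_variation 1 f)%E.
  apply: (@le_trans _ _ (\sum_(i < 1) `|f ((i.+1)%:R) - f (i%:R)| `^ 1)%:E).
    by rewrite lee_fin sumr_ge0// => i _; exact: powR_ge0.
  apply: ereal_sup_ubound; exists 1%N, (fun i => i%:R); split=> // i _.
  by rewrite ltr_nat.
have fsup x : (`|f x|%:E <= sup_norm f)%E.
  by apply: ereal_sup_ubound; exists x.
have chain1 z n x s : chain f n x s -> `|f z| + s <= 1.
  case: n => [[_ ->]|n [xinc ->]].
    rewrite big_ord0 addr0 -lee_fin; apply: le_trans fbv.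
    by rewrite -[leLHS]adde0; exact: leeD.
  rewrite -lee_fin EFinD; apply: le_trans fbv; apply: leeD => //.
  apply: ereal_sup_ubound; exists n.+1, x; split=> //; congr EFin.
  by apply: eq_bigr => i _; rewrite powRr1.
have Sub y : has_ubound (S y).
  exists 1 => s [n [x [cs _]]]; have := chain1 0 _ _ _ cs.
  by have := normr_ge0 (f 0); lra.
have hs y : has_sup (S y) by split=> //; exists 0.
exists (fun y => sup (S y)); split=> [x y xy|y|x y].
- rewrite lerBrDr; have [<-|xny] := eqVneq x y; first by rewrite subrr normr0 add0r.
  have {xy}xy : x < y by rewrite lt_neqAle xny.
  rewrite addrC -lerBrDr; apply: ge_sup; first by exists 0.
  move=> s [n [xs [cs xsx]]]; rewrite lerBrDr.
  have [s' cs' [xs' Hx']] : exists2 s', s <= s' & exists xs', exists m,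
      chain f m xs' s' /\ xs' m = x.
    have [xe|xl] := eqVneq (xs n) x; first by exists s => //; exists xs, n.
    have xslt : xs n < x by rewrite lt_neqAle xl.
    have [xs' c' e'] := chain_extend cs xslt.
    by exists (s + `|f x - f (xs n)|); [rewrite lerDl|exists xs', n.+1].
  case: Hx' => m [cm xm].
  have [xs'' c'' e''] : exists2 x', chain f m.+1 x' (s' + `|f y - f x|) & x' m.+1 = y.
    by rewrite -xm; apply: chain_extend => //; rewrite xm.
  apply: (@le_trans _ _ (s' + `|f y - f x|)); first by rewrite lerD2r.
  apply: ub_le_sup => //; exists m.+1, xs''; split=> //.
  by rewrite e''.
- exact: ub_le_sup.
- rewrite -lerBrDl; apply: ge_sup; first by exists 0.
  by move=> s [n [xs [cs _]]]; rewrite lerBrDl; exact: chain1 cs.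
Qed.

End variation.

(** * Integration by parts against the signed measure P_n^W - P_n *)

Section integration_by_parts.
Context {R : realType}.

Definition downset (D : set R) := forall x y, D y -> x <= y -> D x.

(** Exhibits every ray, closed or open, and the whole line as a limit of closed rays. The cases are:
    unbounded, supremum attained, supremum not attained. *)
Lemma downset_cofinal (D : set R) : downset D -> D !=set0 ->
  exists a : nat -> R, (forall n, D (a n)) /\
    forall x, D x -> \forall n \near \oo, x <= a n.
Proof.
move=> dD [d0 Dd0].
have [ubD|nubD] := pselect (has_ubound D); last first.
  have H (n : nat) : exists a, D a /\ n%:R <= a.
    apply: contrapT => nH; apply: nubD; exists n%:R => y Dy.
    by rewrite leNgt; apply/negP => ny; apply: nH; exists y; split=> //; exact: ltW.
  have [a Ha] := choice H; exists a; split=> [n|x _]; first by case: (Ha n).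
  near=> n; apply: (@le_trans _ _ n%:R); last by case: (Ha n).
  near: n; exact: nbhs_infty_ger.
have hsD : has_sup D by split=> //; exists d0.
have [Ds|nDs] := pselect (D (sup D)).
  by exists (fun=> sup D); split=> // x Dx; apply: nearW => n; exact: ub_le_sup.
have H (n : nat) : exists a, D a /\ sup D - n.+1%:R^-1 < a.
  have [a Da] := sup_adherent (harmonic_gt0 n) hsD.
  by exists a.
have [a Ha] := choice H; exists a; split=> [n|x Dx]; first by case: (Ha n).
have xs : x < sup D.
  rewrite lt_neqAle ub_le_sup// andbT; apply/eqP => xs; apply: nDs.
  by rewrite -xs.
have xs0 : 0 < sup D - x by rewrite subr_gt0.
near=> n; apply/ltW/(@le_lt_trans _ _ (sup D - n.+1%:R^-1)); last by case: (Ha n).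
rewrite lerBrDr -lerBrDl; apply: ltW.
near: n; exact: (near_infty_natSinv_lt (PosNum xs0)).
Unshelve. all: by end_near. Qed.

End integration_by_parts.

Section bv_functional.
Context {R : realType}.
Local Notation mu := (@lebesgue_measure R).
Variables (w : R -> R) (n : nat) (x : nat -> R).
Hypothesis iw : mu.-integrable [set: R] (EFin \o w).

(* Integration against the signed measure [w dy - P_n], and its variation. *)
Let I (f : R -> R) : R := \int[mu]_y (f y * w y) - emp n x f.
Let B (f : R -> R) : R := \int[mu]_y (f y * `|w y|) + emp n x f.

Let iM (f u : R -> R) : bounded_measurable f ->
  mu.-integrable [set: R] (EFin \o u) ->
  mu.-integrable [set: R] (EFin \o (fun y => f y * u y)).
Proof.
move=> [mf [M fM]] iu.
have -> : EFin \o (fun y => f y * u y) = ((EFin \o u) \* (EFin \o f))%E.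
  by apply/funext => y /=; rewrite -EFinM mulrC.
apply: integrableMl => //; exists M; split; first exact: num_real.
by move=> K MK y _; apply: (le_trans (fM y)); exact: ltW.
Qed.

Let empD f g : emp n x (fun y => f y + g y) = emp n x f + emp n x g.
Proof. by rewrite /emp big_split/= mulrDr. Qed.

Let empZ c f : emp n x (fun y => c * f y) = c * emp n x f.
Proof. by rewrite /emp -mulr_sumr mulrCA. Qed.

Let emp_le f g : (forall y, f y <= g y) -> emp n x f <= emp n x g.
Proof. by move=> fg; rewrite /emp ler_wpM2l ?invr_ge0//; apply: ler_sum => i _. Qed.

Let emp_abs f : `|emp n x f| <= emp n x (fun y => `|f y|).
Proof.
rewrite /emp normrM ger0_norm ?invr_ge0//; rewrite ler_wpM2l ?invr_ge0//.
exact: ler_norm_sum.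
Qed.

Let iaw : mu.-integrable [set: R] (EFin \o (fun y => `|w y|)).
Proof. exact: integrable_norm iw. Qed.

Let ID f g : bounded_measurable f -> bounded_measurable g ->
  I (fun y => f y + g y) = I f + I g.
Proof.
move=> bf bg; rewrite /I empD.
under eq_Rintegral do rewrite mulrDl.
by rewrite RintegralD//; [ring|exact: iM|exact: iM].
Qed.

Let IZ c f : bounded_measurable f -> I (fun y => c * f y) = c * I f.
Proof.
move=> bf; rewrite /I empZ; under eq_Rintegral do rewrite -mulrA.
by rewrite RintegralZl//; [ring|exact: iM].
Qed.

Let BD f g : bounded_measurable f -> bounded_measurable g ->
  B (fun y => f y + g y) = B f + B g.
Proof.
move=> bf bg; rewrite /B empD.
under eq_Rintegral do rewrite mulrDl.
by rewrite RintegralD//; [ring|exact: iM|exact: iM].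
Qed.

Let BZ c f : bounded_measurable f -> B (fun y => c * f y) = c * B f.
Proof.
move=> bf; rewrite /B empZ; under eq_Rintegral do rewrite -mulrA.
by rewrite RintegralZl//; [ring|exact: iM].
Qed.

Let I_le f g : bounded_measurable f -> bounded_measurable g ->
  (forall y, `|f y| <= g y) -> `|I f| <= B g.
Proof.
move=> bf bg fg; rewrite /I /B (le_trans (ler_normB _ _))// lerD//; last first.
  exact: le_trans (emp_abs _) (emp_le _).
rewrite (le_trans (le_normr_Rintegral _ (iM bf iw)))//.
apply: le_Rintegral => //; [exact: integrable_norm (iM bf iw)|exact: iM|].
by move=> y _; rewrite normrM ler_wpM2r.
Qed.

Variable Delta : R.
Hypothesis cdfD : forall s : R, `|I (\1_`]-oo, s])| <= Delta.

Let Delta0 : 0 <= Delta. Proof. exact: le_trans (cdfD 0). Qed.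

Let measurable_downset (D : set R) : downset D -> measurable D.
Proof.
move=> dD; apply: is_interval_measurable => a b Da Db c /andP[ac cb].
exact: dD Db (cb).
Qed.

(** Closed rays with end points cofinal in [D] converge to [D] pointwise, and [I] follows: by
    dominated convergence for the density, termwise for the sample. *)
Let I_downset (D : set R) : downset D -> `|I (\1_D)| <= Delta.
Proof.
move=> dD; have mD := measurable_downset dD.
have [->|/set0P D0] := eqVneq D set0.
  rewrite (_ : I _ = 0) ?normr0// /I /emp.
  under eq_Rintegral do rewrite indic0 mul0r.
  rewrite Rintegral_cst// mul0r big1 ?mulr0 ?subr0// => i _.
  by rewrite indic0.
have [a [aD cofa]] := downset_cofinal dD D0.
have acvg y : \1_`]-oo, a k] y @[k --> \oo] --> (\1_D y : R).
  have [Dy|nDy] := pselect (D y).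
    rewrite (_ : \1_D y = 1); last by rewrite indicE mem_set.
    apply: cvg_near_cst; have := cofa y Dy; apply: filterS => k yk.
    by rewrite indicE mem_set//= in_itv/= yk.
  rewrite (_ : \1_D y = 0); last by rewrite indicE memNset.
  apply: cvg_near_cst; apply: nearW => k.
  rewrite indicE memNset//= in_itv/= => ya; apply: nDy.
  exact: dD (aD k) ya.
have cvgI : I (\1_`]-oo, a k]) @[k --> \oo] --> I (\1_D).
  apply: cvgB.
    apply: fine_cvg; rewrite fineK; last first.
      by apply: integrable_fin_num => //; apply: iM => //; exact: bm_indic.
    have [|||||_ _ //] := @dominated_convergence _ _ _ mu setT measurableT
      (fun k y => (\1_`]-oo, a k] y * w y)%:E) (fun y => (\1_D y * w y)%:E)
      (fun y => (`|w y|)%:E).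
    - move=> k; have := iM (bm_indic R (measurable_itv `]-oo, a k])) iw.
      exact: measurable_int.
    - have := iM (bm_indic R mD) iw; exact: measurable_int.
    - apply: aeW => y _; apply: cvg_EFin; first exact: nearW.
      by apply: cvgM; [exact: acvg|exact: cvg_cst].
    - exact: iaw.
    - apply: aeW => y k _ /=; rewrite lee_fin normrM indicE.
      by case: (_ \in _); rewrite ?normr1 ?mul1r// normr0 mul0r.
  apply: cvgM; first exact: cvg_cst.
  by apply: cvg_big => [|i _]; [exact: add_continuous|exact: acvg].
have : `|I (\1_`]-oo, a k])| @[k --> \oo] --> `|I (\1_D)| by exact: cvg_norm.
by move=> /cvgr_to_le; apply; apply: nearW => k; exact: cdfD.
Qed.

Variables f v : R -> R.
Hypothesis mf : measurable_fun [set: R] f.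
Hypothesis fv : forall x y, x <= y -> `|f y - f x| <= v y - v x.
Hypothesis v0 : forall x, 0 <= v x.
Hypothesis fv1 : forall x y, `|f x| + v y <= 1.

Let v_nd a b : a <= b -> v a <= v b.
Proof. by move=> ab; rewrite -subr_ge0 (le_trans _ (fv ab)). Qed.

Let bf : bounded_measurable f.
Proof.
by split=> //; exists 1 => y; have := fv1 y y; have := v0 y; lra.
Qed.

Let bmf1 (A : set R) : measurable A -> bounded_measurable (fun y => f y * \1_A y).
Proof. by move=> mA; apply: bmM => //; exact: bm_indic. Qed.

(** Summation by parts. The level sets of the variation function [v] are downsets that cut the line
    into slices on which [f] varies by at most [e]. Replacing [f] by a constant on each slice costs
    [e * B] of the slice; what is left pairs increments of [f], bounded by those of [v], with values
    of [I] on downsets, bounded by [Delta]. Then [e] tends to 0. *)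
Lemma bv_functional_le : `|I f| <= Delta.
Proof.
suff H (e : R) : 0 < e -> `|I f| <= Delta + e * B (\1_setT).
  apply/ler_addgt0Pr => e e0.
  have B0 : 0 <= B (\1_setT).
    by apply: (le_trans (normr_ge0 (I (\1_setT)))); apply: I_le; try exact: bm_indic;
      move=> y; rewrite indicT normr1.
  have d0 : 0 < e / (B (\1_setT) + 1) by rewrite divr_gt0// ltr_wpDl.
  apply: (le_trans (H _ d0)); rewrite lerD2l mulrAC ler_pdivrMr ?ltr_wpDl//.
  by rewrite ler_wpM2l ?(ltW e0)// lerDl.
move=> e0.
pose D (i : nat) := [set y | v y < i%:R * e].
have dD i : downset (D i) by move=> a b; rewrite /D/= => vb /v_nd ab; exact: le_lt_trans vb.
have mD i := measurable_downset (dD i).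
(* The invariant of the sweep from left to right: [c] lies in the last nonempty slice met, and the
   increments of [f] swept so far have cost at most [v c * Delta]. *)
have Q (i : nat) : D i = set0 \/ exists2 c, D i c &
    `|I (fun y => f y * \1_(D i) y) - f c * I (\1_(D i))| <=
      v c * Delta + e * B (\1_(D i)).
  elim: i => [|i IH].
    by left; apply/seteqP; split=> // y; rewrite /D/= mul0r ltNge v0.
  pose C := D i.+1 `\` D i.
  have mC : measurable C by exact: measurableD.
  have DS : D i `<=` D i.+1.
    by move=> y; rewrite /D/= => /lt_le_trans; apply; rewrite ler_pM2r// ler_nat.
  have [C0|/set0P[c [Dc nDc]]] := eqVneq C set0.
    suff -> : D i.+1 = D i by exact: IH.
    apply/seteqP; split=> // y Dy; apply: contrapT => nDy.
    by have : C y by []; rewrite C0.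
  right; exists c => //.
  have DE : \1_(D i.+1) = (fun y => \1_(D i) y + \1_C y) :> (R -> R).
    apply/funext => y; rewrite !indicE /C.
    have [yD|yD] := pselect (D i y).
      rewrite (mem_set yD) (mem_set (DS _ yD)) memNset ?addr0//.
      by move=> [_ /(_ yD)].
    rewrite (memNset yD) add0r; congr (_%:R); congr nat_of_bool.
    apply/idP/idP; rewrite !inE; first by move=> ?; split.
    by case.
  have bD : bounded_measurable (\1_(D i) : R -> R) by exact: bm_indic.
  have bC : bounded_measurable (\1_C : R -> R) by exact: bm_indic.
  have fDE : I (fun y => f y * \1_(D i.+1) y) =
      I (fun y => f y * \1_(D i) y) + I (fun y => f y * \1_C y).
    rewrite -ID; [|exact: bmf1|exact: bmf1].
    by congr I; apply/funext => y; rewrite DE mulrDr.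
  have IE : I (\1_(D i.+1)) = I (\1_(D i)) + I (\1_C) by rewrite DE ID.
  have BE : B (\1_(D i.+1)) = B (\1_(D i)) + B (\1_C) by rewrite DE BD.
  have HC : `|I (fun y => f y * \1_C y) - f c * I (\1_C)| <= e * B (\1_C).
    rewrite -BZ// -mulNr -IZ//.
    rewrite -ID; [|exact: bmf1|exact: bmZ].
    apply: I_le; [by apply: bmD; [exact: bmf1|exact: bmZ]|exact: bmZ|].
    move=> y; rewrite -mulrDl normrM indicE.
    have [|] := boolP (y \in C); last by rewrite normr0 !mulr0.
    rewrite inE => -[Dy nDy]; rewrite normr1 !mulr1.
    move: Dc nDc Dy nDy; rewrite /D/= => vc1 /negP; rewrite -leNgt => vc2.
    move=> vy1 /negP; rewrite -leNgt => vy2.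
    rewrite -natr1 in vc1 vy1.
    have [cy|/ltW yc] := leP c y; first by have := fv cy; nra.
    by rewrite distrC; have := fv yc; nra.
  case: IH => [D0|[c0 Dc0 IH]].
    have z0 (g : R -> R) : bounded_measurable g -> I (fun y => g y * \1_(D i) y) = 0.
      move=> bg; rewrite (_ : (fun y => _) = (fun y => 0 * g y)); last first.
        by apply/funext => y; rewrite D0 indic0 mulr0 mul0r.
      by rewrite IZ// mul0r.
    have I0 : I (\1_(D i)) = 0.
      rewrite -(z0 (fun=> 1) (bm_cst 1)); congr I; apply/funext => y.
      by rewrite mul1r.
    have B0 : 0 <= B (\1_(D i)).
      by apply: (le_trans (normr_ge0 (I (\1_(D i))))); apply: I_le => // y; rewrite indicE; case: (_ \in _);
       rewrite ?normr1 ?normr0.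
    rewrite fDE z0// IE I0 BE !add0r (le_trans HC)//.
    have p1 : 0 <= v c * Delta by rewrite mulr_ge0.
    have p2 : 0 <= e * B (\1_(D i)) by rewrite mulr_ge0// ltW.
    move: (B (\1_(D i))) (B (\1_C)) p1 p2 => b1 c1 p1 p2; rewrite mulrDr; lra.
  have c0c : c0 <= c.
    rewrite leNgt; apply/negP => /ltW cc0; exact: nDc (dD i _ _ Dc0 cc0).
  have hD := I_downset (dD i).
  have hf := fv c0c.
  (* Moving the reference point from [c0] to [c] costs |f c - f c0| Delta ≤ (v c - v c0) Delta,
     which the growth of the first term of the invariant absorbs. *)
  have -> : I (fun y => f y * \1_(D i.+1) y) - f c * I (\1_(D i.+1)) =
    (I (fun y => f y * \1_(D i) y) - f c0 * I (\1_(D i))) -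
    (f c - f c0) * I (\1_(D i)) +
    (I (fun y => f y * \1_C y) - f c * I (\1_C)) by rewrite fDE IE; ring.
  rewrite BE (mulrDr e) [X in _ <= X]addrA (le_trans (ler_normD _ _))// lerD//.
  rewrite (le_trans (ler_normB _ _))//.
  have : `|(f c - f c0) * I (\1_(D i))| <= (v c - v c0) * Delta by rewrite normrM ler_pM.
  by lra.
(* As v ≤ 1, [D m] is the whole line. The boundary term f(c) I(1) costs |f c| Delta, and |f c| + v c
   ≤ 1. *)
have [m me] : exists m : nat, 1 < m%:R * e.
  exists (Num.bound e^-1); rewrite -ltr_pdivrMr// mul1r.
  by rewrite archi_boundP// invr_ge0 ltW.
have DT : D m = setT.
  apply/seteqP; split=> // y _; rewrite /D/=; apply: le_lt_trans me.
  by have := fv1 y y; have := normr_ge0 (f y); lra.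
case: (Q m) => [|[c _]]; rewrite DT.
  by move=> T0; have : [set: R] 0 by []; rewrite T0.
rewrite (_ : (fun y => f y * \1_setT y) = f); last first.
  by apply/funext => y; rewrite indicT mulr1.
move=> H; have hT := I_downset (D := setT) ltac:(by []).
have h1 : `|f c * I (\1_setT)| <= `|f c| * Delta by rewrite normrM ler_wpM2l.
have h2 : `|I f| <= `|I f - f c * I (\1_setT)| + `|f c * I (\1_setT)|.
  by have := ler_normD (I f - f c * I (\1_setT)) (f c * I (\1_setT)); rewrite subrK.
have h3 : (`|f c| + v c) * Delta <= 1 * Delta by rewrite ler_wpM2r.
by lra.
Qed.

End bv_functional.

(** * The bound for the wavelet density estimator *)

Section wavelet_density.
Context {R : realType}.
Local Notation mu := (@lebesgue_measure R).

(** [f] is the difference of the nondecreasing functions f + v and v. *)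
Lemma bv_measurable (f v : R -> R) :
  (forall x y, x <= y -> `|f y - f x| <= v y - v x) ->
  measurable_fun [set: R] f.
Proof.
move=> fv.
have mv : measurable_fun setT v.
  apply: nondecreasing_measurable => // x y xy.
  by rewrite -subr_ge0 (le_trans _ (fv x y xy))//.
have mfv : measurable_fun setT (fun x => f x + v x).
  apply: nondecreasing_measurable => // x y xy.
  by have := fv x y xy; rewrite ler_norml => /andP[]; lra.
rewrite (_ : f = (fun x => f x + v x - v x)); first exact: measurable_funB.
by apply/funext => x; rewrite addrK.
Qed.

Lemma integrable_compact_support (g : R -> R) (M a b : R) :
  measurable_fun [set: R] g -> (forall y, `|g y| <= M) ->
  (forall y, y \notin `[a, b] -> g y = 0) ->
  mu.-integrable [set: R] (EFin \o g).
Proof.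
move=> mg gM g0; have mab : measurable `[a, b]%classic by exact: measurable_itv.
suff : mu.-integrable `[a, b]%classic (EFin \o g).
  move=> H; have mab' : measurable (`[a, b]%classic : set (measurableTypeR R)) by [].
  have := (@integrable_mkcond _ _ _ mu _ (EFin \o g) mab').1 H.
  rewrite (_ : _ \_ _ = EFin \o g)//; apply/funext => y; rewrite /patch.
  by case: ifPn => // yab; rewrite /= g0//; apply: contra yab; rewrite inE.
have mab' : measurable (`[a, b]%classic : set (measurableTypeR R)) by [].
apply: (@measurable_bounded_integrable _ _ _ mu g _ mab').
- rewrite [X in (X < _)%E](@lebesgue_measure_itv R `[a, b])/=.
  by case: ifP => // _; rewrite -?EFinD ltry.
- by move=> ? Y mY; apply: measurableI => //; rewrite -[X in measurable X]setTI; exact: mg.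
- by exists M; split=> [|K MK y _ /=]; [exact: num_real|rewrite (le_trans (gM y))// ltW].
Qed.

Lemma finite_int_window (A : set int) (M : nat) :
  (forall k, A k -> `|k| <= M%:Z) -> finite_set A.
Proof.
move=> AM; apply: (@sub_finite_set _ _ [set (i%:Z - M%:Z) | i in `I_(M + M).+1]).
  move=> k /AM kM; exists (absz (k + M%:Z)); last by lia.
  by rewrite /=; lia.
exact: finite_image.
Qed.

Variables (phi : R -> R) (B1 B2 : R).
Hypothesis mphi : measurable_fun [set: R] phi.
Hypothesis phib : exists M, forall y, `|phi y| <= M.
Hypothesis Hsupp : forall x, x \notin `]B1, B2] -> phi x = 0.

(** Only those k with x - k in the support of [phi] contribute. This finite set does not depend on
    [y], so the kernel is a fixed finite combination of translates of [phi]. *)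
Lemma wkernel_finite (x : R) : exists r : seq int, forall y,
  wkernel phi y x = \sum_(k <- r) phi (y - k%:~R) * phi (x - k%:~R).
Proof.
pose J := [set k : int | x - B2 <= k%:~R <= x - B1].
have fJ : finite_set J.
  apply: (@finite_int_window _ (Num.bound (`|x - B2| + `|x - B1|))) => k /andP[k1 k2].
  have : `|k%:~R : R| <= `|x - B2| + `|x - B1|.
    have := ler_norm (x - B1); have := ler_norm (- (x - B2)); rewrite normrN.
    by have := normr_ge0 (x - B1); have := normr_ge0 (x - B2); rewrite ler_norml => *; apply/andP; split; lra.
  have b0 : 0 <= `|x - B2| + `|x - B1| by rewrite addr_ge0.
  move=> /le_lt_trans /(_ (archi_boundP b0)) /ltW.
  by rewrite -intr_norm [X in _ <= X -> _]pmulrn ler_int.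
exists (finmap.enum_fset (fset_set J)) => y; rewrite /wkernel.
rewrite -(@fsbig_widen _ _ _ _ J)//; first by rewrite fsbig_finite.
move=> k [_ nJ] /=; rewrite (Hsupp (x := x - k%:~R)) ?mulr0//.
apply/negP; rewrite in_itv/= => /andP[k1 k2]; apply: nJ; rewrite /J/=.
by apply/andP; split; lra.
Qed.

Lemma wdensity_integrable (j n : nat) (x : nat -> R) :
  mu.-integrable [set: R] (EFin \o wdensity phi j n x).
Proof.
have /choice[r Hr] : forall i : nat, exists r : seq int, forall y,
    wkernel phi y (2 ^+ j * x i) =
    \sum_(k <- r) phi (y - k%:~R) * phi (2 ^+ j * x i - k%:~R).
  by move=> i; exact: wkernel_finite.
have i1 (k : int) : mu.-integrable setT (EFin \o (fun y => phi (2 ^+ j * y - k%:~R))).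
  have [M phiM] := phib; have j0 : 0 < 2 ^+ j :> R by rewrite exprn_gt0.
  apply: (@integrable_compact_support _ M ((B1 + k%:~R) / 2 ^+ j) ((B2 + k%:~R) / 2 ^+ j)) => //.
    apply: (@measurableT_comp _ _ _ R R R phi setT (fun y => 2 ^+ j * y - k%:~R)) => //.
    by apply: measurable_funB => //; exact: measurable_funM.
  move=> y yn; apply: Hsupp; apply: contra yn; rewrite !in_itv/= => /andP[y1 y2].
  by rewrite ler_pdivrMr// ler_pdivlMr// mulrC; apply/andP; split; lra.
have -> : EFin \o wdensity phi j n x = (fun y => (n%:R^-1)%:E *
    \sum_(i < n) (2 ^+ j)%:E * \sum_(k <- r i)
      ((phi (2 ^+ j * x i - k%:~R))%:E * (phi (2 ^+ j * y - k%:~R))%:E))%E.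
  apply/funext => y; rewrite /wdensity /= EFinM; congr (_ * _)%E.
  rewrite -sumEFin; apply: eq_bigr => i _; rewrite EFinM; congr (_ * _)%E.
  rewrite Hr -sumEFin; apply: eq_bigr => k _.
  by rewrite -EFinM mulrC.
apply: integrableZl => //.
apply: (@integrable_sum _ _ _ mu setT measurableT) => i _.
apply: integrableZl => //.
apply: (@integrable_sum _ _ _ mu setT measurableT) => k _.
by apply: integrableZl => //; exact: i1.
Qed.

Lemma bv_functional_cdf_dist (j n : nat) (x : nat -> R) (f : R -> R) :
  (sup_norm f + p_variation 1 f <= 1)%E ->
  (`|wemp phi j n x f - emp n x f|%:E <= cdf_dist phi j n x)%E.
Proof.
move=> /variation_function[v [fv v0 fv1]].
have mf := bv_measurable fv.
have cdf_ge0 : (0 <= cdf_dist phi j n x)%E.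
  apply: (@le_trans _ _ (`|wemp_cdf phi j n x 0 - emp_cdf n x 0|%:E)).
    by rewrite lee_fin.
  by apply: ereal_sup_ubound; exists 0.
(* An infinite distance makes the claim trivial; a finite one serves as [Delta]. *)
have [cdf_fin|] := boolP (cdf_dist phi j n x \is a fin_num); last first.
  by rewrite ge0_fin_numE// -leNgt leye_eq => /eqP ->; exact: leey.
rewrite -(fineK cdf_fin) lee_fin.
apply: (bv_functional_le (wdensity_integrable j n x) _ mf fv v0 fv1) => s.
rewrite -lee_fin (fineK cdf_fin); apply: ereal_sup_ubound; exists s => //.
rewrite /wemp_cdf Rintegral_mkcond; congr (`|_ - _|%:E).
apply: eq_Rintegral => y _; rewrite /patch indicE.
by case: ifP => _; rewrite ?mul1r ?mul0r.
Qed.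

Lemma class_dist_le_cdf_dist (j n : nat) (x : nat -> R) (F : set (R -> R)) :
  (forall f, F f -> (sup_norm f + p_variation 1 f <= 1)%E) ->
  (class_dist phi j n x F <= cdf_dist phi j n x)%E.
Proof.
move=> Fbv; apply: ge_ereal_sup => _ [f Ff <-].
by apply: bv_functional_cdf_dist; exact: Fbv.
Qed.

End wavelet_density.

(** * Dyadic cells of equal probability *)

Section dyadic_coding.
Context {R : realType} (P : probability R R).
Hypothesis atomless : forall x : R, P [set x] = 0%E.

Let Plty (A : set R) : measurable A -> (P A < +oo)%E.
Proof. by move=> mA; rewrite -ge0_fin_numE// fin_num_measure. Qed.

Definition dfun (x : R) : R := fine (P `]-oo, x]%classic).

Lemma dfunE x : P `]-oo, x]%classic = (dfun x)%:E.
Proof. by rewrite /dfun fineK// fin_num_measure. Qed.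

Lemma dfun_nd x y : x <= y -> dfun x <= dfun y.
Proof.
move=> xy; rewrite -lee_fin -!dfunE le_measure ?inE//.
by apply: subset_itvl; rewrite bnd_simp.
Qed.

Lemma dfun01 x : 0 <= dfun x <= 1.
Proof. by rewrite -!lee_fin -dfunE measure_ge0 probability_le1. Qed.

Let dfun_left x (v : R) : (forall y, y < x -> dfun y <= v) -> dfun x <= v.
Proof.
move=> H; pose A n := `]-oo, x - n.+1%:R^-1]%classic.
have UA : \bigcup_n A n = `]-oo, x[%classic.
  apply/seteqP; split=> [y [n _]|y]; rewrite /A/= !in_itv/=.
    by move=> /le_lt_trans; apply; rewrite ltrBlDr ltrDl invr_gt0.
  move=> yx; have xy0 : 0 < x - y by rewrite subr_gt0.
  have [n _ Hn] := near_infty_natSinv_lt (PosNum xy0).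
  exists n => //; have := Hn n (leqnn n) => /= H1.
  by rewrite /A /= in_itv/= lerBrDr -lerBrDl ltW.
have -> : dfun x = fine (P `]-oo, x[%classic).
  rewrite /dfun -(@setUitv1 _ _ _ _ true) ?bnd_simp// measureU//.
    by rewrite [X in (_ + X)%E]atomless adde0.
  by apply/seteqP; split=> // y [/= + yx]; rewrite ?in_itv/= yx ltxx.
have : P (A n) @[n --> \oo] --> P (`]-oo, x[%classic).
  rewrite -UA; apply: nondecreasing_cvg_mu; first by move=> n; exact: measurable_itv.
    by apply: bigcupT_measurable => n; exact: measurable_itv.
  move=> m n mn; apply/subsetPset; apply: subset_itvl; rewrite bnd_simp.
  by rewrite lerD2l lerN2 lef_pV2 ?posrE// ler_nat.
move=> /cvge_to_le H1; rewrite -lee_fin fineK ?fin_num_measure//; apply: H1.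
by apply: nearW => n; rewrite /A dfunE lee_fin H// ltrBlDr ltrDl invr_gt0.
Qed.

Let dfun_right x (v : R) : (forall y, x < y -> v <= dfun y) -> v <= dfun x.
Proof.
move=> H; pose A n := `]-oo, x + n.+1%:R^-1]%classic.
have : P (A n) @[n --> \oo] --> P (`]-oo, x]%classic).
  have -> : `]-oo, x]%classic = \bigcap_n A n by exact: (itvNycEbigcap false).
  apply: nonincreasing_cvg_mu.
  - by apply: Plty; exact: measurable_itv.
  - by move=> n; exact: measurable_itv.
  - by apply: bigcapT_measurable => n; exact: measurable_itv.
  move=> m n mn; apply/subsetPset; apply: subset_itvl; rewrite bnd_simp.
  by rewrite lerD2l lef_pV2 ?posrE// ler_nat.
move=> /cvge_to_ge H1; rewrite -lee_fin -dfunE; apply: H1.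
by apply: nearW => n; rewrite /A dfunE lee_fin H// ltrDl invr_gt0.
Qed.

Let dfun_small (v : R) : 0 < v -> exists x, dfun x <= v.
Proof.
move=> v0; pose A n := `]-oo, - n%:R]%classic : set R.
have A0 : \bigcap_n A n = set0.
  apply/seteqP; split=> // y /(_ (Num.bound `|y|) I); rewrite /A/= in_itv/=.
  by rewrite lerNr leNgt (le_lt_trans (ler_norm _))// normrN archi_boundP.
have : P (A n) @[n --> \oo] --> 0%E.
  rewrite -(measure0 P) -A0; apply: nonincreasing_cvg_mu.
  - by apply: Plty; exact: measurable_itv.
  - by move=> n; exact: measurable_itv.
  - by apply: bigcapT_measurable => n; exact: measurable_itv.
  - move=> m n mn; apply/subsetPset; apply: subset_itvl; rewrite bnd_simp.
    by rewrite lerN2 ler_nat.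
move=> /fine_cvgP[_ /cvgr0Pnorm_le /(_ v v0)] [n _ /(_ n (leqnn n))] /= H.
by exists (- n%:R); rewrite /dfun (le_trans (ler_norm _)).
Qed.

Let dfun_big (v : R) : v < 1 -> exists x, v < dfun x.
Proof.
move=> v1; pose A n := `]-oo, n%:R]%classic : set R.
have AT : \bigcup_n A n = setT.
  apply/seteqP; split=> // y _; exists (Num.bound `|y|) => //.
  by rewrite /A/= in_itv/= (le_trans (ler_norm _))// ltW// archi_boundP.
have : P (A n) @[n --> \oo] --> 1%E.
  rewrite -(probability_setT P) -AT; apply: nondecreasing_cvg_mu.
  - by move=> n; exact: measurable_itv.
  - by apply: bigcupT_measurable => n; exact: measurable_itv.
  - move=> m n mn; apply/subsetPset; apply: subset_itvl; rewrite bnd_simp.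
    by rewrite ler_nat.
move=> /fine_cvgP[_ /cvgr_gt /(_ v v1)] [n _ /(_ n (leqnn n))] /= H.
by exists n%:R.
Qed.

(** Take the supremum of the points where [dfun] is at most [v]: right continuity, and left
    continuity from the absence of atoms, force the value [v] there. *)
Lemma dfun_quantile (v : R) : 0 < v < 1 -> exists b, dfun b = v.
Proof.
move=> /andP[v0 v1]; pose E := [set x | dfun x <= v].
have [x0 Ex0] : E !=set0 by exact: dfun_small.
have [x1 vx1] := dfun_big v1.
have hE : has_sup E.
  split; first by exists x0.
  exists x1 => y Ey; rewrite leNgt; apply/negP => /ltW /dfun_nd.
  by rewrite leNgt (le_lt_trans Ey).
exists (sup E); apply/eqP; rewrite eq_le; apply/andP; split.
  apply: dfun_left => y ys; have sy : 0 < sup E - y by rewrite subr_gt0.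
  have [z Ez] := sup_adherent sy hE; rewrite subKr => /ltW yz.
  exact: le_trans (dfun_nd yz) Ez.
apply: dfun_right => y ys; rewrite leNgt; apply/negP => /ltW Ey.
by have := ub_le_sup hE.2 Ey; rewrite leNgt ys.
Qed.

Lemma measurable_dfun_lt (u : R) : measurable [set x | dfun x < u].
Proof.
apply: is_interval_measurable => a b /= _ bu c /andP[_ cb].
exact: le_lt_trans (dfun_nd cb) bu.
Qed.

(** The probability integral transform: the set lies between the closed rays that end at quantiles
    of u - e and of u. *)
Lemma prob_dfun_lt (u : R) : 0 <= u <= 1 -> P [set x | dfun x < u] = u%:E.
Proof.
move=> /andP[u0 u1]; have mA := measurable_dfun_lt u.
apply/eqP; rewrite eq_le; apply/andP; split.
  have [->|un1] := eqVneq u 1; first by apply: probability_le1; exact: measurable_dfun_lt.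
  have {u1 un1}u1 : u < 1 by rewrite lt_neqAle un1.
  have [->|un0] := eqVneq u 0.
    rewrite (_ : mkset _ = set0) ?measure0//; apply/seteqP; split=> // x /=.
    by rewrite ltNge (andP (dfun01 x)).1.
  have {u0 un0}u0 : 0 < u by rewrite lt_neqAle eq_sym un0.
  have [|a <-] := @dfun_quantile u; first by rewrite u0.
  rewrite -dfunE; apply: le_measure; rewrite ?inE; first exact: measurable_dfun_lt.
    exact: measurable_itv.
  move=> y /=; rewrite in_itv/= => ya.
  by rewrite leNgt; apply/negP => /ltW /dfun_nd; rewrite leNgt ya.
apply/lee_addgt0Pr => e e0.
have [ue|eu] := leP (u - e) 0.
  apply: (@le_trans _ _ e%:E); first by rewrite lee_fin; lra.
  by rewrite leeDr.
have [|b bE] := @dfun_quantile (u - e); first by rewrite eu/=; lra.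
rewrite -leeBlDr// -EFinB -bE -dfunE; apply: le_measure; rewrite ?inE//.
move=> y /=; rewrite in_itv/= => /dfun_nd yb; apply: (le_lt_trans yb); rewrite bE; lra.
Qed.

(* The level-l dyadic cell of x; truncated so that the null set where the
   distribution function equals 1 is put in the last cell. *)
Definition dcode (l : nat) (x : R) : nat :=
  minn (Num.truncn (2 ^+ l * dfun x)) (2 ^ l).-1.

Lemma dcode_lt l x : (dcode l x < 2 ^ l)%N.
Proof.
rewrite /dcode (leq_ltn_trans (geq_minr _ _))// prednK// expn_gt0//.
Qed.

(** The cells are nested because the integer part of y is half that of 2 y, rounded down; the
    truncation agrees with this, since half of 2^(l+1) - 1, rounded down, is 2^l - 1. *)
Lemma dcode_half l x : dcode l x = (dcode l.+1 x)./2.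
Proof.
have y0 : 0 <= 2 ^+ l * dfun x by rewrite mulr_ge0// (andP (dfun01 x)).1.
have : Num.truncn (2 ^+ l * dfun x) = (Num.truncn (2 ^+ l.+1 * dfun x))./2.
  apply/eqP; rewrite exprS -mulrA; move: (2 ^+ l * dfun x) y0 => y y0.
  have y20 : 0 <= 2 * y by rewrite mulr_ge0.
  rewrite truncn_eq//; have := truncn_itv y20.
  set n := Num.truncn (2 * y) => /andP[n1 n2].
  have nE : n%:R = (odd n)%:R + 2 * (n./2)%:R :> R.
    by rewrite -natrM -natrD mul2n odd_double_half.
  rewrite -(natr1 n) in n2; rewrite -(natr1 n./2).
  have o0 : 0 <= (odd n)%:R :> R by exact: ler0n.
  have o1 : (odd n)%:R <= 1 :> R by case: (odd n).
  by apply/andP; split; lra.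
rewrite /dcode => ->; have : ((2 ^ l.+1).-1)./2 = (2 ^ l).-1.
  by rewrite expnS; have := expn_gt0 2 l; lia.
by lia.
Qed.

Lemma dcode_nd l x y : x <= y -> (dcode l x <= dcode l y)%N.
Proof.
move=> /dfun_nd xy; rewrite /dcode leq_min geq_minr andbT.
apply: (leq_trans (geq_minl _ _)); apply: le_truncn.
by rewrite ler_wpM2l// exprn_ge0.
Qed.

Let dcode_ltE l k : (k < 2 ^ l)%N ->
  [set x | (dcode l x < k)%N] = [set x | dfun x < k%:R / 2 ^+ l].
Proof.
move=> kl; have p0 : 0 < 2 ^+ l :> R by rewrite exprn_gt0.
have y0 x : 0 <= 2 ^+ l * dfun x by rewrite mulr_ge0 ?(ltW p0)// (andP (dfun01 x)).1.
have /negbTE kF : ~~ ((2 ^ l).-1 < k)%N by lia.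
by apply/seteqP; split=> x /=; rewrite /dcode gtn_min kF orbF truncn_lt_nat//
  ltr_pdivlMr// mulrC.
Qed.

Lemma measurable_dcode_lt l k : measurable [set x | (dcode l x < k)%N].
Proof.
have [kl|kl] := ltnP k (2 ^ l); first by rewrite dcode_ltE//; exact: measurable_dfun_lt.
rewrite (_ : mkset _ = setT)//; apply/seteqP; split=> // x _ /=.
exact: leq_trans (dcode_lt l x) kl.
Qed.

Let prob_dcode_lt l k : (k <= 2 ^ l)%N ->
  P [set x | (dcode l x < k)%N] = (k%:R / 2 ^+ l)%:E.
Proof.
have p0 : 0 < 2 ^+ l :> R by rewrite exprn_gt0.
rewrite leq_eqVlt => /predU1P[->|kl].
  rewrite natrX divff ?gt_eqF// (_ : mkset _ = setT) ?probability_setT//.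
  by apply/seteqP; split=> // x _ /=; exact: dcode_lt.
rewrite dcode_ltE// prob_dfun_lt//; apply/andP; split.
  by rewrite divr_ge0// ltW.
by rewrite ler_pdivrMr// mul1r -natrX ler_nat ltnW.
Qed.

Let dcode_eqE l k : [set x | dcode l x = k] =
  [set x | (dcode l x < k.+1)%N] `\` [set x | (dcode l x < k)%N].
Proof.
apply/seteqP; split=> x /=; first by move=> ->; rewrite ltnn.
by move=> [h1 /negP h2]; apply/eqP; rewrite eqn_leq -ltnS h1 leqNgt h2.
Qed.

Lemma measurable_dcode_eq l k : measurable [set x | dcode l x = k].
Proof. by rewrite dcode_eqE; apply: measurableD; exact: measurable_dcode_lt. Qed.

Lemma prob_dcode_eq l k : (k < 2 ^ l)%N ->
  P [set x | dcode l x = k] = (2 ^- l)%:E.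
Proof.
move=> kl; rewrite dcode_eqE measureD; last 3 first.
- exact: measurable_dcode_lt.
- exact: measurable_dcode_lt.
- by apply: Plty; exact: measurable_dcode_lt.
rewrite setIidr; last by move=> x /= /ltnW.
rewrite [X in (X - _)%E]prob_dcode_lt// [X in (_ - X)%E]prob_dcode_lt; last exact: ltnW.
by rewrite -EFinB -mulrBl -natrB// subSnn mul1r.
Qed.

End dyadic_coding.

(** * The Haar system of P and its coefficients *)

Section haar.
Context {R : realType} (P : probability R R).
Hypothesis atomless : forall x : R, P [set x] = 0%E.
Local Notation D := (dcode P).
Local Notation r2 := (Num.sqrt 2 : R).

Let r2_gt0 : 0 < r2. Proof. by rewrite sqrtr_gt0. Qed.

Let r2X l : r2 ^+ l * r2 ^+ l = 2 ^+ l.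
Proof. by rewrite -exprMn -expr2 sqr_sqrtr. Qed.

Definition cell (l k : nat) (x : R) : R := (D l x == k)%:R.

Lemma cell_indic l k : cell l k = \1_[set x | D l x = k].
Proof.
apply/funext => x; rewrite /cell indicE; congr (_%:R); congr nat_of_bool.
by apply/idP/idP; rewrite inE => /eqP.
Qed.

Lemma bm_cell l k : bounded_measurable (cell l k).
Proof. by rewrite cell_indic; apply: bm_indic; exact: measurable_dcode_eq. Qed.

Lemma exp_cell l k : (k < 2 ^ l)%N -> \int[P]_x cell l k x = 2 ^- l.
Proof.
move=> kl; rewrite cell_indic exp_indic; last exact: measurable_dcode_eq.
by rewrite prob_dcode_eq.
Qed.

Lemma cell_sum l (F : nat -> R) x : \sum_(k < 2 ^ l) F k * cell l k x = F (D l x).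
Proof.
rewrite (bigD1 (Ordinal (dcode_lt P l x)))//= /cell eqxx mulr1 big1 ?addr0// => k.
by rewrite -val_eqE/= eq_sym => /negbTE ->; rewrite mulr0.
Qed.

Lemma cell_nonempty l k : (k < 2 ^ l)%N -> exists x, D l x = k.
Proof.
move=> kl; apply: contrapT => nx.
have := prob_dcode_eq atomless kl; rewrite (_ : mkset _ = set0); last first.
  by apply/seteqP; split=> // x Dx; apply: nx; exists x.
rewrite measure0 => /esym/eqP; rewrite eqe invr_eq0 expf_eq0 pnatr_eq0 andbF.
by [].
Qed.

(** The parity of the code one level deeper tells the left half of the cell, with sign +, from the
    right half; the factor 2^(l/2) normalises in L^2(P). *)
Definition haar (l k : nat) (x : R) : R :=
  r2 ^+ l * cell l k x * (-1) ^+ odd (D l.+1 x).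

Lemma haarE l k x :
  haar l k x = r2 ^+ l * (cell l.+1 k.*2 x - cell l.+1 k.*2.+1 x).
Proof.
rewrite /haar /cell -mulrA; congr (_ * _); rewrite (dcode_half P l).
set m := D l.+1 x.
have [<-|mk] := eqVneq m./2 k; last first.
  have /negbTE -> : m != k.*2 by apply: contra mk => /eqP ->; rewrite doubleK.
  have /negbTE -> : m != k.*2.+1.
    by apply: contra mk => /eqP ->; rewrite /= uphalf_double.
  by rewrite mul0r subr0.
rewrite mul1r; have := odd_double_half m; case: (odd m) => /= mE.
  have /negbTE -> : m != m./2.*2 by lia.
  have -> : m == m./2.*2.+1 by lia.
  by rewrite sub0r expr1.
have /negbTE -> : m != m./2.*2.+1 by lia.
have -> : m == m./2.*2 by lia.
by rewrite subr0 expr0.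
Qed.

Lemma bm_haar l k : bounded_measurable (haar l k).
Proof.
rewrite (_ : haar l k = fun x => r2 ^+ l * (cell l.+1 k.*2 x - cell l.+1 k.*2.+1 x)).
  by apply: bmZ; apply: bmB; exact: bm_cell.
by apply/funext => x; rewrite haarE.
Qed.

Let double_lt l k : (k < 2 ^ l)%N -> (k.*2.+1 < 2 ^ l.+1)%N.
Proof. by rewrite expnS; lia. Qed.

Lemma exp_haar l k : (k < 2 ^ l)%N -> \int[P]_x haar l k x = 0.
Proof.
move=> kl; under eq_Rintegral do rewrite haarE.
rewrite expZ; last by apply: bmB; exact: bm_cell.
rewrite expB; [|exact: bm_cell|exact: bm_cell].
rewrite !exp_cell ?subrr ?mulr0//; first exact: double_lt.
exact: ltn_trans (double_lt kl).
Qed.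

Let cellX l k x n : cell l k x ^+ n.+1 = cell l k x.
Proof. by rewrite /cell -natrX; case: (_ == _); rewrite ?exp1n ?exp0n. Qed.

Let signX (b : bool) : ((-1) ^+ b) ^+ 2 = 1 :> R.
Proof. by case: b; rewrite ?expr1 ?expr0 ?sqrrN ?expr1n. Qed.

Lemma haar_sqr l k x : haar l k x ^+ 2 = 2 ^+ l * cell l k x.
Proof. by rewrite /haar !exprMn signX mulr1 cellX -r2X expr2. Qed.

Lemma haar_pow4 l k x : haar l k x ^+ 4 = 2 ^+ l * 2 ^+ l * cell l k x.
Proof.
rewrite (_ : 4%N = (2 * 2)%N)// exprM haar_sqr exprMn cellX expr2; ring.
Qed.

Lemma exp_haar_sqr l k : (k < 2 ^ l)%N -> \int[P]_x (haar l k x ^+ 2) = 1.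
Proof.
move=> kl; under eq_Rintegral do rewrite haar_sqr.
by rewrite expZ ?exp_cell ?mulfV ?expf_neq0//; exact: bm_cell.
Qed.

Lemma exp_haar_pow4 l k : (k < 2 ^ l)%N -> \int[P]_x (haar l k x ^+ 4) = 2 ^+ l.
Proof.
move=> kl; under eq_Rintegral do rewrite haar_pow4.
by rewrite expZ ?exp_cell ?mulfK ?expf_neq0//; exact: bm_cell.
Qed.

Lemma haar_abs l k x : `|haar l k x| = r2 ^+ l * cell l k x.
Proof.
rewrite /haar !normrM normrX (ger0_norm (ltW r2_gt0)) normr_sign mulr1.
by rewrite ger0_norm// /cell.
Qed.

Let dcode_div l m x : D l x = (D (l + m) x %/ 2 ^ m)%N.
Proof.
elim: m => [|m IH]; first by rewrite addn0 expn0 divn1.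
rewrite IH addnS (dcode_half P (l + m)) -divn2 -divnMA.
by rewrite expnS.
Qed.

(** On the support of the finer function the coarser one is a constant [c], read off from the code
    k', and the finer one has mean zero. *)
Lemma haar_orth l k l' k' : (k' < 2 ^ l')%N -> (l < l')%N ->
  \int[P]_x (haar l k x * haar l' k' x) = 0.
Proof.
move=> kl ll'.
pose c := r2 ^+ l * ((k' %/ 2 ^ (l' - l))%N == k)%:R * (-1) ^+ odd (k' %/ 2 ^ (l' - l.+1))%N.
have E x : haar l k x * haar l' k' x = c * haar l' k' x.
  have [Dx|Dx] := eqVneq (D l' x) k'; last first.
    by rewrite (_ : haar l' k' x = 0) ?mulr0// /haar /cell (negbTE Dx) mulr0 mul0r.
  congr (_ * _); rewrite /haar /cell /c.
  rewrite (dcode_div l (l' - l)) subnKC ?(ltnW ll')// Dx.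
  by rewrite (dcode_div l.+1 (l' - l.+1)) subnKC// Dx.
under eq_Rintegral do rewrite E.
by rewrite expZ ?exp_haar ?mulr0//; exact: bm_haar.
Qed.

Lemma haar_disjoint l k k' x : k != k' -> haar l k x * haar l k' x = 0.
Proof.
move=> kk'; rewrite /haar /cell; have [->|Dk] := eqVneq (D l x) k.
  by rewrite (negbTE kk') mulr0 mul0r mulr0.
by rewrite mulr0 !mul0r.
Qed.

Lemma exp_haarM l k l' k' : (k < 2 ^ l)%N -> (k' < 2 ^ l')%N ->
  \int[P]_x (haar l k x * haar l' k' x) = ((l == l') && (k == k'))%:R.
Proof.
move=> kl kl'; have [ll'|ll'|->] := ltngtP l l'.
- exact: haar_orth.
- under eq_Rintegral do rewrite mulrC.
  by rewrite haar_orth.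
- have [->|kk'] := eqVneq k k'.
    by under eq_Rintegral do rewrite -expr2; rewrite exp_haar_sqr.
  by under eq_Rintegral do rewrite (haar_disjoint _ _ kk'); rewrite exp_cst.
Qed.

(* The Haar functions are numbered by i.+1 = 2 ^ l + k with k < 2 ^ l. *)
Definition hlev (i : nat) := trunc_log 2 i.+1.
Definition hoff (i : nat) := (i.+1 - 2 ^ hlev i)%N.
Definition hfun (i : nat) := haar (hlev i) (hoff i).

Lemma hidx l k : (k < 2 ^ l)%N ->
  hlev ((2 ^ l).-1 + k) = l /\ hoff ((2 ^ l).-1 + k) = k.
Proof.
move=> kl; have e0 : (0 < 2 ^ l)%N by rewrite expn_gt0.
have E : ((2 ^ l).-1 + k).+1 = (2 ^ l + k)%N by rewrite -addSn prednK.
have L : hlev ((2 ^ l).-1 + k) = l.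
  rewrite /hlev E; apply: trunc_log_eq => //.
  by rewrite leq_addr expnS mul2n -addnn ltn_add2l.
by split=> //; rewrite /hoff L E addKn.
Qed.

Lemma hoff_lt i : (hoff i < 2 ^ hlev i)%N.
Proof.
rewrite /hoff /hlev.
have := trunc_log_bounds (isT : (1 < 2)%N) (isT : (0 < i.+1)%N).
move=> /andP[h1 h2]; rewrite expnS in h2; lia.
Qed.

Lemma big_levels (F : nat -> R) L : \sum_(i < (2 ^ L).-1) F i =
  \sum_(l < L) \sum_(k < 2 ^ l) F ((2 ^ l).-1 + k)%N.
Proof.
elim: L => [|L IH]; first by rewrite !big_ord0.
rewrite big_ord_recr/= -IH -!(big_mkord xpredT F).
have e0 : (0 < 2 ^ L)%N by rewrite expn_gt0.
rewrite (big_cat_nat (n := (2 ^ L).-1))//=; last by rewrite expnS; lia.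
congr (_ + _); rewrite -[X in \sum_(X <= _ < _) _]add0n big_addn big_mkord.
rewrite (_ : ((2 ^ L.+1).-1 - (2 ^ L).-1)%N = (2 ^ L)%N); last by rewrite expnS; lia.
by apply: eq_bigr => k _; rewrite addnC.
Qed.

Lemma exp_hfunM i j : \int[P]_x (hfun i x * hfun j x) = (i == j)%:R.
Proof.
rewrite exp_haarM; try exact: hoff_lt.
congr (_%:R); congr nat_of_bool; apply/idP/eqP => [/andP[/eqP h1 /eqP h2]|->].
  have := h2; rewrite /hoff -h1; have := trunc_log_bounds (isT : (1 < 2)%N) (isT : (0 < i.+1)%N).
  have := trunc_log_bounds (isT : (1 < 2)%N) (isT : (0 < j.+1)%N).
  rewrite -/(hlev i) -/(hlev j) -h1; lia.
by rewrite !eqxx.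
Qed.

Section oscillation.
Variables (f : R -> R) (e : nat -> nat -> R).
Hypothesis bf : bounded_measurable f.
Hypothesis e0 : forall l k, 0 <= e l k.
Hypothesis fe : forall l x y, D l x = D l y -> `|f x - f y| <= e l (D l x).
Hypothesis sume : forall l, \sum_(k < 2 ^ l) e l k <= 1.

Definition hcoef (l k : nat) : R := \int[P]_x (f x * haar l k x).

Let bfM g : bounded_measurable g -> bounded_measurable (fun x => f x * g x).
Proof. by move=> bg; apply: bmM. Qed.

Let hcoefE l k : hcoef l k = r2 ^+ l *
  (\int[P]_x (f x * cell l.+1 k.*2 x) - \int[P]_x (f x * cell l.+1 k.*2.+1 x)).
Proof.
rewrite -expB; [|by apply: bfM; exact: bm_cell|by apply: bfM; exact: bm_cell].
rewrite -expZ; last by apply: bmB; apply: bfM; exact: bm_cell.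
by apply: eq_Rintegral => x _; rewrite haarE; ring.
Qed.

(** As a Haar function has mean zero, [f] may be recentred at a point of the cell and is then
    bounded there by its oscillation [e l k]; the L^1 norm of a Haar function is 2^(-l/2). *)
Lemma hcoef_le l k : (k < 2 ^ l)%N -> `|hcoef l k| <= r2 ^- l * e l k.
Proof.
move=> kl; have [x0 Dx0] := cell_nonempty kl.
have rl : 0 < r2 ^+ l by rewrite exprn_gt0.
have bfr : bounded_measurable (fun x => (f x - f x0) * haar l k x).
  by apply: bmM; [apply: bmB => //; exact: bm_cst|exact: bm_haar].
have -> : hcoef l k = \int[P]_x ((f x - f x0) * haar l k x).
  rewrite (_ : \int[P]_x _ = \int[P]_x (f x * haar l k x - f x0 * haar l k x)).
    rewrite expB; [|by apply: bfM; exact: bm_haar|by apply: bmZ; exact: bm_haar].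
    by rewrite expZ ?exp_haar ?mulr0 ?subr0//; exact: bm_haar.
  by apply: eq_Rintegral => x _; rewrite mulrBl.
rewrite (le_trans (exp_abs _ bfr))//.
apply: (@le_trans _ _ (\int[P]_x (e l k * r2 ^+ l * cell l k x))).
  apply: exp_le; [exact: bm_abs|by apply: bmZ; exact: bm_cell|move=> x].
  rewrite normrM haar_abs mulrA /cell; case: eqP => [Dx|]; last by rewrite !mulr0.
  by rewrite !mulr1 ler_wpM2r ?(ltW rl)// -Dx fe// Dx.
rewrite expZ ?exp_cell//; last exact: bm_cell.
rewrite -r2X invfM mulrA mulfK ?gt_eqF// mulrC.
by [].
Qed.

(** The oscillations at one level sum to at most 1; 5/7 is a rational upper bound of 1/√2, as
    (7/5)^2 = 49/25 ≤ 2. *)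
Lemma hcoef_sum_le l : \sum_(k < 2 ^ l) `|hcoef l k| <= (5 / 7) ^+ l.
Proof.
apply: (@le_trans _ _ (r2 ^- l)).
  apply: (@le_trans _ _ (r2 ^- l * \sum_(k < 2 ^ l) e l k)).
    by rewrite mulr_sumr; apply: ler_sum => k _; exact: hcoef_le.
  by rewrite ler_piMr// invr_ge0 exprn_ge0// ltW.
rewrite -exprVn lerXn2r ?nnegrE ?invr_ge0 ?(ltW r2_gt0) ?divr_ge0//.
rewrite -[leRHS]invrK lef_pV2 ?posrE ?invr_gt0 ?divr_gt0//.
have -> : (5 / 7 : R)^-1 = Num.sqrt ((7 / 5) ^+ 2).
  by rewrite sqrtr_sqr ger0_norm ?divr_ge0// invf_div.
by rewrite ler_sqrt// expr2; lra.
Qed.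

(** The conditional expectation of [f] given the cell of level L. *)
Let cmean L x : R := 2 ^+ L * \int[P]_y (f y * cell L (D L x) y).

Let cmean_close L x : `|f x - cmean L x| <= e L (D L x).
Proof.
have p0 : 0 < 2 ^+ L :> R by rewrite exprn_gt0.
have kl := dcode_lt P L x.
have bc := bm_cell L (D L x).
have -> : f x - cmean L x = 2 ^+ L * \int[P]_y ((f x - f y) * cell L (D L x) y).
  rewrite (_ : \int[P]_y ((f x - f y) * _) =
     \int[P]_y (f x * cell L (D L x) y - f y * cell L (D L x) y)); last first.
    by apply: eq_Rintegral => y _; rewrite mulrBl.
  rewrite expB; [|exact: bmZ|exact: bfM].
  by rewrite expZ// exp_cell// mulrBr /cmean mulrCA mulfV ?mulr1// gt_eqF.
have bd : bounded_measurable (fun y => (f x - f y) * cell L (D L x) y).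
  by apply: bmM => //; apply: bmB => //; exact: bm_cst.
rewrite normrM gtr0_norm// -ler_pdivlMl// (le_trans (exp_abs _ bd))//.
apply: (@le_trans _ _ (\int[P]_y (e L (D L x) * cell L (D L x) y))).
  apply: exp_le; [exact: bm_abs|exact: bmZ|move=> y].
  rewrite normrM /cell; case: eqP => [Dy|]; last by rewrite normr0 !mulr0.
  by rewrite normr1 !mulr1 fe.
by rewrite expZ// exp_cell// mulrC.
Qed.

Lemma haar_level_sum l (F : nat -> R) x :
  \sum_(k < 2 ^ l) F k * haar l k x = F (D l x) * haar l (D l x) x.
Proof.
rewrite (bigD1 (Ordinal (dcode_lt P l x)))//= big1 ?addr0// => k.
rewrite -val_eqE/= /haar /cell eq_sym => /negbTE ->.
by rewrite mulr0 mul0r mulr0.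
Qed.

(** Telescoping: the Haar terms of level L turn the mean over a cell into the means over its two
    halves. *)
Let cmeanE L x : \sum_(l < L) \sum_(k < 2 ^ l) hcoef l k * haar l k x =
  cmean L x - \int[P]_y f y.
Proof.
elim: L => [|L IH].
  rewrite big_ord0 /cmean expr0 mul1r (_ : \int[P]_y (f y * _) = \int[P]_y f y) ?subrr//.
  apply: eq_Rintegral => y _; rewrite /cell.
  have E : D 0 y == D 0 x.
    by have := dcode_lt P 0 x; have := dcode_lt P 0 y; rewrite expn0; lia.
  by rewrite E mulr1.
rewrite big_ord_recr/= IH haar_level_sum.
suff -> : cmean L.+1 x = cmean L x + hcoef L (D L x) * haar L (D L x) x by ring.
rewrite hcoefE /haar /cell eqxx mulr1 /cmean.
set k := D L x; set I0 := \int[P]_y (f y * cell L.+1 k.*2 y).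
set I1 := \int[P]_y (f y * cell L.+1 k.*2.+1 y).
have -> : \int[P]_y (f y * cell L k y) = I0 + I1.
  rewrite /I0 /I1 -expD; [|by apply: bfM; exact: bm_cell|by apply: bfM; exact: bm_cell].
  apply: eq_Rintegral => y _; rewrite -mulrDr; congr (_ * _).
  rewrite /cell (dcode_half P L y); set m := D L.+1 y.
  have [<-|mk] := eqVneq m./2 k; last first.
    have /negbTE -> : m != k.*2 by apply: contra mk => /eqP ->; rewrite doubleK.
    have /negbTE -> : m != k.*2.+1.
      by apply: contra mk => /eqP ->; rewrite /= uphalf_double.
    by rewrite addr0.
  have := odd_double_half m; case: (odd m) => /= mE.
    have /negbTE -> : m != m./2.*2 by lia.
    have -> : m == m./2.*2.+1 by lia.
    by rewrite add0r.
  have /negbTE -> : m != m./2.*2.+1 by lia.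
  have -> : m == m./2.*2 by lia.
  by rewrite addr0.
have kE : k = (D L.+1 x)./2 by rewrite /k (dcode_half P).
have := odd_double_half (D L.+1 x); rewrite -kE; case: (odd _) => /= DE.
  have -> : D L.+1 x = k.*2.+1 by lia.
  rewrite -/I1 exprS expr1 -[2 ^+ L]r2X; ring.
have -> : D L.+1 x = k.*2 by lia.
rewrite -/I0 exprS expr0 -[2 ^+ L]r2X; ring.
Qed.

Definition residual L x : R := f x - \int[P]_y f y -
  \sum_(l < L) \sum_(k < 2 ^ l) hcoef l k * haar l k x.

Lemma residual_le L x : `|residual L x| <= \sum_(k < 2 ^ L) e L k * cell L k x.
Proof.
rewrite cell_sum /residual cmeanE (_ : _ - _ - _ = f x - cmean L x); last by ring.
exact: cmean_close.
Qed.

Lemma bm_residual L : bounded_measurable (residual L).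
Proof.
apply: bmB; first by apply: bmB => //; exact: bm_cst.
by apply: bm_sum => l _; apply: bm_sum => k _; apply: bmZ; exact: bm_haar.
Qed.

Lemma exp_residual_le L : \int[P]_x `|residual L x| <= 2 ^- L.
Proof.
have bs : bounded_measurable (fun x => \sum_(k < 2 ^ L) e L k * cell L k x).
  by apply: bm_sum => k _; apply: bmZ; exact: bm_cell.
apply: (@le_trans _ _ (\int[P]_x (\sum_(k < 2 ^ L) e L k * cell L k x))).
  by apply: exp_le => //; [apply: bm_abs; exact: bm_residual|exact: residual_le].
rewrite exp_sum; last by move=> k _; apply: bmZ; exact: bm_cell.
rewrite (eq_bigr (fun k : 'I_(2 ^ L) => e L k * 2 ^- L)); last first.
  by move=> k _; rewrite expZ ?exp_cell//; exact: bm_cell.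
by rewrite -mulr_suml ler_piMl ?sume ?invr_ge0 ?exprn_ge0.
Qed.

End oscillation.

(** Truncated Parseval identity: the error is the integral of [residual f L] against [g], where the
    residual has L^1 norm at most 2^-L and |g| ≤ 1. *)
Lemma haar_covariance (f g : R -> R) (e : nat -> nat -> R) L :
  bounded_measurable f -> (forall l k, 0 <= e l k) ->
  (forall l x y, D l x = D l y -> `|f x - f y| <= e l (D l x)) ->
  (forall l, \sum_(k < 2 ^ l) e l k <= 1) ->
  bounded_measurable g -> (forall x, `|g x| <= 1) ->
  `|\int[P]_x (f x * g x) - (\int[P]_x f x) * (\int[P]_x g x) -
    \sum_(l < L) \sum_(k < 2 ^ l) hcoef f l k * hcoef g l k| <= 2 ^- L.
Proof.
move=> bf e0 fe sume bg g1.
have br := bm_residual bf L.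
have -> : \int[P]_x (f x * g x) - (\int[P]_x f x) * (\int[P]_x g x) -
    \sum_(l < L) \sum_(k < 2 ^ l) hcoef f l k * hcoef g l k =
    \int[P]_x (residual f L x * g x).
  rewrite (_ : \int[P]_x (residual f L x * g x) = \int[P]_x ((f x * g x - (\int[P]_y f y) * g x) -
     \sum_(l < L) \sum_(k < 2 ^ l) hcoef f l k * (g x * haar l k x))); last first.
    apply: eq_Rintegral => x _; rewrite /residual !mulrBl; congr (_ - _ - _).
    rewrite mulr_suml; apply: eq_bigr => l _; rewrite mulr_suml; apply: eq_bigr => k _.
    by ring.
  have bgh l k : bounded_measurable (fun x => g x * haar l k x).
    by apply: bmM => //; exact: bm_haar.
  rewrite expB; last 2 first.
  - by apply: bmB; [exact: bmM|exact: bmZ].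
  - by apply: bm_sum => l _; apply: bm_sum => k _; exact: bmZ.
  rewrite expB; [|exact: bmM|exact: bmZ].
  rewrite expZ//; congr (_ - _).
  rewrite exp_sum; last by move=> l _; apply: bm_sum => k _; exact: bmZ.
  apply: eq_bigr => l _; rewrite exp_sum; last by move=> k _; exact: bmZ.
  by apply: eq_bigr => k _; rewrite expZ.
have brg : bounded_measurable (fun x => residual f L x * g x) by exact: bmM.
rewrite (le_trans (exp_abs _ brg))//.
apply: (le_trans _ (exp_residual_le bf fe sume L)).
apply: exp_le; [exact: bm_abs|exact: bm_abs|move=> x].
by rewrite normrM ler_piMr.
Qed.

End haar.

Lemma geometric_tail (R : realType) (q : R) (m n : nat) : 0 <= q -> q < 1 ->
  \sum_(m <= l < n) q ^+ l <= q ^+ m / (1 - q).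
Proof.
move=> q0 q1; have q10 : 0 < 1 - q by rewrite subr_gt0.
rewrite ler_pdivlMr//; have [nm|mn] := leqP n m.
  by rewrite big_geq// mul0r exprn_ge0.
suff -> : (\sum_(m <= l < n) q ^+ l) * (1 - q) = q ^+ m - q ^+ n.
  by rewrite gerBl exprn_ge0.
elim: n mn => // n IH; rewrite ltnS leq_eqVlt => /predU1P[->|mn].
  by rewrite big_nat1 exprS; ring.
by rewrite big_nat_recr ?(ltnW mn)//= mulrDl IH// exprS; ring.
Qed.

(** * Oscillations of a function of the ball over dyadic cells *)

Section bv_oscillation.
Context {R : realType} (P : probability R R).

(** The cells of a level follow each other from left to right, so the oscillation on each is bounded
    by an increment of the variation function, and these increments telescope. *)
Lemma bv_oscillation (f : R -> R) : (sup_norm f + p_variation 1 f <= 1)%E ->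
  [/\ bounded_measurable f, forall x, `|f x| <= 1 &
   exists e : nat -> nat -> R, [/\ forall l k, 0 <= e l k,
     forall l x y, dcode P l x = dcode P l y -> `|f x - f y| <= e l (dcode P l x)
   & forall l, \sum_(k < 2 ^ l) e l k <= 1]].
Proof.
move=> /variation_function[v [fv v0 fv1]].
have f1 x : `|f x| <= 1 by have := fv1 x x; have := v0 x; lra.
have v1 x : v x <= 1 by have := fv1 x x; have := normr_ge0 (f x); lra.
split=> //; first by split; [exact: bv_measurable fv|exists 1].
(* [t l k], the supremum of this set, is the value of [v] just left of cell k. Adding 0 keeps the
   set nonempty for k = 0 and is harmless as v ≥ 0. *)
pose S l k : set R := [set s | s = 0 \/ exists2 y, (dcode P l y < k)%N & s = v y].
pose t l k := sup (S l k).
have Sub l k : has_ubound (S l k) by exists 1 => s [->|[y _ ->]].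
have S0 l k : S l k 0 by left.
have t0 l k : 0 <= t l k by exact: ub_le_sup.
have t1 l k : t l k <= 1 by apply: ge_sup; [exists 0|move=> s [->|[y _ ->]]].
exists (fun l k => t l k.+1 - t l k); split.
- move=> l k; rewrite subr_ge0; apply: ge_sup; first by exists 0.
  move=> s [->//|[y yk ->]]; apply: ub_le_sup => //; right; exists y => //.
  exact: ltnW.
- move=> l.
  have up z : v z <= t l (dcode P l z).+1.
    by apply: ub_le_sup => //; right; exists z.
  have lo z : t l (dcode P l z) <= v z.
    apply: ge_sup; first by exists 0.
    move=> s [->//|[y yk ->]]; have [yz|zy] := leP y z.
      by rewrite -subr_ge0 (le_trans _ (fv _ _ yz)).
    by have := dcode_nd P l (ltW zy); rewrite leqNgt yk.
  move=> x y xy; have [le_xy|/ltW le_yx] := leP x y.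
    rewrite distrC (le_trans (fv _ _ le_xy))//.
    by have := lo x; have := up y; rewrite -xy; lra.
  rewrite (le_trans (fv _ _ le_yx))//.
  by have := lo y; have := up x; rewrite -xy; lra.
- move=> l; rewrite -(big_mkord xpredT (fun k => t l k.+1 - t l k)) telescope_sumr//.
  by have := t0 l 0%N; have := t1 l (2 ^ l)%N; lra.
Qed.

End bv_oscillation.

(** * The empirical process on Haar functions and on the ball *)

Section empirical_process.
Context {R : realType} (P : probability R R) (Pr : probability (sample_space R) R).
Hypothesis HPr : infinite_product P Pr.
Hypothesis atomless : forall x : R, P [set x] = 0%E.

Definition nu (n : nat) (x : nat -> R) (g : R -> R) : R :=
  Num.sqrt n%:R * (emp n x g - \int[P]_y g y).

Lemma nuD n x f g : bounded_measurable f -> bounded_measurable g ->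
  nu n x (fun y => f y + g y) = nu n x f + nu n x g.
Proof.
by move=> bf bg; rewrite /nu expD// /emp big_split/= mulrDr; ring.
Qed.

Lemma nuZ n x c g : bounded_measurable g ->
  nu n x (fun y => c * g y) = c * nu n x g.
Proof. by move=> bg; rewrite /nu expZ// /emp -mulr_sumr; ring. Qed.

Lemma nu_cst n x c : (0 < n)%N -> nu n x (fun=> c) = 0.
Proof.
move=> n0; rewrite /nu exp_cst /emp sumr_const card_ord -[c *+ n]mulr_natl mulKf.
  by rewrite subrr mulr0.
by rewrite pnatr_eq0 -lt0n.
Qed.

Lemma nu_sum n x (I : Type) (r : seq I) (F : I -> R -> R) : (0 < n)%N ->
  (forall i, bounded_measurable (F i)) ->
  nu n x (fun y => \sum_(i <- r) F i y) = \sum_(i <- r) nu n x (F i).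
Proof.
move=> n0 bF; elim: r => [|i r IH].
  rewrite big_nil -[RHS](nu_cst x 0 n0); congr nu.
  by apply/funext => y; rewrite big_nil.
rewrite big_cons -IH -nuD//; last exact: bm_sum.
by congr nu; apply/funext => y; rewrite big_cons.
Qed.

Lemma nu_psum n x g : (0 < n)%N -> \int[P]_y g y = 0 ->
  nu n x g = (Num.sqrt n%:R)^-1 * psum (fun=> g) n x.
Proof.
move=> n0 g0; rewrite /nu g0 subr0 /emp /psum mulrA; congr (_ * _).
have s0 : Num.sqrt n%:R != 0 :> R by rewrite sqrtr_eq0 -ltNge ltr0n.
apply: (mulfI s0); rewrite mulrA -expr2 sqr_sqrtr ?ler0n// mulfV ?mulfV//.
by rewrite pnatr_eq0 -lt0n.
Qed.

Lemma bm_nu n g : bounded_measurable g ->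
  @bounded_measurable _ (sample_space R) R (fun x => nu n x g).
Proof.
move=> bg; apply: bmZ; apply: (bmB _ (bm_cst _)); apply: bmZ.
apply: (@bm_sum _ (sample_space R)) => i _.
exact: (bm_comp (@measurable_coord R i)).
Qed.

Lemma exp_nu_pow4 n g : (0 < n)%N -> bounded_measurable g -> \int[P]_y g y = 0 ->
  \int[Pr]_x (nu n x g ^+ 4) <=
  3 * (\int[P]_y (g y ^+ 2)) ^+ 2 + (\int[P]_y (g y ^+ 4)) / n%:R.
Proof.
move=> n0 bg g0.
have nn0 : n%:R != 0 :> R by rewrite pnatr_eq0 -lt0n.
have s4 : (Num.sqrt n%:R)^-1 ^+ 4 = n%:R ^- 2 :> R.
  by rewrite exprVn -[4%N]/(2 * 2)%N exprM sqr_sqrtr ?ler0n.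
under eq_Rintegral do rewrite nu_psum// exprMn s4.
rewrite expZ; last by apply: bmX; exact: bm_psum.
rewrite ler_pdivrMl ?exprn_gt0 ?ltr0n//.
rewrite (le_trans (exp_psum_pow4 HPr bg g0 n))//.
rewrite mulrDr mulrCA !mulrA le_eqVlt; apply/orP; left; apply/eqP.
congr (_ + _); first by ring.
by field.
Qed.

Lemma nu_center n x g : (0 < n)%N -> bounded_measurable g ->
  nu n x g = nu n x (fun y => g y - \int[P]_z g z).
Proof.
move=> n0 bg; rewrite (nuD _ _ bg (bm_cst (- \int[P]_z g z))) nu_cst// addr0.
by [].
Qed.

(** The general bound reads 3 + 2^l / n here; it stays bounded as long as cells hold at least one
    observation on average, which is why the expansion stops near level log_2 n. *)
Lemma exp_nu_haar_pow4 n l k : (0 < n)%N -> (k < 2 ^ l)%N -> (2 ^ l <= n)%N ->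
  \int[Pr]_x (nu n x (haar P l k) ^+ 4) <= 4.
Proof.
move=> n0 kl ln; rewrite (le_trans (exp_nu_pow4 n0 (bm_haar P l k) (exp_haar atomless kl)))//.
rewrite exp_haar_sqr// exp_haar_pow4// expr1n mulr1.
have : 2 ^+ l / n%:R <= 1 :> R by rewrite ler_pdivrMr ?ltr0n// mul1r -natrX ler_nat.
by lra.
Qed.

(** With p = 2^-L, the centred indicator has second and fourth moments at most p, and 1/n ≤ p; the
    two terms of the general bound are then at most 3 p^2 and p^2. *)
Lemma exp_nu_cell_pow4 n L k : (0 < n)%N -> (k < 2 ^ L)%N -> (2 ^ L <= n)%N ->
  \int[Pr]_x (nu n x (cell P L k) ^+ 4) <= 4 * 2 ^- L * 2 ^- L.
Proof.
move=> n0 kL Ln; have bc := bm_cell P L k.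
pose p : R := 2 ^- L; have p0 : 0 <= p by rewrite invr_ge0 exprn_ge0.
have p1 : p <= 1 by rewrite invf_le1 ?exprn_gt0// exprn_ege1// ler1n.
pose g y := cell P L k y - p.
have bg : bounded_measurable g by apply: bmB => //; exact: bm_cst.
have g0 : \int[P]_y g y = 0 by rewrite expB ?exp_cst ?exp_cell ?subrr//; exact: bm_cst.
have -> : \int[Pr]_x (nu n x (cell P L k) ^+ 4) = \int[Pr]_x (nu n x g ^+ 4).
  by apply: eq_Rintegral => x _; rewrite (nu_center _ n0 bc) exp_cell.
rewrite (le_trans (exp_nu_pow4 n0 bg g0))//.
have g2 y : g y ^+ 2 <= p + (1 - 2 * p) * cell P L k y - p * (1 - p).
  rewrite /g /cell; case: (_ == _) => /=; rewrite ?mulr1n ?mulr0n le_eqVlt; apply/orP; left; apply/eqP; ring.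
have g2p : \int[P]_y (g y ^+ 2) <= p.
  apply: (@le_trans _ _ (\int[P]_y (p + (1 - 2 * p) * cell P L k y - p * (1 - p)))).
    apply: exp_le => //; first exact: bmX.
    by apply: (bmB _ (bm_cst _)); apply: (bmD (bm_cst _)); exact: bmZ.
  rewrite expB; [|by apply: (bmD (bm_cst _)); exact: bmZ|exact: bm_cst].
  rewrite expD; [|exact: bm_cst|exact: bmZ].
  by rewrite !exp_cst expZ// exp_cell// -/p; nra.
have g4p : \int[P]_y (g y ^+ 4) <= p.
  apply: le_trans g2p; apply: exp_le; [exact: bmX|exact: bmX|move=> y].
  have g1 : g y ^+ 2 <= 1 by rewrite /g /cell; case: (_ == _) => /=; rewrite ?mulr1n ?mulr0n expr2; nra.
  by rewrite -[4%N]/(2 + 2)%N exprD ler_piMl// sqr_ge0.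
have m20 : 0 <= \int[P]_y (g y ^+ 2) by apply: Rintegral_ge0 => y _; exact: sqr_ge0.
have np : n%:R^-1 <= p :> R.
  by rewrite /p lef_pV2 ?posrE ?ltr0n ?exprn_gt0// -natrX ler_nat.
have n00 : 0 <= n%:R^-1 :> R by rewrite invr_ge0.
have h1 : (\int[P]_y (g y ^+ 2)) ^+ 2 <= p * p by rewrite expr2 ler_pM.
have h2 : (\int[P]_y (g y ^+ 4)) / n%:R <= p * p.
  by apply: ler_pM => //; apply: Rintegral_ge0 => y _; rewrite exprn_even_ge0.
rewrite -/p; lra.
Qed.

(** The residual is dominated by E, the sum of the oscillations times the cell indicators. So
    |ν_n(residual)| ≤ √n (P_n E + P E) = ν_n(E) + 2 √n P E, where P E ≤ 2^-L and ν_n(E) combines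
    values on cells with weights of sum at most 1. *)
Lemma nu_residual_le (f : R -> R) n x L (delta : R) : (0 < n)%N ->
  (sup_norm f + p_variation 1 f <= 1)%E ->
  (forall k, (k < 2 ^ L)%N -> `|nu n x (cell P L k)| <= delta) ->
  `|nu n x f - \sum_(l < L) \sum_(k < 2 ^ l) hcoef P f l k * nu n x (haar P l k)| <=
  delta + 2 * Num.sqrt n%:R / 2 ^+ L.
Proof.
move=> n0 /(bv_oscillation P)[bf f1 [e [e0 fe sume]]] Hcell.
have br := bm_residual P bf L.
have bh l k := bm_haar P l k.
have -> : nu n x f - \sum_(l < L) \sum_(k < 2 ^ l) hcoef P f l k * nu n x (haar P l k) =
    nu n x (residual P f L).
  have -> : residual P f L = (fun y => (f y + - \int[P]_z f z) +
     (-1) * \sum_(l < L) \sum_(k < 2 ^ l) hcoef P f l k * haar P l k y).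
    by apply/funext => y; rewrite /residual mulN1r.
  have bs : bounded_measurable (fun y => \sum_(l < L) \sum_(k < 2 ^ l) hcoef P f l k * haar P l k y).
    by apply: bm_sum => l _; apply: bm_sum => k _; exact: bmZ.
  rewrite nuD; [|by apply: (bmD bf); exact: bm_cst|exact: bmZ].
  rewrite (nuD _ _ bf (bm_cst _)) nu_cst// addr0 nuZ// mulN1r; congr (_ - _).
  rewrite nu_sum//; last by move=> l; apply: bm_sum => k _; exact: bmZ.
  apply: eq_bigr => l _; rewrite nu_sum//; last by move=> k; exact: bmZ.
  by apply: eq_bigr => k _; rewrite nuZ.
pose E y := \sum_(k < 2 ^ L) e L k * cell P L k y.
have rE y : `|residual P f L y| <= E y by exact: residual_le.
have bE : bounded_measurable E.
  by apply: bm_sum => k _; apply: bmZ; exact: bm_cell.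
have s0 : 0 <= Num.sqrt n%:R :> R by exact: sqrtr_ge0.
have IE : \int[P]_y E y <= 2 ^- L.
  rewrite exp_sum; last by move=> k _; apply: bmZ; exact: bm_cell.
  rewrite (eq_bigr (fun k : 'I_(2 ^ L) => e L k * 2 ^- L)); last first.
    by move=> k _; rewrite expZ ?exp_cell//; exact: bm_cell.
  by rewrite -mulr_suml ler_piMl ?sume ?invr_ge0 ?exprn_ge0.
have nuE : nu n x E <= delta.
  rewrite nu_sum//; last by move=> k; apply: bmZ; exact: bm_cell.
  have d0 : 0 <= delta.
    by apply: (le_trans (normr_ge0 _) (Hcell 0%N _)); rewrite expn_gt0.
  apply: (@le_trans _ _ (\sum_(k < 2 ^ L) e L k * delta)).
    apply: ler_sum => k _; rewrite nuZ; last exact: bm_cell.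
    by rewrite ler_wpM2l// (le_trans (ler_norm _))// Hcell.
  by rewrite -mulr_suml ler_piMl.
have h1 : `|nu n x (residual P f L)| <= Num.sqrt n%:R * (emp n x E + \int[P]_y E y).
  rewrite /nu normrM (ger0_norm s0) ler_wpM2l// (le_trans (ler_normB _ _))// lerD//.
    rewrite /emp normrM ger0_norm ?invr_ge0// ler_wpM2l ?invr_ge0//.
    by rewrite (le_trans (ler_norm_sum _ _ _))//; apply: ler_sum => i _; exact: rE.
  rewrite (le_trans (exp_abs _ br))//.
  by apply: exp_le => //; exact: bm_abs.
apply: (le_trans h1).
have -> : Num.sqrt n%:R * (emp n x E + \int[P]_y E y) =
   nu n x E + 2 * Num.sqrt n%:R * \int[P]_y E y by rewrite /nu; ring.
by rewrite lerD// ler_wpM2l// mulr_ge0.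
Qed.

(* A Markov bound for the statistic [T], which controls at once all Haar
   levels between [l0] and [L] and the finest cells. *)
Lemma empirical_haar_approx (l0 L n : nat) (delta : R) : (0 < n)%N ->
  (l0 <= L)%N -> (2 ^ L <= n)%N -> 0 < delta ->
  exists2 B : set (sample_space R), measurable B /\
    (Pr B <= (24 * (512 / 625) ^+ l0 + 4 * delta ^- 4 / 2 ^+ L)%:E)%E &
  forall x, ~ B x -> forall f, (sup_norm f + p_variation 1 f <= 1)%E ->
   `|nu n x f - \sum_(i < (2 ^ l0).-1) hcoef P f (hlev i) (hoff i) * nu n x (hfun P i)|
   <= 10 * (25 / 28) ^+ l0 + delta + 2 * Num.sqrt n%:R / 2 ^+ L.
Proof.
move=> n0 l0L Ln d0.
(* If T1 ≤ 1, every |ν_n(h)| at level l is at most (5/4)^l. There are 2^l functions at level l and 2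
   (4/5)^4 = 512/625 < 1, so the mean of T1 is a geometric tail; 24 exceeds 4 / (1 - 512/625). *)
pose T1 x := \sum_(l0 <= l < L) \sum_(k < 2 ^ l) ((4 / 5) ^+ l) ^+ 4 * nu n x (haar P l k) ^+ 4.
pose T2 x := \sum_(k < 2 ^ L) delta ^- 4 * nu n x (cell P L k) ^+ 4.
have b1 l k : @bounded_measurable _ (sample_space R) R
    (fun x => ((4 / 5) ^+ l) ^+ 4 * nu n x (haar P l k) ^+ 4).
  by apply: bmZ; apply: bmX; apply: bm_nu; exact: bm_haar.
have b2 k : @bounded_measurable _ (sample_space R) R
    (fun x => delta ^- 4 * nu n x (cell P L k) ^+ 4).
  by apply: bmZ; apply: bmX; apply: bm_nu; exact: bm_cell.
have bT1 : @bounded_measurable _ (sample_space R) R T1.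
  by apply: (@bm_sum _ (sample_space R)) => l _; apply: (@bm_sum _ (sample_space R)) => k _.
have bT2 : @bounded_measurable _ (sample_space R) R T2.
  by apply: (@bm_sum _ (sample_space R)) => k _.
have p4 (y : R) : 0 <= y ^+ 4 by rewrite exprn_even_ge0.
have T10 x : 0 <= T1 x.
  by apply: sumr_ge0 => l _; apply: sumr_ge0 => k _; rewrite mulr_ge0.
have d4 : 0 <= delta ^- 4 by rewrite invr_ge0.
have T20 x : 0 <= T2 x by apply: sumr_ge0 => k _; rewrite mulr_ge0.
(* Off [B] all terms of both sums are at most 1, which bounds the Haar functions and, through [T2],
   the finest cells by [delta]. *)
pose B : set (sample_space R) := [set x | 1 < T1 x + T2 x].
have bT := bmD bT1 bT2.
exists B.
  split; first by apply: measurable_set_lt => //; exact: bT.1.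
  have := @markov_bm _ _ _ Pr _ 1 bT _ ltr01.
  rewrite divr1 => H; apply: (le_trans (H _)).
    by move=> x; rewrite addr_ge0.
  rewrite lee_fin (expD _ bT1 bT2) lerD//.
    rewrite /T1 exp_sum; last by move=> l _; apply: (@bm_sum _ (sample_space R)) => k _.
    apply: (@le_trans _ _ (\sum_(l0 <= l < L) 4 * (512 / 625) ^+ l)).
      rewrite [leLHS]big_nat_cond [leRHS]big_nat_cond; apply: ler_sum => l /andP[/andP[_ lL] _].
      rewrite exp_sum; last by move=> k _.
      apply: (@le_trans _ _ (\sum_(k < 2 ^ l) ((4 / 5) ^+ l) ^+ 4 * 4)).
        apply: ler_sum => k _; rewrite expZ; last first.
          by apply: bmX; apply: bm_nu; exact: bm_haar.
        rewrite ler_wpM2l//; apply: exp_nu_haar_pow4 => //.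
        by apply: leq_trans Ln; rewrite leq_exp2l// ltnW.
      rewrite sumr_const card_ord -[_ *+ (2 ^ l)%N]mulr_natl natrX -exprM mulnC exprM mulrA -exprMn mulrC.
      by rewrite (_ : 2 * (4 / 5) ^+ 4 = 512 / 625)//; field.
    rewrite -mulr_sumr.
    have q0 : 0 <= 512 / 625 :> R by lra.
    have q1 : 512 / 625 < 1 :> R by lra.
    have := geometric_tail l0 L q0 q1.
    have := exprn_ge0 l0 q0; set Q := (512 / 625) ^+ l0; set S := \sum_(_ <= _ < _) _.
    rewrite (_ : Q / (1 - 512 / 625) = Q * (625 / 113)); last by field.
    by move=> ? ?; lra.
  rewrite /T2 exp_sum; last by move=> k _.
  apply: (@le_trans _ _ (\sum_(k < 2 ^ L) delta ^- 4 * (4 * 2 ^- L * 2 ^- L))).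
    apply: ler_sum => k _; rewrite expZ; last by apply: bmX; apply: bm_nu; exact: bm_cell.
    by rewrite ler_wpM2l//; exact: exp_nu_cell_pow4.
  rewrite sumr_const card_ord -[_ *+ (2 ^ L)%N]mulr_natl natrX le_eqVlt; apply/orP; left; apply/eqP.
  by field; apply/andP; split; rewrite ?expf_neq0// gt_eqF.
move=> x; rewrite /B/= => /negP; rewrite -leNgt => Tx f fbv.
have pow4_le1 (c y : R) : 0 < c -> c ^+ 4 * y ^+ 4 <= 1 -> `|y| <= c^-1.
  move=> c0; rewrite -exprMn => H.
  have : `|c * y| ^+ 4 <= 1 by rewrite -normrX ger0_norm.
  by rewrite expr_le1// normrM gtr0_norm// -ler_pdivlMl// mulr1.
have Hhaar l k : (l0 <= l < L)%N -> (k < 2 ^ l)%N -> `|nu n x (haar P l k)| <= (5 / 4) ^+ l.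
  move=> lL kl.
  rewrite (_ : (5 / 4) ^+ l = ((4 / 5) ^+ l)^-1); last by rewrite -exprVn invf_div.
  apply: pow4_le1; first by rewrite exprn_gt0// divr_gt0.
  apply: le_trans Tx; apply: (@le_trans _ _ (T1 x)); last by rewrite lerDl.
  rewrite /T1 (bigD1_seq l)/= ?mem_index_iota ?iota_uniq//=.
  rewrite (bigD1 (Ordinal kl))//= -addrA lerDl addr_ge0//; apply: sumr_ge0 => *.
    by rewrite mulr_ge0.
  by apply: sumr_ge0 => *; rewrite mulr_ge0.
have Hcell k : (k < 2 ^ L)%N -> `|nu n x (cell P L k)| <= delta.
  move=> kL; rewrite -[delta]invrK; apply: pow4_le1; first by rewrite invr_gt0.
  rewrite exprVn; apply: le_trans Tx; apply: (@le_trans _ _ (T2 x)); last by rewrite lerDr.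
  rewrite /T2 (bigD1 (Ordinal kL))//= lerDl; apply: sumr_ge0 => *.
  by rewrite mulr_ge0.
have := nu_residual_le n0 fbv Hcell.
have -> : \sum_(i < (2 ^ l0).-1) hcoef P f (hlev i) (hoff i) * nu n x (hfun P i) =
    \sum_(0 <= l < l0) \sum_(k < 2 ^ l) hcoef P f l k * nu n x (haar P l k).
  rewrite (big_levels (fun i => hcoef P f (hlev i) (hoff i) * nu n x (hfun P i))) big_mkord.
  apply: eq_bigr => l _; apply: eq_bigr => k _.
  by have [h1 h2] := hidx (ltn_ord k); rewrite /hfun h1 h2.
rewrite -(big_mkord xpredT (fun l => \sum_(k < 2 ^ l) hcoef P f l k * nu n x (haar P l k))).
rewrite (big_cat_nat (n := l0))//=; set S0 := \sum_(0 <= _ < l0) _; set S1 := \sum_(l0 <= _ < L) _.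
move=> H.
(* Coefficients decaying like (5/7)^l meet values growing like (5/4)^l; 10 exceeds 1 / (1 - 25/28) =
   28/3. *)
have HS1 : `|S1| <= 10 * (25 / 28) ^+ l0.
  rewrite /S1 (le_trans (ler_norm_sum _ _ _))//.
  apply: (@le_trans _ _ (\sum_(l0 <= l < L) (25 / 28) ^+ l)).
    rewrite [leLHS]big_nat_cond [leRHS]big_nat_cond; apply: ler_sum => l /andP[lL _].
    rewrite (le_trans (ler_norm_sum _ _ _))//.
    apply: (@le_trans _ _ (\sum_(k < 2 ^ l) `|hcoef P f l k| * (5 / 4) ^+ l)).
      by apply: ler_sum => k _; rewrite normrM ler_wpM2l// Hhaar.
    have [bf f1 [e [e0 fe sume]]] := bv_oscillation P fbv.
    rewrite -mulr_suml (_ : 25 / 28 = 5 / 7 * (5 / 4)); last by field.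
    rewrite [leRHS]exprMn ler_wpM2r ?exprn_ge0 ?divr_ge0//.
    exact: (hcoef_sum_le atomless bf fe sume).
  have q0 : 0 <= 25 / 28 :> R by lra.
  have q1 : 25 / 28 < 1 :> R by lra.
  have := geometric_tail l0 L q0 q1.
  have := exprn_ge0 l0 q0; set Q := (25 / 28) ^+ l0; set S := \sum_(_ <= _ < _) _.
  rewrite (_ : Q / (1 - 25 / 28) = Q * (28 / 3)); last by field.
  by move=> ? ?; lra.
rewrite (_ : nu n x f - S0 = (nu n x f - (S0 + S1)) + S1); last by ring.
by rewrite (le_trans (ler_normD _ _))// addrC -addrA lerD.
Qed.

End empirical_process.

(** * Transport of an atomless law to another by quantiles *)

Lemma prob_unique_ray (R : realType) (P1 P2 : probability R R) :
  (forall c : R, P1 `]-oo, c[%classic = P2 `]-oo, c[%classic) ->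
  forall A, measurable A -> P1 A = P2 A.
Proof.
move=> Hc A mA.
apply: (measure_unique (@RGenInftyO.G R) (fun n => `]-oo, n%:R[%classic)) => //.
- exact: RGenInftyO.measurableE.
- move=> _ _ [a ->] [b ->]; exists (Num.min a b).
  by apply/seteqP; split=> x /=; rewrite !in_itv/= lt_min => /andP.
- by move=> n; exists n%:R.
- apply/seteqP; split=> // x _; exists (Num.bound `|x|) => //=.
  by rewrite in_itv/= (le_lt_trans (ler_norm x))// archi_boundP.
- by move=> _ [c ->]; exact: Hc.
- by move=> n; rewrite (le_lt_trans (probability_le1 _ _))// ltry.
Qed.

Section quantile_transform.
Context {R : realType} (P Q : probability R R).
Hypothesis atomless : forall x : R, P [set x] = 0%E.
Hypothesis atomlessQ : forall x : R, Q [set x] = 0%E.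

Lemma measurable_dfun_le (u : R) : measurable [set x | dfun P x <= u].
Proof.
apply: is_interval_measurable => a b /= _ bu c /andP[_ cb].
exact: le_trans (dfun_nd P cb) bu.
Qed.

Lemma prob_dfun_le (u : R) : 0 <= u -> (P [set x | (dfun P x <= u)%R] <= u%:E)%E.
Proof.
move=> u0; have [u1|u1] := leP 1 u.
  rewrite (le_trans (probability_le1 _ _)) ?lee_fin//; exact: measurable_dfun_le.
apply/lee_addgt0Pr => e e0.
pose v := Num.min 1 (u + e).
have uv : u < v by rewrite lt_min u1 ltrDl.
have v01 : 0 <= v <= 1 by rewrite ge_min lexx (le_trans u0)// ltW.
apply: (@le_trans _ _ (P [set x | dfun P x < v])).
  apply: le_measure; rewrite ?inE; [exact: measurable_dfun_le|exact: measurable_dfun_lt|].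
  by move=> x /= /le_lt_trans; exact.
by rewrite prob_dfun_lt// -EFinD lee_fin ge_min lexx orbT.
Qed.

(** [xi] is a quantile function of Q composed with the distribution function of P. It makes normal
    variables out of the observations, so that the Gaussian limit can be built on the sample space
    itself. *)
Lemma quantile_transform : exists xi : R -> R, measurable_fun [set: R] xi /\
  forall A, measurable A -> P (xi @^-1` A) = Q A.
Proof.
have /choice[b bE] : forall v : R, exists b : R, 0 < v < 1 -> dfun Q b = v.
  move=> v; have [v01|] := boolP (0 < v < 1); last by exists 0.
  by have [b] := dfun_quantile atomlessQ v01; exists b.
pose A : set R := [set x | 0 < dfun P x < 1].
(* The default 0 is taken off [A], a null set because [dfun P] is uniformly distributed. *)
pose xi x : R := if 0 < dfun P x < 1 then b (dfun P x) else 0.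
have mA : measurable A.
  apply: is_interval_measurable => x y /= /andP[x0 x1] /andP[y0 y1] z /andP[xz zy].
  by apply/andP; rewrite (lt_le_trans x0 (dfun_nd P xz)) (le_lt_trans (dfun_nd P zy) y1).
have PA : P (~` A) = 0%E.
  have m0 := measurable_dfun_le 0.
  have m1 := measurable_dfun_lt P 1.
  apply/eqP; rewrite eq_le measure_ge0 andbT.
  apply: (@le_trans _ _ (P ([set x | dfun P x <= 0] `|` ~` [set x | dfun P x < 1]))).
    apply: le_measure; rewrite ?inE; [exact: measurableC| |].
      by apply: measurableU => //; exact: measurableC.
    move=> x; rewrite /A/= => /negP; rewrite negb_and -!leNgt => /orP[|x1]; [by left|right].
    by move=> /(le_lt_trans x1); rewrite ltxx.
  apply: (le_trans (measureU2 P m0 (measurableC m1))).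
  rewrite [X in (_ + X)%E](probability_setC P m1) prob_dfun_lt ?ler01 ?lexx// subee// adde0.
  exact: prob_dfun_le.
(* [b] picks one quantile per level, so points with the same value of [dfun P] have the same image;
   this rules out a decrease. *)
have xi_nd x y : A x -> A y -> x <= y -> xi x <= xi y.
  move=> Ax Ay xy; rewrite /xi ifT// ifT// leNgt; apply/negP => yx.
  have := dfun_nd Q (ltW yx); rewrite !bE// => yxE.
  have yxEq : dfun P x = dfun P y by apply/eqP; rewrite eq_le yxE dfun_nd.
  by move: yx; rewrite yxEq ltxx.
have mxi_lt (c : R) : measurable (xi @^-1` `]-oo, c[%classic).
  rewrite -(setIT (_ @^-1` _)) -(setUv A) setIUr; apply: measurableU.
    apply: is_interval_measurable => x y /= [xc Ax] [yc Ay] z /andP[xz zy].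
    have Az : A z.
      move: Ax Ay => /andP[x0 x1] /andP[y0 y1]; apply/andP; split.
        exact: lt_le_trans (dfun_nd P xz).
      exact: le_lt_trans (dfun_nd P zy) _.
    split=> //; move: yc; rewrite !in_itv/=; exact: le_lt_trans (xi_nd _ _ Az Ay zy).
  have [c0|c0] := ltP 0 c.
    rewrite setIidr; first exact: measurableC.
    by move=> x /= /negP/negbTE nA; rewrite in_itv/= /xi nA.
  rewrite (_ : _ `&` _ = set0)//; apply/seteqP; split=> // x [/=].
  by rewrite in_itv/= /xi => + /negP/negbTE nA; rewrite nA ltNge c0.
have mxi : measurable_fun [set: R] xi.
  apply: (measurability (@RGenInftyO.G R)); first exact: RGenInftyO.measurableE.
  by move=> _ [_ [c ->] <-]; rewrite setTI; exact: mxi_lt.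
exists xi; split=> //.
pose P' := image_law P mxi.
apply: (prob_unique_ray (P1 := P')) => c; rewrite image_lawE.
have Qc : Q `]-oo, c[%classic = (dfun Q c)%:E.
  by rewrite -dfunE -(@setUitv1 _ _ _ c true) ?bnd_simp// (measureU0 _ _ (atomlessQ c))//; exact: measurable_itv.
have /andP[v0 v1] := dfun01 Q c.
apply/eqP; rewrite eq_le Qc; apply/andP; split.
  apply: (@le_trans _ _ (P ([set x | dfun P x <= dfun Q c] `|` ~` A))).
    apply: le_measure; rewrite ?inE; first exact: mxi_lt.
      by apply: measurableU; [exact: measurable_dfun_le|exact: measurableC].
    move=> x /=; rewrite in_itv/= => xc; have [Ax|] := pselect (A x); [left|by right].
    by move: xc; rewrite /xi ifT// => /ltW /(dfun_nd Q); rewrite bE.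
  apply: (le_trans (measureU2 P (measurable_dfun_le _) (measurableC mA))).
  by rewrite [X in (_ + X)%E]PA adde0; exact: prob_dfun_le.
rewrite -[leLHS](prob_dfun_lt atomless (dfun01 Q c)).
apply: (@le_trans _ _ (P (xi @^-1` `]-oo, c[%classic `|` ~` A))).
  apply: le_measure; rewrite ?inE; first exact: measurable_dfun_lt.
    by apply: measurableU => //; exact: measurableC.
  move=> x /= xc; have [Ax|] := pselect (A x); [left|by right].
  rewrite in_itv/= /xi ifT// ltNge; apply/negP => /(dfun_nd Q).
  by rewrite bE// leNgt xc.
apply: (le_trans (measureU2 P (mxi_lt c) (measurableC mA))).
by rewrite [X in (_ + X)%E]PA adde0.
Qed.

End quantile_transform.

Lemma normal_prob_atomless (R : realType) (m s x : R) : normal_prob m s [set x] = 0%E.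
Proof.
have /null_content_dominatesP := @normal_prob_dominates R m s; apply.
  exact: measurable_set1.
exact: lebesgue_measure_set1.
Qed.

(** * Topology and Borel sets of the space of bounded functions *)

(** Compactness, as a near-covering property, is applied to the filter of properties that hold for
    all large enough finite lists of points of [K]. *)
Lemma compact_seq_cover (T : topologicalType) (K : set T) (A : T -> set T) :
  compact K -> (forall x, K x -> nbhs x (A x)) ->
  exists2 s : seq T, {in s, forall x, K x} &
    forall x, K x -> exists2 y, y \in s & A y x.
Proof.
move=> /compact_near_coveringP Kc KA.
pose F : set_system (seq T) := [set S | exists s0 : seq T,
  {in s0, forall x, K x} /\
  forall s : seq T, {subset s0 <= s} -> {in s, forall x, K x} -> S s].
have FF : Filter F.
  split.
  - by exists [::].
  - move=> S1 S2 [s1 [K1 H1]] [s2 [K2 H2]]; exists (s1 ++ s2); split.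
      by move=> x; rewrite mem_cat => /orP[/K1|/K2].
    move=> s ss Ks; split; [apply: H1|apply: H2] => // x xs; apply: ss;
      by rewrite mem_cat xs ?orbT.
  - by move=> S1 S2 S12 [s0 [K0 H]]; exists s0; split=> // s ss Ks; exact/S12/H.
have [] := Kc _ F (fun s x => exists2 y, y \in s & A y x) FF.
  move=> x Kx; exists (A x, [set s : seq T | x \in s]) => /=.
    split; first exact: KA.
    exists [:: x]; split=> [y|s ss _]; first by rewrite inE => /eqP ->.
    by apply: ss; rewrite inE.
  by move=> [z s] /= [Axz xs]; exists x.
by move=> s [Ks H]; exists s => // x Kx; exact: (H s).
Qed.

Section uniform_space.
Context {R : realType} (T : choiceType).
Implicit Types (z : {uniform T -> R}) (A : set {uniform T -> R}).

Lemma nbhs_uniform z A : nbhs z A <->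
  exists2 e : R, 0 < e & forall z', (forall t, `|z t - z' t| < e) -> A z'.
Proof.
split.
  move=> /uniform_nbhs[E [/= entE EA]].
  move: entE; rewrite -entourage_ballE => -[e /= e0 eE]; exists e => // z' zz'.
  by apply: EA => t _; apply: eE; exact: zz'.
move=> [e e0 eA]; apply/uniform_nbhs.
exists [set xy | ball xy.1 e xy.2]; split.
  by rewrite -entourage_ballE; exists e.
by move=> z' /= zz'; apply: eA => t; exact: zz'.
Qed.

Lemma open_linf : open (@linf R T).
Proof.
rewrite openE => z [M zM]; apply/nbhs_uniform; exists 1 => // z' zz'.
exists (M + 1) => t; rewrite -[z' t](subrK (z t)) (le_trans (ler_normD _ _))//.
by rewrite addrC lerD// distrC ltW.
Qed.

Lemma measurable_linf : measurable (@linf R T : set (uniform_borel T)).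
Proof. by apply: sub_sigma_algebra; exact: open_linf. Qed.

Lemma measurable_fun_continuous_linf (H : {uniform T -> R} -> R) :
  {within @linf R T, continuous H} ->
  measurable_fun (@linf R T : set (uniform_borel T)) (H : uniform_borel T -> R).
Proof.
rewrite continuous_open_subspace; last exact: open_linf.
move=> cH; apply: (measurability (@RGenOpens.G R)).
  exact: RGenOpens.measurableE.
move=> _ [_ [a [b ->]] <-]; apply: sub_sigma_algebra.
rewrite openE => z [zl Hz]; apply: filterI; first by apply: open_nbhs_nbhs; split=> //; exact: open_linf.
have := cH z; rewrite inE => /(_ zl); apply.
by apply: open_nbhs_nbhs; split => //; exact: interval_open.
Qed.

End uniform_space.

Lemma bigmin_attained (R : realType) (I : eqType) (s : seq I) (F : I -> R) (m : R) :
  \big[Num.min/m]_(i <- s) F i = m \/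
  exists2 i, i \in s & \big[Num.min/m]_(i <- s) F i = F i.
Proof.
elim: s => [|i s IH]; first by left; rewrite big_nil.
rewrite big_cons; set b := \big[_/_]_(_ <- s) _ in IH *.
have [_|_] := leP (F i) b; first by right; exists i => //; rewrite mem_head.
case: IH => [|[j js jE]]; first by left.
by right; exists j => //; rewrite inE js orbT.
Qed.

(** * Lipschitz substitutes for continuous functionals *)

Section sup_lipschitz.
Context {R : realType} (T : choiceType).
Implicit Types (z w : {uniform T -> R}) (f g : {uniform T -> R} -> R).
Local Notation linf := (@linf R T).

(** The uniform distance between bounded functions; the element 0 keeps the set nonempty when the
    index type is empty. *)
Definition supd z w : R := sup [set r | r = 0 \/ exists t, r = `|z t - w t|].

Lemma supd_ub z w : linf z -> linf w ->
  has_ubound [set r : R | r = 0 \/ exists t, r = `|z t - w t|].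
Proof.
move=> [M zM] [N wN]; exists (Num.max 0 (M + N)) => r [->|[t ->]].
  by rewrite le_max lexx.
by rewrite le_max; apply/orP; right; rewrite (le_trans (ler_normB _ _))// lerD.
Qed.

Lemma supd_ge0 z w : linf z -> linf w -> 0 <= supd z w.
Proof. by move=> zl wl; apply: ub_le_sup; [exact: supd_ub|left]. Qed.

Lemma le_supd z w t : linf z -> linf w -> `|z t - w t| <= supd z w.
Proof. by move=> zl wl; apply: ub_le_sup; [exact: supd_ub|right; exists t]. Qed.

Lemma supd_le z w (r : R) : 0 <= r -> (forall t, `|z t - w t| <= r) -> supd z w <= r.
Proof.
by move=> r0 H; apply: ge_sup; [exists 0; left|move=> y [->//|[t ->]]].
Qed.

Lemma supd_triangle z z' w (r : R) : linf z -> linf w -> 0 <= r ->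
  (forall t, `|z t - z' t| <= r) -> supd z' w <= supd z w + r.
Proof.
move=> zl wl r0 zr; apply: supd_le; first by rewrite addr_ge0// supd_ge0.
move=> t; rewrite (_ : z' t - w t = (z t - w t) - (z t - z' t)); last by ring.
by rewrite (le_trans (ler_normB _ _))// lerD// le_supd.
Qed.

(** Any uniform bound [r] may be used in place of the distance, so that coordinatewise estimates
    apply directly. *)
Definition sup_lipschitz f := exists2 C : R, 0 <= C &
  forall z z' (r : R), linf z -> linf z' -> 0 <= r ->
    (forall t, `|z t - z' t| <= r) -> `|f z - f z'| <= C * r.

Lemma slip_supd w : linf w -> sup_lipschitz (supd^~ w).
Proof.
move=> wl; exists 1 => // z z' r zl zl' r0 zr; rewrite mul1r ler_distl; apply/andP.
have h1 := supd_triangle zl wl r0 zr.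
have h2 : supd z w <= supd z' w + r.
  by apply: supd_triangle => // t; rewrite distrC.
by split; lra.
Qed.

Lemma slip_affine a b f : sup_lipschitz f -> sup_lipschitz (fun z => a + b * f z).
Proof.
move=> [C C0 fC]; exists (`|b| * C); first by rewrite mulr_ge0.
move=> z z' r zl zl' r0 zr.
rewrite (_ : _ - _ = b * (f z - f z')); last by ring.
by rewrite normrM -mulrA ler_wpM2l// fC.
Qed.

Lemma slip_max0 f : sup_lipschitz f -> sup_lipschitz (fun z => Num.max 0 (f z)).
Proof.
move=> [C C0 fC]; exists C => // z z' r zl zl' r0 zr.
have := fC z z' r zl zl' r0 zr; rewrite !ler_distl => /andP[h1 h2].
apply/andP; rewrite /Num.max; have [] := ltP 0 (f z); have [] := ltP 0 (f z');
  have := mulr_ge0 C0 r0; by split; lra.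
Qed.

Lemma slip_bigmin (I : eqType) (s : seq I) (m : R) (F : I -> {uniform T -> R} -> R) :
  {in s, forall i, sup_lipschitz (F i)} ->
  sup_lipschitz (fun z => \big[Num.min/m]_(i <- s) F i z).
Proof.
elim: s => [_|i s IH sF].
  by exists 0 => // z z' r _ _ _ _; rewrite !big_nil subrr normr0 mul0r.
have [] := IH; first by move=> j js; apply: sF; rewrite inE js orbT.
move=> C C0 bC; have [D D0 FD] := sF i (mem_head _ _).
exists (C + D); first exact: addr_ge0.
move=> z z' r zl zl' r0 zr; rewrite !big_cons.
have := bC z z' r zl zl' r0 zr; have := FD z z' r zl zl' r0 zr.
set b := \big[_/_]_(_ <- _) _; set b' := \big[_/_]_(_ <- _) _.
rewrite !ler_distl => /andP[h1 h2] /andP[h3 h4].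
apply/andP; rewrite /Num.min; have [] := ltP (F i z) b; have [] := ltP (F i z') b';
  have := mulr_ge0 C0 r0; have := mulr_ge0 D0 r0; rewrite mulrDl; by split; lra.
Qed.

(* [Ht] is a sup-Lipschitz approximation of [H] near the compact set [K], and
   [chi] detects the points that are far from [K]. *)
Lemma lipschitz_near_compact (K : set {uniform T -> R}) (H : {uniform T -> R} -> R)
    (M e : R) :
  compact K -> K `<=` linf -> {within linf, continuous H} ->
  0 < M -> (forall z, linf z -> `|H z| <= M) -> 0 < e ->
  exists Ht chi : {uniform T -> R} -> R, exists2 delta : R, 0 < delta &
  [/\ sup_lipschitz Ht, sup_lipschitz chi, forall z, linf z -> `|Ht z| <= M,
      forall z, 0 <= chi z <= 1 &
  forall z Z, linf z -> linf Z -> (forall t, `|Z t - z t| <= delta) ->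
    `|H Z - Ht z| <= e + 2 * M * chi z /\ (K Z -> chi z = 0)].
Proof.
move=> cK Kl; rewrite continuous_open_subspace; last exact: open_linf.
move=> cH M0 HM e0.
have /choice[rad radP] : forall c, exists r : R, 0 < r /\
    (K c -> forall z, linf z -> supd z c <= 6 * r -> `|H z - H c| <= e).
  move=> c; have [Kc|] := pselect (K c); last by exists 1.
  have cl := Kl _ Kc; have := cH c; rewrite inE => /(_ cl)/cvgrPdist_le/(_ e e0).
  move=> /nbhs_uniform[r r0 Hr]; exists (r / 7); split; first by rewrite divr_gt0.
  move=> _ z zl zc; rewrite distrC; apply: Hr => t; rewrite distrC.
  by apply: (le_lt_trans (le_supd t zl cl)); lra.
have [|s sK scov] := @compact_seq_cover _ K
    (fun c => [set z : {uniform T -> R} | forall t, `|c t - z t| < rad c]) cK.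
  by move=> c Kc; apply/nbhs_uniform; exists (rad c) => //; have [] := radP c.
have rad0 c : 0 < rad c by have [] := radP c.
have sl c : c \in s -> linf c by move=> /sK/Kl.
(* Equal to [H c] within 4 radii of [c] and at least [M] beyond 5 radii, so a distant centre never
   pulls the minimum [Ht] below [H]. *)
pose term c z := H c + 2 * M / rad c * Num.max 0 (supd z c + - 4 * rad c).
(* Zero within 2 radii of [c] and at least 1 beyond 3 radii: the minimum [chi] vanishes near [K],
   and a value below 1 puts [z] close to some centre. *)
pose far c z := Num.max 0 (- 2 + (rad c)^-1 * supd z c).
pose Ht z := \big[Num.min/M]_(c <- s) term c z.
pose chi z := \big[Num.min/1]_(c <- s) far c z.
pose delta : R := \big[Num.min/1]_(c <- s) rad c.
have max0 (y : R) : 0 <= Num.max 0 y by rewrite le_max lexx.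
exists Ht, chi, delta.
  by rewrite /delta; apply: lt_bigmin => // c _.
have HtM z : linf z -> - M <= Ht z.
  move=> zl; rewrite /Ht big_seq; apply: le_bigmin; first lra.
  move=> c cs; rewrite /term; have := HM _ (sl _ cs); rewrite ler_norml => /andP[h _].
  by rewrite (le_trans h)// lerDl mulr_ge0// divr_ge0 ?mulr_ge0// ltW.
split.
- apply: slip_bigmin => c cs; apply: slip_affine; apply: slip_max0.
  have [C C0 HC] := slip_supd (sl _ cs); exists C => // z z' r zl zl' r0 zr.
  by rewrite (_ : _ - _ = supd z c - supd z' c); [exact: HC|ring].
- apply: slip_bigmin => c cs; apply: slip_max0; apply: slip_affine.
  exact: slip_supd (sl _ cs).
- move=> z zl; rewrite ler_norml HtM//; exact: bigmin_le_id.
- move=> z; apply/andP; split; last exact: bigmin_le_id.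
  by apply: le_bigmin => // c _; exact: max0.
move=> z Z zl Zl Zz; have dle c : c \in s -> delta <= rad c.
  by move=> cs; exact: ge_bigmin_seq.
have d0 : 0 <= delta by apply: le_bigmin => // c _; exact: ltW.
have HZ : `|H Z| <= M by exact: HM.
have Zc c : c \in s -> supd Z c <= supd z c + rad c.
  move=> cs; apply: supd_triangle => //; [exact: sl|exact: ltW|move=> t].
  by rewrite distrC (le_trans (Zz t))// dle.
split; last first.
  move=> KZ; have [c cs cZ] := scov _ KZ.
  apply/eqP; rewrite eq_le; apply/andP; split; last first.
    by apply: le_bigmin => // c' _; exact: max0.
  apply: (le_trans (@ge_bigmin_seq _ _ _ s 1 c xpredT (far^~ z) cs isT)); rewrite /far.
  have h : supd z c <= 2 * rad c.
    apply: (@le_trans _ _ (supd Z c + rad c)).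
      apply: supd_triangle => //; [exact: sl|exact: ltW|move=> t].
      by rewrite (le_trans (Zz t))// dle.
    suff : supd Z c <= rad c by lra.
    by apply: supd_le => [|t]; [exact: ltW|rewrite distrC ltW].
  by rewrite ge_max lexx/= addrC subr_le0 mulrC ler_pdivrMr.
have chi0 : 0 <= chi z by apply: le_bigmin => // c _; exact: max0.
have lower : H Z - e <= Ht z.
  rewrite /Ht big_seq; apply: le_bigmin; first by move: HZ; rewrite ler_norml => /andP[_]; lra.
  move=> c cs; rewrite /term; have [near_c|far_c] := leP (supd z c) (5 * rad c).
    have /(_ (sK _ cs) Z Zl) := (radP c).2; rewrite ler_distl => H1.
    have : supd Z c <= 6 * rad c by have := Zc _ cs; lra.
    move=> /H1/andP[_ H2]; have : 0 <= 2 * M / rad c * Num.max 0 (supd z c + - 4 * rad c).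
      by rewrite mulr_ge0// divr_ge0 ?mulr_ge0// ltW.
    by lra.
  have h1 : 2 * M <= 2 * M / rad c * Num.max 0 (supd z c + - 4 * rad c).
    rewrite -[leLHS](divfK (lt0r_neq0 (rad0 c)))// ler_wpM2l//.
      by rewrite divr_ge0 ?mulr_ge0// ltW.
    by rewrite le_max; apply/orP; right; lra.
  have := HM _ (sl _ cs); move: HZ; rewrite !ler_norml => /andP[_ ?] /andP[? _]; lra.
have HtM' := bigmin_le_id s M xpredT (term^~ z); rewrite -/(Ht z) in HtM'.
have HtMl := HtM z zl; have := HZ; rewrite ler_norml => /andP[HZ1 HZ2].
have [chi1|[c cs cE]] := bigmin_attained s (far^~ z) 1.
  rewrite -/(chi z) in chi1; rewrite chi1 mulr1 ler_norml; apply/andP; split; lra.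
rewrite -/(chi z) in cE.
have [far1|near1] := leP 1 (far c z).
  have := ler_wpM2l (ltW (mulr_gt0 (ltr0n R 2) M0)) far1; rewrite -cE mulr1 => h.
  by rewrite ler_norml; apply/andP; split; lra.
have zc3 : supd z c <= 3 * rad c.
  move: near1; rewrite /far gt_max => /andP[_].
  rewrite addrC ltrBlDr mulrC ltr_pdivrMr//; lra.
have H1 : `|H Z - H c| <= e.
  by apply: (radP c).2 => //; [exact: sK|have := Zc _ cs; have := rad0 c; lra].
have Htc : Ht z <= H c.
  apply: (le_trans (@ge_bigmin_seq _ _ _ s M c xpredT (term^~ z) cs isT)); rewrite /term max_l ?mulr0 ?addr0//.
  by have := rad0 c; lra.
move: H1; rewrite ler_distl => /andP[h1 h2].
have : 0 <= 2 * M * chi z by rewrite !mulr_ge0// ltW.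
by move=> h3; rewrite ler_norml; apply/andP; split; lra.
Qed.

End sup_lipschitz.

(** * Series with geometrically decaying coefficients *)

Section series.
Context {R : realType} (T : choiceType) (c : T -> nat -> R).
Hypothesis csum : forall t l,
  \sum_(k < 2 ^ l) `|c t ((2 ^ l).-1 + k)%N| <= (5 / 7) ^+ l.

Definition partial (L : nat) (x : nat -> R) (t : T) : R :=
  \sum_(i < (2 ^ L).-1) c t i * x i.

(** Coordinates may grow like (5/4)^l at level l; against coefficients of total size (5/7)^l, the
    series converges geometrically with ratio 25/28, uniformly in [t]. *)
Definition box (M : R) : set (nat -> R) :=
  [set x | forall i, `|x i| <= M * (5 / 4) ^+ hlev i].

Lemma coef_le1 t i : `|c t i| <= 1.
Proof.
have -> : i = ((2 ^ hlev i).-1 + hoff i)%N.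
  have := trunc_log_bounds (isT : (1 < 2)%N) (isT : (0 < i.+1)%N).
  move=> /andP[h1 h2]; rewrite /hoff -[trunc_log 2 i.+1]/(hlev i) in h1 *.
  have : (0 < 2 ^ hlev i)%N by rewrite expn_gt0.
  by lia.
have kl := @hoff_lt R i.
apply: (@le_trans _ _ ((5 / 7) ^+ hlev i)); last first.
  by rewrite exprn_ile1//; lra.
apply: le_trans (csum t (hlev i)).
by rewrite (bigD1 (Ordinal kl))//= lerDl sumr_ge0.
Qed.

Lemma partial_lipschitz L x y t :
  `|partial L x t - partial L y t| <= \sum_(i < (2 ^ L).-1) `|x i - y i|.
Proof.
rewrite /partial -sumrB (le_trans (ler_norm_sum _ _ _))//.
apply: ler_sum => i _; rewrite -mulrBr normrM ler_piMl//; exact: coef_le1.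
Qed.

Lemma partial_cauchy M L L' x t : 0 <= M -> box M x -> (L <= L')%N ->
  `|partial L x t - partial L' x t| <= 10 * M * (25 / 28) ^+ L.
Proof.
move=> M0 xM LL'; rewrite /partial !(big_levels (fun i => c t i * x i)) distrC.
rewrite -!(big_mkord xpredT (fun l => \sum_(k < 2 ^ l) c t ((2 ^ l).-1 + k)%N * x ((2 ^ l).-1 + k)%N)).
rewrite (big_cat_nat (n := L))//= addrAC subrr add0r.
rewrite (le_trans (ler_norm_sum _ _ _))//.
apply: (@le_trans _ _ (\sum_(L <= l < L') M * (25 / 28) ^+ l)).
  apply: ler_sum => l _; rewrite (le_trans (ler_norm_sum _ _ _))//.
  apply: (@le_trans _ _ (\sum_(k < 2 ^ l) `|c t ((2 ^ l).-1 + k)%N| * (M * (5 / 4) ^+ l))).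
    apply: ler_sum => k _; rewrite normrM ler_wpM2l//.
    by have := xM ((2 ^ l).-1 + k)%N; rewrite (hidx (ltn_ord k)).1.
  rewrite -mulr_suml mulrCA ler_wpM2l// (_ : 25 / 28 = 5 / 7 * (5 / 4)); last by field.
  by rewrite [leRHS]exprMn ler_wpM2r// exprn_ge0//; lra.
rewrite -mulr_sumr mulrAC mulrC ler_wpM2r//.
have q0 : 0 <= 25 / 28 :> R by lra.
have q1 : 25 / 28 < 1 :> R by lra.
have := geometric_tail L L' q0 q1.
have := exprn_ge0 L q0; set Q := (25 / 28) ^+ L; set S := \sum_(_ <= _ < _) _.
rewrite (_ : Q / (1 - 25 / 28) = Q * (28 / 3)); last by field.
by move=> ? ?; lra.
Qed.

Lemma geometric_small (M e : R) : 0 < e -> exists L0, forall L, (L0 <= L)%N ->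
  10 * M * (25 / 28) ^+ L <= e.
Proof.
move=> e0; have q : `|25 / 28 : R| < 1 by rewrite ger0_norm; lra.
have : 10 * M * (25 / 28) ^+ L @[L --> \oo] --> 10 * M * (0 : R).
  by apply: cvgM; [exact: cvg_cst|exact: cvg_expr].
rewrite mulr0 => /cvgrPdist_le/(_ e e0)[L0 _ H]; exists L0 => L /H.
by rewrite sub0r normrN; exact: le_trans (ler_norm _).
Qed.

Definition series_sum (x : nat -> R) : {uniform T -> R} :=
  fun t => lim (partial L x t @[L --> \oo]).

Lemma cvg_partial M x t : 0 <= M -> box M x ->
  partial L x t @[L --> \oo] --> series_sum x t.
Proof.
move=> M0 xM; apply/cauchy_cvgP; apply: cauchy_exP => e e0.
have [L0 H] := geometric_small M (divr_gt0 e0 (ltr0n R 2)).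
exists (partial L0 x t); exists L0 => // L /= L0L.
rewrite /ball/= (le_lt_trans (partial_cauchy t M0 xM L0L))//.
by rewrite (le_lt_trans (H L0 _))//; lra.
Qed.

Lemma series_sum_approx M L x t : 0 <= M -> box M x ->
  `|series_sum x t - partial L x t| <= 10 * M * (25 / 28) ^+ L.
Proof.
move=> M0 xM; rewrite distrC.
have c1 : `|partial L x t - partial n x t| @[n --> \oo] --> `|partial L x t - series_sum x t|.
  by apply: cvg_norm; apply: cvgB; [exact: cvg_cst|exact: cvg_partial xM].
apply: (cvgr_to_le c1); exists L => // n /= Ln; exact: partial_cauchy.
Qed.

Lemma linf_series_sum M x : 0 <= M -> box M x -> linf (series_sum x).
Proof.
move=> M0 xM; exists (10 * M) => t; have := series_sum_approx 0 t M0 xM.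
by rewrite /partial big_ord0 subr0 expr0 mulr1.
Qed.

Lemma linf_partial L x : linf (partial L x : {uniform T -> R}).
Proof.
exists (\sum_(i < (2 ^ L).-1) `|x i|) => t.
have := partial_lipschitz L x (fun=> 0) t.
rewrite {2}/partial big1 ?subr0; last by move=> i _; rewrite mulr0.
by move/le_trans; apply; apply: ler_sum => i _; rewrite subr0.
Qed.

Lemma compact_box M : compact (box M : set (prod_topology (fun=> R))).
Proof.
have := @tychonoff nat (fun=> R) (fun i => `[- (M * (5 / 4) ^+ hlev i), M * (5 / 4) ^+ hlev i]%classic)
  (fun i => @segment_compact R _ _).
rewrite (_ : [set f | _] = box M)//.
by apply/seteqP; split=> x /= H i; have := H i; rewrite in_itv/= ler_norml.
Qed.

Lemma nbhs_coordinates N (x : prod_topology (fun _ : nat => R)) (e : R) : 0 < e ->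
  nbhs x [set y : prod_topology (fun _ : nat => R) | forall i, (i < N)%N -> `|x i - y i| < e].
Proof.
move=> e0; elim: N => [|N IH].
  by apply: filterS (@filterT _ (nbhs x) _) => y _ i; rewrite ltn0.
have HN : nbhs x [set y : prod_topology (fun _ : nat => R) | `|x N - y N| < e].
  exact: (@proj_continuous nat (fun=> R : topologicalType) N x (ball (x N) e)
    (nbhsx_ballx (x N) e e0)).
apply: (@filterS _ (nbhs x) (nbhs_filter x)) (@filterI _ (nbhs x) (nbhs_filter x) _ _ HN IH).
move=> y [yN IHy] i.
by rewrite ltnS leq_eqVlt => /predU1P[->//|]; exact: IHy.
Qed.

(** Continuity from the box, with the product topology, to the uniform norm: tails beyond a level L
    are uniformly small on the box, and the remaining finitely many coordinates have coefficients at
    most 1. *)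
Lemma series_sum_near M x (e : R) : 0 <= M -> box M x -> 0 < e ->
  exists N, exists2 d : R, 0 < d & forall y, box M y ->
    (forall i, (i < N)%N -> `|x i - y i| < d) ->
    forall t, `|series_sum x t - series_sum y t| < e.
Proof.
move=> M0 xM e0; have [L HL] := geometric_small M (divr_gt0 e0 (ltr0n R 4)).
pose N := (2 ^ L).-1; pose d := e / 4 / N.+1%:R.
exists N, d; first by rewrite !divr_gt0.
move=> y yM Hy t.
have h1 := series_sum_approx L t M0 xM; have h2 := series_sum_approx L t M0 yM.
have h3 : `|partial L x t - partial L y t| <= e / 4.
  apply: (le_trans (partial_lipschitz _ _ _ _)).
  apply: (@le_trans _ _ (\sum_(i < N) d)).
    by apply: ler_sum => i _; rewrite ltW// Hy.
  rewrite sumr_const card_ord -[_ *+ N]mulr_natl /d mulrCA ler_piMr//.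
    by rewrite divr_ge0// ltW.
  by rewrite ler_pdivrMr// mul1r ler_nat.
have h4 := HL L (leqnn L).
rewrite (_ : series_sum x t - series_sum y t =
  (series_sum x t - partial L x t) + (partial L x t - partial L y t) -
  (series_sum y t - partial L y t)); last by ring.
rewrite (le_lt_trans (ler_normB _ _))//.
have := ler_normD (series_sum x t - partial L x t) (partial L x t - partial L y t).
lra.
Qed.

(** A continuous image of a box that is compact by Tychonoff's theorem; these sets give the
    tightness of the limit law. *)
Lemma compact_series_box M : 0 <= M -> compact (series_sum @` box M).
Proof.
move=> M0.
apply: (@continuous_compact (prod_topology (fun _ : nat => R)) {uniform T -> R}); last exact: compact_box.
apply/subspace_continuousP => x xM A /nbhs_uniform[e e0 eA].
have [N [d d0 Hd]] := series_sum_near M0 xM e0.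
have := nbhs_coordinates N x d0.
apply: (@filterS _ (nbhs (x : prod_topology (fun _ : nat => R))) (nbhs_filter _)) => y Hy yM.
exact/eA/Hd.
Qed.

End series.

Lemma hausdorff_uniform (R : realType) (T : choiceType) : hausdorff_space {uniform T -> R}.
Proof.
move=> z w zw; apply/funext => t; apply/eqP; rewrite -subr_eq0 -normr_le0 leNgt.
apply/negP => zw0; pose r := `|z t - w t| / 2; have r0 : 0 < r by rewrite divr_gt0.
have [] := zw [set y : {uniform T -> R} | forall s, `|z s - y s| < r]
  [set y : {uniform T -> R} | forall s, `|w s - y s| < r].
- by apply/nbhs_uniform; exists r.
- by apply/nbhs_uniform; exists r.
move=> y [/(_ t) h1 /(_ t) h2]; have := ler_distD (y t) (z t) (w t).
by rewrite (distrC (y t)) leNgt [ltRHS]splitr ltrD.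
Qed.

(** * The law of the random series *)

Section gaussian_process.
Context {R : realType} (T : choiceType) (c : T -> nat -> R).
Hypothesis csum : forall t l,
  \sum_(k < 2 ^ l) `|c t ((2 ^ l).-1 + k)%N| <= (5 / 7) ^+ l.
Context d (Omega : measurableType d) (Pr : probability Omega R).
Variable Y : Omega -> nat -> R.
Hypothesis mY : forall i, measurable_fun [set: Omega] (Y ^~ i).

Definition in_boxes (w : Omega) := exists m : nat, box m%:R (Y w).

(** The zero function is the default where no box contains the coordinates, so that every path is
    bounded. *)
Definition series_process (w : Omega) : uniform_borel T :=
  if pselect (in_boxes w) then series_sum c (Y w) else (fun=> 0).

Lemma measurable_in_box M : measurable [set w | box M (Y w)].
Proof.
rewrite (_ : mkset _ = \bigcap_i [set w | ~ (M * (5 / 4) ^+ hlev i < `|Y w i|)]).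
  apply: bigcapT_measurable => i; apply: measurableC.
  by apply: measurable_set_lt => //; exact: measurableT_comp.
apply/seteqP; split=> w /= H i; first by move=> _; apply/negP; rewrite -leNgt; exact: H.
by rewrite leNgt; apply/negP; exact: H.
Qed.

Lemma series_processE m w : box m%:R (Y w) -> series_process w = series_sum c (Y w).
Proof. by move=> wm; rewrite /series_process; case: pselect => // -[]; exists m. Qed.

(** The uniform norm is in general not separable, so Borel measurability does not follow from that
    of the coordinates. But on each box, membership of the sum in an open set is decided locally by
    finitely many coordinates ([series_sum_near]). *)
Lemma measurable_series_process : measurable_fun [set: Omega] series_process.
Proof.
apply: (@measurability _ _ _ (uniform_borel T) setT series_process (@open {uniform T -> R})); first by [].
move=> _ [U oU <-]; rewrite setTI.
(* The points at which the default path is taken, counted when [U] contains it. *)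
pose S0 : set Omega := if `[< U (fun=> 0) >] then ~` \bigcup_m [set w | box m%:R (Y w)] else set0.
have -> : series_process @^-1` U =
    (\bigcup_(m in [set: nat]) [set w | box m%:R (Y w) /\ U (series_sum c (Y w))]) `|` S0.
  apply/seteqP; split=> w /=.
    rewrite /series_process; case: pselect => /= [[m wm] Uw|nw U0]; first by left; exists m.
    by right; rewrite /S0; case: asboolP => // _ [m _ wm]; apply: nw; exists m; exact: wm.
  move=> [[m _ [wm Uw]]|]; first by rewrite (series_processE wm).
  rewrite /S0; case: asboolP => // U0 nw.
  rewrite /series_process; case: pselect => [[m wm]|//]; exfalso; apply: nw.
  by exists m.
have mU : measurable (\bigcup_m [set w | box m%:R (Y w)]).
  by apply: bigcupT_measurable => m; exact: measurable_in_box.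
apply: measurableU; last first.
  by rewrite /S0; case: asboolP => // _; exact: measurableC.
apply: bigcupT_measurable => m.
apply: (@measurable_locally_determined _ _ _ Y mY (box m%:R) (fun x => U (series_sum c x))); last exact: measurable_in_box.
move=> x xm Ox; have /nbhs_uniform[e e0 eO] : nbhs (series_sum c x : {uniform T -> R}) U.
  by apply: open_nbhs_nbhs.
have [N [r r0 Hr]] := series_sum_near csum (ler0n R m) xm e0.
by exists N, r; split=> // y ym Hy; apply/eO/Hr => // i iN; rewrite distrC; exact: Hy.
Qed.

Lemma linf_series_process w : linf (series_process w : {uniform T -> R}).
Proof.
rewrite /series_process; case: pselect => [[m wm]|nw].
  exact: (linf_series_sum csum (ler0n R m) wm).
by exists 0 => t; rewrite normr0.
Qed.

Definition series_law : probability (uniform_borel T) R :=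
  image_law Pr measurable_series_process.

Hypothesis tail : forall e : R, 0 < e ->
  exists m : nat, (Pr (~` [set w | box m%:R (Y w)]) <= e%:E)%E.

Lemma tight_series_law : tight_on_linf series_law.
Proof.
split.
  rewrite [LHS]image_lawE (_ : _ @^-1` _ = setT) ?probability_setT//.
  by apply/seteqP; split=> // w _; exact: linf_series_process.
move=> e e0; have [m Hm] := tail e0.
exists (series_sum c @` box m%:R); split.
- exact: compact_series_box.
- by move=> _ [x xm <-]; exact: (linf_series_sum csum (ler0n R m) xm).
apply: le_trans Hm; rewrite [leLHS]image_lawE.
have mK : measurable (~` (series_sum c @` box m%:R) : set (uniform_borel T)).
  apply: sub_sigma_algebra; apply: closed_openC; apply: compact_closed.
    exact: hausdorff_uniform.
  exact: compact_series_box.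
apply: le_measure; rewrite ?inE.
- rewrite -[X in measurable X]setTI; exact: measurable_series_process.
- by apply: measurableC; exact: measurable_in_box.
- by move=> w /= nK wm; apply: nK; exists (Y w) => //; rewrite (series_processE wm).
Qed.

End gaussian_process.

(** * Bounds for outer expectations *)

Section expectation_bounds.
Context d (Omega : measurableType d) (R : realType) (Pr : probability Omega R).

Lemma exp_EFin (f : Omega -> R) : bounded_measurable f ->
  (\int[Pr]_w (f w)%:E)%E = (\int[Pr]_w f w)%:E.
Proof.
move=> bf; rewrite /Rintegral fineK//.
by apply: integrable_fin_num => //; exact: bm_integrable.
Qed.

Lemma outer_expectation_le (h f : Omega -> R) : bounded_measurable f ->
  (forall w, h w <= f w) -> (outer_expectation Pr h <= (\int[Pr]_w f w)%:E)%E.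
Proof.
move=> bf hf; apply: ereal_inf_lbound; exists (EFin \o f).
  by split=> [|w /=]; [exact: bm_integrable|rewrite lee_fin].
exact: exp_EFin.
Qed.

Lemma outer_expectation_ge (h f : Omega -> R) : bounded_measurable f ->
  (forall w, f w <= h w) -> ((\int[Pr]_w f w)%:E <= outer_expectation Pr h)%E.
Proof.
move=> bf fh; apply/ereal_infP => _ [U [intU hU] <-]; rewrite -exp_EFin//.
apply: le_integral => //; first exact: bm_integrable.
by move=> w _; apply: le_trans (hU w); rewrite /= lee_fin.
Qed.

Lemma cvg_EFin_bounds (u : nat -> \bar R) (l : R) :
  (forall e : R, 0 < e -> \forall n \near \oo, ((l - e)%:E <= u n <= (l + e)%:E)%E) ->
  u n @[n --> \oo] --> l%:E.
Proof.
move=> H; apply/fine_cvgP; split.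
  have := H 1 ltr01; apply: filterS => n /andP[h1 h2].
  by rewrite fin_numE; case: (u n) h1 h2.
apply/cvgrPdist_le => e e0; have := H e e0; apply: filterS => n /= /andP[].
by case: (u n) => //= r; rewrite !lee_fin distrC ler_distl => -> ->.
Qed.

End expectation_bounds.

(** * From convergence of coordinates to convergence of processes *)

Section convergence.
Context {R : realType} (T : choiceType) (c : T -> nat -> R).
Hypothesis csum : forall t l,
  \sum_(k < 2 ^ l) `|c t ((2 ^ l).-1 + k)%N| <= (5 / 7) ^+ l.
Context d (Omega : measurableType d) (Pr : probability Omega R).
Variables (V : nat -> Omega -> nat -> R) (Y : Omega -> nat -> R)
  (Z : nat -> Omega -> {uniform T -> R}).
Hypothesis mV : forall n i, measurable_fun [set: Omega] (fun w => V n w i).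
Hypothesis mY : forall i, measurable_fun [set: Omega] (Y ^~ i).
Hypothesis tail : forall e : R, 0 < e ->
  exists m : nat, (Pr (~` [set w | box m%:R (Y w)]) <= e%:E)%E.
Hypothesis cvg_cos : forall N (a : nat -> R) (b : R),
  \int[Pr]_w cos (\sum_(i < N) a i * V n w i + b) @[n --> \oo] -->
  \int[Pr]_w cos (\sum_(i < N) a i * Y w i + b).
Hypothesis tight : forall N (e : R), 0 < e -> exists2 rho : R, 0 < rho &
  (forall n, Pr [set w | escapes N rho (V n w)] <= e%:E)%E /\
  (Pr [set w | escapes N rho (Y w)] <= e%:E)%E.
Hypothesis linfZ : forall n w, linf (Z n w).
Hypothesis approx : forall e : R, 0 < e -> exists l1, forall L, (l1 <= L)%N ->
  exists n0, forall n, (n0 <= n)%N ->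
  exists2 B : set Omega, measurable B /\ (Pr B <= e%:E)%E &
    forall w, ~ B w -> forall t, `|Z n w t - partial c L (V n w) t| <= e.

Let slip_partial L (f : {uniform T -> R} -> R) : sup_lipschitz f -> exists2 C : R, 0 <= C &
  forall x y, `|f (partial c L x) - f (partial c L y)| <=
    C * \sum_(i < (2 ^ L).-1) `|x i - y i|.
Proof.
move=> [C C0 fC]; exists C => // x y.
apply: fC; [exact: linf_partial|exact: linf_partial|exact: sumr_ge0|].
by move=> t; exact: partial_lipschitz.
Qed.

Let cvg_slip L (f : {uniform T -> R} -> R) (M : R) : sup_lipschitz f ->
  (forall z, linf z -> `|f z| <= M) ->
  \int[Pr]_w f (partial c L (V n w)) @[n --> \oo] --> \int[Pr]_w f (partial c L (Y w)).
Proof.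
move=> /(slip_partial L)[C C0 fC] fM.
apply: (@cvg_exp_lipschitz R (2 ^ L).-1 _ _ Omega Omega Pr Pr V Y mV mY (@cvg_cos _)
  (@tight _) (fun x => f (partial c L x)) C M C0 fC).
by move=> x; apply: fM; exact: linf_partial.
Qed.

Let bm_slip L (f : {uniform T -> R} -> R) (M : R) (X : Omega -> nat -> R) :
  (forall i, measurable_fun [set: Omega] (X ^~ i)) -> sup_lipschitz f ->
  (forall z, linf z -> `|f z| <= M) -> bounded_measurable (fun w => f (partial c L (X w))).
Proof.
move=> mX /(slip_partial L)[C C0 fC] fM; split.
  exact: (measurable_lipschitz mX (g := fun x => f (partial c L x)) fC).
by exists M => w; apply: fM; exact: linf_partial.
Qed.

Let sandwich (A B : set Omega) (h f g : Omega -> R) (M e : R) : 0 <= M ->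
  (forall w, `|h w| <= M) -> (forall w, `|f w| <= M) -> (forall w, 0 <= g w) -> 0 <= e ->
  (forall w, ~ B w -> `|h w - f w| <= e + 2 * M * g w) ->
  forall w, `|h w - f w| <= e + 2 * M * g w + 2 * M * (\1_B w : R).
Proof.
move=> M0 hM fM g0 e0 hf w; rewrite indicE; case: (boolP (w \in B)) => [_|nB].
  rewrite mulr1 (le_trans (ler_normB _ _))//.
  have := hM w; have := fM w; have := mulr_ge0 M0 (g0 w); lra.
by rewrite mulr0 addr0; apply: hf => Bw; move: nB; rewrite mem_set.
Qed.

Let exp_sandwich (B : set Omega) (f g : Omega -> R) (M e : R) : measurable B ->
  bounded_measurable f -> bounded_measurable g ->
  bounded_measurable (fun w => e + 2 * M * g w + 2 * M * (\1_B w : R)) /\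
  \int[Pr]_w (e + 2 * M * g w + 2 * M * (\1_B w : R)) =
  e + 2 * M * (\int[Pr]_w g w) + 2 * M * fine (Pr B).
Proof.
move=> mB bf bg; have b1 : bounded_measurable (fun w => e + 2 * M * g w).
  by apply: bmD; [exact: bm_cst|exact: bmZ].
have bB : bounded_measurable (fun w => 2 * M * (\1_B w : R)).
  by apply: bmZ; exact: bm_indic.
split; first exact: bmD.
rewrite (expD _ b1 bB) (expD _ (bm_cst e) (bmZ _ bg)) exp_cst (expZ _ _ bg).
by rewrite (expZ _ _ (bm_indic _ mB)) exp_indic.
Qed.

(** Off rare events, [Z n] and the limit are uniformly close to partial sums with the same
    coefficients. There [H] is replaced by a Lipschitz [Ht] at the partial sum, at a cost controlled
    by [chi]. The mean of [chi] is small for the limit, whose law is mostly carried by a compact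
    set, and hence for [V n] by convergence of the coordinates. *)
Theorem cvg_in_law_series : cvg_in_law Pr Z (series_law csum Pr mY).
Proof.
split=> //; first exact: tight_series_law.
move=> H cH [M1 HM1]; pose M := `|M1| + 1.
have M0 : 0 < M by rewrite ltr_wpDl.
have HM z : linf z -> `|H z| <= M.
  by move=> zl; rewrite (le_trans (HM1 _ zl))// ler_wpDr// ler_norm.
pose G := series_process c Y.
have Gl w : linf (G w : {uniform T -> R}) by exact: linf_series_process.
have mHl := measurable_fun_continuous_linf cH.
have mG := measurable_series_process csum mY.
(* [H] is controlled on [linf] only; its extension by 0 is bounded and measurable everywhere. *)
pose Hl (z : uniform_borel T) : R := if `[< linf (z : {uniform T -> R}) >] then H z else 0.
have mH : measurable_fun [set: uniform_borel T] Hl.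
  have linfE : (fun z : uniform_borel T => `[< linf (z : {uniform T -> R}) >]) @^-1` [set true] = @linf R T.
    by apply/seteqP; split=> z /= /asboolP.
  apply: measurable_fun_if => //.
    apply: (@measurable_fun_bool _ _ _ _ true); rewrite setTI linfE//.
    exact: measurable_linf.
  by rewrite setTI linfE.
have HlG w : Hl (G w) = H (G w) by rewrite /Hl asboolT.
have bHl : bounded_measurable Hl.
  split=> //; exists M => z; rewrite /Hl; case: asboolP => [/HM//|_].
  by rewrite normr0 ltW.
have bH : bounded_measurable (fun w => H (G w)).
  by under eq_fun do rewrite -HlG; exact: (bm_comp mG bHl).
have -> : (\int[series_law csum Pr mY]_(z in @linf R T) (H z)%:E = (\int[Pr]_w H (G w))%:E)%E.
  rewrite integral_mkcond -exp_EFin//.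
  rewrite (_ : _ \_ _ = EFin \o Hl).
    rewrite integral_image_law.
    - by apply: eq_integral => w _; rewrite /= HlG.
    - exact/measurable_EFinP.
    - exact: (bm_integrable _ (bm_comp mG bHl)).
  by apply/funext => z; rewrite patchE /= /Hl; case: asboolP => zl;
    [rewrite mem_set|rewrite memNset].
apply: cvg_EFin_bounds => e0 e00.
(* The errors sum to 3 e + 10 M e: e + 6 M e for [Z n], e for the convergence of the means of [Ht],
   e + 4 M e for the limit. *)
pose e := e0 / (3 + 12 * M).
have e_gt0 : 0 < e by rewrite divr_gt0// addr_gt0// mulr_gt0.
have [m Hm] := tail e_gt0.
have mm0 : 0 <= m%:R :> R by [].
have cK := compact_series_box csum mm0.
have Kl : series_sum c @` box m%:R `<=` @linf R T.
  by move=> _ [x xm <-]; exact: (linf_series_sum csum mm0 xm).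
have [Ht [chi [delta delta0 [sHt schi HtM chi01 near_K]]]] :=
  lipschitz_near_compact cK Kl cH M0 HM e_gt0.
have ed0 : 0 < Num.min e delta by rewrite lt_min e_gt0.
have [l1 Hl1] := approx ed0.
have [l2 Hl2] := geometric_small m%:R delta0.
pose L := maxn l1 l2.
have [n0 Hn0] := Hl1 L (leq_maxl _ _).
have chiM z : @linf R T z -> `|chi z| <= 1.
  by move=> _; have /andP[h1 h2] := chi01 z; rewrite ger0_norm.
have bg n := bm_slip L (mV n) sHt HtM.
have bx n := bm_slip L (mV n) schi chiM.
have bgY := bm_slip L mY sHt HtM.
have bxY := bm_slip L mY schi chiM.
have /cvgrPdist_le/(_ e e_gt0) c1 := @cvg_slip L _ _ sHt HtM.
have /cvgrPdist_le/(_ e e_gt0) c2 := @cvg_slip L _ _ schi chiM.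
have fineP (B : set Omega) (r : R) : measurable B -> (Pr B <= r%:E)%E -> fine (Pr B) <= r.
  by move=> mB; rewrite -lee_fin fineK ?fin_num_measure.
pose B' := ~` [set w | box m%:R (Y w)].
have mB' : measurable B' by apply: measurableC; exact: measurable_in_box.
have PB' := fineP _ _ mB' Hm.
(* Off [B'] the sum lies in the compact set and its partial sum is within [delta], so [chi] vanishes
   at the partial sum. *)
have GB w : ~ B' w -> [/\ `|H (G w) - Ht (partial c L (Y w))| <=
    e + 2 * M * chi (partial c L (Y w)) & chi (partial c L (Y w)) = 0].
  rewrite /B' /= => /contrapT wm; rewrite /G (series_processE c wm).
  have [|h1 h2] := near_K (partial c L (Y w)) (series_sum c (Y w)) (linf_partial csum L _)
    (linf_series_sum csum mm0 wm).
    move=> t; apply: (le_trans (series_sum_approx csum L t mm0 wm)).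
    exact/Hl2/leq_maxr.
  by split=> //; apply: h2; exists (Y w).
have chiY : \int[Pr]_w chi (partial c L (Y w)) <= e.
  rewrite (le_trans _ PB')// -exp_indic//; apply: exp_le => //; first exact: bm_indic.
  move=> w; rewrite indicE; case: (boolP (w \in B')) => [_|nB].
    by have /andP[] := chi01 (partial c L (Y w)).
  by rewrite (GB w _).2// => Bw; move: nB; rewrite mem_set.
have chi0 z : 0 <= chi z by have /andP[] := chi01 z.
have HGt w : `|Ht (partial c L (Y w))| <= M by apply: HtM; exact: linf_partial.
have e_ge0 := ltW e_gt0; have M_ge0 := ltW M0.
have limG : `|\int[Pr]_w H (G w) - \int[Pr]_w Ht (partial c L (Y w))| <= e + 4 * M * e.
  have S := sandwich setT M_ge0 (fun w => HM _ (Gl w)) HGt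
    (fun w => chi0 (partial c L (Y w))) e_ge0 (fun w nB => (GB w nB).1).
  have [bS ES] := exp_sandwich M e mB' bgY bxY.
  rewrite -expB// (le_trans (exp_abs _ (bmB bH bgY)))//.
  rewrite (le_trans (exp_le _ (bm_abs (bmB bH bgY)) bS S))// ES.
  have := ler_wpM2l M_ge0 chiY; have := ler_wpM2l M_ge0 PB'; lra.
near=> n.
have n0n : (n0 <= n)%N by near: n; exact: nbhs_infty_ge.
have [B [mB PBe] HB] := Hn0 n n0n.
have PB := fineP _ _ mB PBe.
have PBle : fine (Pr B) <= e by rewrite (le_trans PB)// ge_min lexx.
have HZ w : ~ B w -> `|H (Z n w) - Ht (partial c L (V n w))| <=
    e + 2 * M * chi (partial c L (V n w)).
  move=> nB; have [] // := near_K (partial c L (V n w)) (Z n w) (linf_partial csum L _) (linfZ n w).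
  by move=> t; rewrite (le_trans (HB w nB t))// ge_min lexx orbT.
have HVt w : `|Ht (partial c L (V n w))| <= M by apply: HtM; exact: linf_partial.
have S := sandwich setT M_ge0 (fun w => HM _ (linfZ n w)) HVt
    (fun w => chi0 (partial c L (V n w))) e_ge0 HZ.
have [bS ES] := exp_sandwich M e mB (bg n) (bx n).
have h1 : `|\int[Pr]_w Ht (partial c L (Y w)) - \int[Pr]_w Ht (partial c L (V n w))| <= e.
  by near: n.
have h2 : `|\int[Pr]_w chi (partial c L (Y w)) - \int[Pr]_w chi (partial c L (V n w))| <= e.
  by near: n.
have e0E : e0 = 3 * e + 12 * (M * e).
  by rewrite /e; field; rewrite gt_eqF// addr_gt0// mulr_gt0.
set EG := \int[Pr]_w H (G w) in limG *.
(* One [e] bounds the mean of [chi] for the limit, the other its distance to the mean for [V n]. *)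
have chiV : M * \int[Pr]_w chi (partial c L (V n w)) <= M * (2 * e).
  apply: ler_wpM2l => //; move: h2 chiY; rewrite ler_distl => /andP[]; lra.
have MPB := ler_wpM2l M_ge0 PBle.
have Me : 0 <= M * e by rewrite mulr_ge0.
(* [H (Z n w)] need not be measurable in [w]; its outer expectation is enclosed between the means of
   a measurable minorant and majorant. *)
apply/andP; split.
  apply: le_trans (outer_expectation_ge Pr (f := fun w => Ht (partial c L (V n w)) -
    (e + 2 * M * chi (partial c L (V n w)) + 2 * M * (\1_B w : R))) _ _).
  - rewrite lee_fin (expB _ (bg n) bS) ES.
    move: h1 limG; rewrite !ler_distl => /andP[? ?] /andP[? ?]; lra.
  - exact: bmB.
  - by move=> w; have := S w; rewrite ler_distl => /andP[? ?]; lra.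
apply: le_trans (outer_expectation_le Pr (f := fun w => Ht (partial c L (V n w)) +
    (e + 2 * M * chi (partial c L (V n w)) + 2 * M * (\1_B w : R))) _ _) _.
- exact: bmD.
- by move=> w; have := S w; rewrite ler_distl => /andP[? ?]; lra.
rewrite lee_fin (expD _ (bg n) bS) ES.
by move: h1 limG; rewrite !ler_distl => /andP[? ?] /andP[? ?]; lra.
Unshelve. all: by end_near. Qed.

End convergence.

(** * Gaussian and Haar coordinates on the sample space *)

Section normal_on_reals.
Context {R : realType} (s : R).

Let id_R : measurableTypeR R -> R := id.

Let measurable_id_R : measurable_fun [set: measurableTypeR R] id_R.
Proof. by move=> _ A mA; rewrite setTI. Qed.

(* [normal_prob 0 s] lives on [measurableTypeR R], which is not the canonical
   measurable structure of [R]. *)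
Definition centered_normal : probability R R :=
  image_law (normal_prob 0 s : probability (measurableTypeR R) R) measurable_id_R.

Lemma centered_normalE A : centered_normal A = normal_prob 0 s A.
Proof. by []. Qed.

Lemma integral_centered_normal (f : R -> \bar R) : measurable_fun [set: R] f ->
  (normal_prob 0 s).-integrable [set: measurableTypeR R] f ->
  (\int[centered_normal]_x f x = \int[normal_prob 0 s]_x f x)%E.
Proof. by move=> mf intf; rewrite integral_image_law. Qed.

Lemma exp_centered_normal (f : R -> R) : bounded_measurable f ->
  \int[centered_normal]_x f x = \int[normal_prob 0 s]_x f x.
Proof. by move=> bf; rewrite exp_image_law. Qed.

End normal_on_reals.

Section coordinates.
Context {R : realType} (P : probability R R) (Pr : probability (sample_space R) R).
Hypothesis HPr : infinite_product P Pr.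
Hypothesis atomless : forall x : R, P [set x] = 0%E.
Variable xi : R -> R.
Hypothesis mxi : measurable_fun [set: R] xi.
Hypothesis xi_law : forall A, measurable A -> P (xi @^-1` A) = normal_prob 0 1 A.

Definition gauss_coord (x : sample_space R) (i : nat) : R := xi (x i).

Lemma measurable_gauss_coord i : measurable_fun [set: sample_space R] (gauss_coord ^~ i).
Proof. by apply: measurableT_comp => //; exact: (@measurable_coord R i). Qed.

Lemma cos_xi a b : \int[P]_x cos (a * xi x + b) = expR (- (a ^+ 2 / 2)) * cos b.
Proof.
have := @gauss_cosE R 1 ltr01 a b; rewrite expr1n mulr1 => <-.
have bc := bm_gauss_cos a b.
rewrite -(exp_image_law P mxi bc) /gauss_cos.
rewrite -(exp_centered_normal 1 bc).
by apply: eq_exp => A mA; rewrite image_lawE; exact: xi_law.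
Qed.

Lemma cos_gauss_coord N (a : nat -> R) b :
  \int[Pr]_x cos (\sum_(i < N) a i * gauss_coord x i + b) =
  expR (- ((\sum_(i < N) a i ^+ 2) / 2)) * cos b.
Proof. exact: (gaussian_psum_cos HPr a N b mxi cos_xi). Qed.

Let C4 : R := \int[normal_prob 0 1]_y (y ^+ 4).

Let C40 : 0 <= C4.
Proof. by apply: Rintegral_ge0 => y _; rewrite exprn_even_ge0. Qed.

Lemma prob_xi_gt (r : R) : 0 < r -> (P [set x | (r < `|xi x|)%R] <= (C4 / r ^+ 4)%:E)%E.
Proof.
move=> r0; have mA : measurable [set y : R | (r < `|y|)%R].
  by apply: measurable_set_lt => //; exact: measurableT_comp.
have -> : P [set x | (r < `|xi x|)%R] = normal_prob 0 1 [set y : R | (r < `|y|)%R].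
  by rewrite -xi_law.
rewrite -[leLHS]fineK ?fin_num_measure// lee_fin ler_pdivlMr ?exprn_gt0// mulrC.
rewrite -exp_indic// -expZ; last exact: bm_indic.
apply: le_Rintegral => //.
- by apply: bm_integrable; apply: bmZ; exact: bm_indic.
- exact: (normal_integrable_pow4 ltr01).
move=> y _; rewrite indicE; case: (boolP (y \in _)) => [|_]; last first.
  by rewrite mulr0 exprn_even_ge0.
rewrite inE/= mulr1 => ry.
by rewrite -[y ^+ 4]ger0_norm ?exprn_even_ge0// normrX lerXn2r ?nnegrE//; exact: ltW.
Qed.

(** Markov's inequality for fourth moments gives C4 / (m (5/4)^l)^4 for each of the 2^l coordinates
    of level l. The union bound is a geometric series of ratio 2 (4/5)^4 = 512/625, with sum 625/113
    < 6. *)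
Lemma tail_gauss_coord (e : R) : 0 < e ->
  exists m : nat, (Pr (~` [set x | box m%:R (gauss_coord x)]) <= e%:E)%E.
Proof.
move=> e0.
have [m m0 Hm] : exists2 m : nat, (0 < m)%N & 6 * C4 / m%:R ^+ 4 <= e.
  exists (Num.bound (6 * C4 / e)).+1 => //; set m := Num.bound _.
  have m1 : 1 <= m.+1%:R :> R by rewrite ler1n.
  rewrite ler_pdivrMr ?exprn_gt0// [leRHS]mulrC -ler_pdivrMr//.
  rewrite (@le_trans _ _ m.+1%:R)//.
    have H : 6 * C4 / e < m%:R by apply: archi_boundP; rewrite divr_ge0 ?mulr_ge0// ltW.
    by rewrite ltW// (lt_trans H)// ltr_nat.
  by rewrite exprS ler_peMr// exprn_ege1.
exists m; pose r i : R := m%:R * (5 / 4) ^+ hlev i.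
have r0 i : 0 < r i by rewrite mulr_gt0 ?ltr0n// exprn_gt0//; lra.
pose A i := [set x : sample_space R | (r i < `|gauss_coord x i|)%R].
have mA i : measurable (A i).
  apply: measurable_set_lt => //; apply: measurableT_comp => //.
  exact: measurable_gauss_coord.
have -> : ~` [set x | box m%:R (gauss_coord x)] = \bigcup_i A i.
  apply/seteqP; split=> x /=.
    move=> nbx; apply: contrapT => nA; apply: nbx => i; rewrite leNgt.
    by apply/negP => ri; apply: nA; exists i.
  by move=> [i _ ri] bx; have := bx i; rewrite leNgt => /negP; exact.
apply: (le_trans (@generalized_Boole_inequality _ _ _ Pr A mA _)).
  exact: bigcupT_measurable.
apply: lime_le; first exact: is_cvg_nneseries.
exists 0%N => // n _ /=.
apply: (@le_trans _ _ (\sum_(0 <= i < n) (C4 / r i ^+ 4)%:E)%E).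
  apply: lee_sum => i _.
  have -> : Pr (A i) = P [set y | (r i < `|xi y|)%R].
    rewrite -(measure_coord HPr i)//; apply: measurable_set_lt => //.
    exact: measurableT_comp.
  exact: prob_xi_gt.
rewrite sumEFin lee_fin; apply: le_trans Hm.
have t0 i : 0 <= C4 / r i ^+ 4 by rewrite divr_ge0// exprn_ge0// ltW.
(* The first n terms are enlarged to complete levels, so that [big_levels] applies. *)
have nn : (n <= (2 ^ n).-1)%N by have := ltn_expl n (isT : (1 < 2)%N); lia.
apply: (@le_trans _ _ (\sum_(0 <= i < (2 ^ n).-1) C4 / r i ^+ 4)).
  rewrite [leRHS](big_cat_nat (n := n))//= lerDl.
  by apply: sumr_ge0.
rewrite big_mkord (big_levels (fun i => C4 / r i ^+ 4)).
rewrite (eq_bigr (fun l : 'I_n => C4 / m%:R ^+ 4 * (512 / 625) ^+ l)); last first.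
  move=> l _; rewrite (eq_bigr (fun=> C4 / (m%:R * (5 / 4) ^+ l) ^+ 4)); last first.
    by move=> k _; rewrite /r (hidx (ltn_ord k)).1.
  rewrite sumr_const card_ord -[_ *+ (2 ^ l)%N]mulr_natl natrX exprMn -exprM mulnC exprM.
  rewrite (_ : (5 / 4) ^+ 4 = 625 / 256); last by field.
  rewrite (_ : 512 / 625 = 2 * (625 / 256)^-1); last by field.
  by rewrite [(2 * _) ^+ l]exprMn exprVn invfM; ring.
rewrite -mulr_sumr -(big_mkord xpredT (fun l => (512 / 625) ^+ l)).
have q0 : 0 <= 512 / 625 :> R by lra.
have q1 : 512 / 625 < 1 :> R by lra.
have := geometric_tail 0 n q0 q1; rewrite expr0; set S := \sum_(_ <= _ < _) _ => HS.
rewrite (_ : 6 * C4 / _ = C4 / m%:R ^+ 4 * 6); last by ring.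
rewrite ler_wpM2l//.
  by rewrite divr_ge0// exprn_ge0.
apply: le_trans HS _.
by rewrite (_ : 1 / (1 - 512 / 625) = 625 / 113); [lra|field].
Qed.

Section haar_statistics.
Variable n : nat.
Hypothesis n0 : (0 < n)%N.

Lemma exp_nu_sqr g : bounded_measurable g -> \int[P]_y g y = 0 ->
  \int[Pr]_x (nu P n x g ^+ 2) = \int[P]_y (g y ^+ 2).
Proof.
move=> bg g0; have nn0 : n%:R != 0 :> R by rewrite pnatr_eq0 -lt0n.
under eq_Rintegral do rewrite nu_psum// exprMn exprVn sqr_sqrtr ?ler0n//.
by rewrite expZ ?(exp_psum_sqr HPr)// ?mulKf//; apply: bmX; exact: bm_psum.
Qed.

End haar_statistics.

Definition haar_coord (n : nat) (x : sample_space R) (i : nat) : R := nu P n x (hfun P i).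

Lemma bm_haar_coord n i : bounded_measurable (fun x => haar_coord n x i).
Proof. by apply: bm_nu; exact: bm_haar. Qed.

Let exp_hfun i : \int[P]_y hfun P i y = 0.
Proof. by apply: exp_haar => //; exact: hoff_lt. Qed.

Let bm_hfun i : bounded_measurable (hfun P i).
Proof. exact: bm_haar. Qed.

(** A linear combination of Haar coordinates is the empirical process at one function [g], whose
    variance is the sum of the squares a_i^2 by orthonormality; [clt_cos] then applies to [g]. *)
Lemma cvg_cos_haar_coord N (a : nat -> R) b :
  \int[Pr]_x cos (\sum_(i < N) a i * haar_coord n x i + b) @[n --> \oo] -->
  \int[Pr]_x cos (\sum_(i < N) a i * gauss_coord x i + b).
Proof.
rewrite cos_gauss_coord.
pose g y := \sum_(i < N) a i * hfun P i y.
have bZ i : bounded_measurable (fun y => a i * hfun P i y) by exact: bmZ.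
have bg : bounded_measurable g by apply: bm_sum => i _.
have g0 : \int[P]_y g y = 0.
  rewrite exp_sum; last by move=> i _.
  by apply: big1 => i _; rewrite expZ// exp_hfun mulr0.
have -> : \sum_(i < N) a i ^+ 2 = \int[P]_y (g y ^+ 2).
  rewrite (_ : (fun y => g y ^+ 2) = fun y =>
      \sum_(i < N) \sum_(k < N) (a i * a k) * (hfun P i y * hfun P k y)).
    rewrite exp_sum; last by move=> i _; apply: bm_sum => k _; apply: bmZ; exact: bmM.
    apply: eq_bigr => i _; rewrite exp_sum; last by move=> k _; apply: bmZ; exact: bmM.
    rewrite (bigD1 i)//= expZ ?exp_hfunM ?eqxx ?mulr1 ?big1 ?addr0//; last exact: bmM.
    move=> k ki; rewrite expZ ?exp_hfunM//; last exact: bmM.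
    by rewrite -val_eqE/= in ki; rewrite eq_sym (negbTE ki) mulr0.
  apply/funext => y; rewrite expr2 /g big_distrl/=; apply: eq_bigr => i _.
  by rewrite big_distrr/=; apply: eq_bigr => k _; ring.
apply: cvg_trans (clt_cos HPr bg g0 (b := b)); apply: near_eq_cvg.
exists 1%N => // n /= n0; apply: eq_Rintegral => x _; congr (cos (_ + _)).
rewrite -(nu_psum _ n0 g0) /g nu_sum//.
by apply: eq_bigr => i _; rewrite nuZ.
Qed.

Lemma tight_coords N (e : R) : 0 < e -> exists2 rho : R, 0 < rho &
  (forall n, Pr [set x | escapes N rho (haar_coord n x)] <= e%:E)%E /\
  (Pr [set x | escapes N rho (gauss_coord x)] <= e%:E)%E.
Proof.
move=> e0; have [m Hm] := tail_gauss_coord e0.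
(* The first bound encloses the Gaussian box. The second serves Markov's inequality for the sum of
   squares of the Haar coordinates, of mean N; it is at least 1, so |y| > rho implies y^2 > rho. *)
pose rho : R := Num.max (m%:R * (5 / 4) ^+ N) (N%:R / e + 1).
have Ne0 : 0 <= N%:R / e by rewrite divr_ge0// ltW.
have rho1 : 1 <= rho by rewrite le_max lerDr Ne0 orbT.
have rho0 : 0 < rho by exact: lt_le_trans rho1.
have mesc X : (forall i, measurable_fun [set: sample_space R] (X ^~ i)) ->
    measurable [set x | escapes N rho (X x)] by exact: measurable_escapes.
exists rho => //; split; last first.
  apply: le_trans Hm; apply: le_measure; rewrite ?inE.
  - by apply: mesc => i; exact: measurable_gauss_coord.
  - apply: measurableC; apply: measurable_in_box => i; exact: measurable_gauss_coord.
  move=> x /= [i iN ri] bx; have := lt_le_trans ri (bx i).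
  have lN : (hlev i <= N)%N.
    have := trunc_log_bounds (isT : (1 < 2)%N) (isT : (0 < i.+1)%N).
    rewrite -/(hlev i) => /andP[h1 _].
    by have := ltn_expl (hlev i) (isT : (1 < 2)%N); lia.
  rewrite ltNge => /negP; apply; rewrite le_max; apply/orP; left.
  by rewrite ler_wpM2l// ler_weXn2l//; lra.
move=> n; have [->|n0] := posnP n.
  rewrite (_ : mkset _ = set0) ?measure0 ?lee_fin ?ltW//.
  apply/seteqP; split=> // x /= [i _].
  by rewrite /haar_coord /nu sqrtr0 mul0r normr0 ltNge ltW.
pose S x := \sum_(i < N) haar_coord n x i ^+ 2.
have bS : @bounded_measurable _ (sample_space R) R S.
  by apply: (@bm_sum _ (sample_space R)) => i _; apply: bmX; exact: bm_haar_coord.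
apply: (@le_trans _ _ (Pr [set x | (rho < S x)%R])).
  apply: le_measure; rewrite ?inE.
  - by apply: mesc => i; exact: (bm_haar_coord n i).1.
  - by apply: measurable_set_lt => //; exact: bS.1.
  move=> x /= [i iN ri]; rewrite /S (bigD1 (Ordinal iN))//=.
  rewrite ltr_wpDr ?sumr_ge0// => [k _|]; first exact: sqr_ge0.
  rewrite -real_normK ?num_real// (lt_le_trans ri)// expr2 ler_peMr// (le_trans rho1)// ltW//.
apply: (le_trans (markov_bm _ bS _ rho0)); first by move=> x; apply: sumr_ge0 => i _; exact: sqr_ge0.
rewrite lee_fin ler_pdivrMr// exp_sum; last by move=> i _; apply: bmX; exact: bm_haar_coord.
rewrite (eq_bigr (fun=> 1)); last first.
  move=> i _; rewrite exp_nu_sqr//; transitivity (\int[P]_y (hfun P i y * hfun P i y)); last by rewrite exp_hfunM// eqxx.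
  by apply: eq_Rintegral => y _; rewrite expr2.
rewrite sumr_const card_ord mulrC -ler_pdivrMr// /rho le_max; apply/orP; right.
by rewrite lerDl.
Qed.

End coordinates.

(** * Identification of the limit as G_P *)

Lemma cvg_sum (R : realType) (I : Type) (r : seq I) (F : I -> nat -> R) (l : I -> R) :
  (forall i, F i n @[n --> \oo] --> l i) ->
  \sum_(i <- r) F i n @[n --> \oo] --> \sum_(i <- r) l i.
Proof.
move=> Fl; elim: r => [|i r IH].
  by rewrite big_nil; under eq_fun do rewrite big_nil; exact: cvg_cst.
by rewrite big_cons; under eq_fun do rewrite big_cons; exact: cvgD.
Qed.

Section gaussian_of_cosine.
Context {R : realType} (Q : probability R R) (v : R).
Hypothesis v0 : 0 <= v.
Hypothesis Qcos : forall a b,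
  \int[Q]_x cos (a * x + b) = expR (- (a ^+ 2 * v / 2)) * cos b.

Let msqr : measurable_fun [set: R] (EFin \o (fun x : R => x ^+ 2)).
Proof. exact/measurable_EFinP/measurable_funX. Qed.

Let mid : measurable_fun [set: R] (EFin \o (fun x : R => x)).
Proof. exact/measurable_EFinP. Qed.

(** The cosine transform determines the law, hence its moments. The case v = 0 is a point mass and
    is treated apart, because [normal_prob] with deviation 0 is not one. *)
Lemma gaussian_of_cosine :
  [/\ gaussian_law Q, (\int[Q]_x (x ^+ 2)%:E = v%:E)%E & (\int[Q]_x x%:E = 0)%E].
Proof.
have [v_gt0|] := ltP 0 v; last first.
  move=> v_le0; have vE : v = 0 by apply/eqP; rewrite eq_le v_le0.
  have QE A : measurable A -> Q A = \d_(0 : R) A.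
    apply: (law_unique_cos (P2 := \d_(0 : R))) => a b.
    rewrite Qcos vE mulr0 mul0r oppr0 expR0 mul1r /Rintegral integral_dirac//.
      by rewrite diracT mul1e /= mulr0 add0r.
    by apply/measurable_EFinP; exact: (bm_gauss_cos a b).1.
  have EQ (f : R -> \bar R) : (\int[Q]_x f x = \int[\d_(0%R : R)]_x f x)%E.
    by apply: eq_measure_integral => A mA _; exact: QE.
  split; first by left; exists 0 => B mB; exact: QE.
    by rewrite EQ integral_dirac// diracT mul1e vE expr0n.
  by rewrite EQ integral_dirac// diracT mul1e.
pose s := Num.sqrt v; have s0 : 0 < s by rewrite sqrtr_gt0.
have s2 : s ^+ 2 = v by rewrite sqr_sqrtr.
have QE A : measurable A -> Q A = centered_normal s A.
  apply: law_unique_cos => a b; have bc := bm_gauss_cos a b.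
  by rewrite Qcos -s2 (exp_centered_normal _ bc) -(gauss_cosE s0).
have EQ (f : R -> \bar R) : measurable_fun [set: R] f ->
    (normal_prob 0 s).-integrable [set: measurableTypeR R] f ->
    (\int[Q]_x f x = \int[normal_prob 0 s]_x f x)%E.
  move=> mf intf; rewrite -integral_centered_normal//.
  by apply: eq_measure_integral => A mA _; exact: QE.
have i2 := normal_integrable_sqr s0; have i1 := normal_integrable_id s0.
split.
- by right; exists 0, s; split=> // B mB; rewrite QE.
- rewrite EQ// -s2 -(normal_second_moment s0) /Rintegral fineK//.
  exact: integrable_fin_num.
- have := normal_mean s0; rewrite EQ// /Rintegral => H.
  rewrite -[LHS]fineK ?H//; exact: integrable_fin_num.
Qed.

End gaussian_of_cosine.

Lemma exp_eq_null d (T : measurableType d) (R : realType) (P : probability T R)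
    (f g : T -> R) (N : set T) : bounded_measurable f -> bounded_measurable g ->
  measurable N -> P N = 0%E -> (forall x, ~ N x -> f x = g x) ->
  \int[P]_x f x = \int[P]_x g x.
Proof.
move=> bf bg mN PN fg; apply/eqP; rewrite -subr_eq0 -normr_le0 -expB//.
have bfg := bmB bf bg; rewrite (le_trans (exp_abs _ bfg))//.
have [M fM] := bf.2; have [K gK] := bg.2.
have bI : bounded_measurable (fun x => (M + K) * (\1_N x : R)) by apply: bmZ; exact: bm_indic.
apply: (@le_trans _ _ (\int[P]_x ((M + K) * (\1_N x : R)))).
  apply: exp_le => //; [exact: bm_abs|move=> x].
  rewrite indicE; case: (boolP (x \in N)) => [_|nN].
    by rewrite mulr1 (le_trans (ler_normB _ _))// lerD.
  by rewrite mulr0 fg ?subrr ?normr0// => Nx; move: nN; rewrite mem_set.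
by rewrite expZ ?exp_indic ?PN ?mulr0//; exact: bm_indic.
Qed.

Section law_of_the_series.
Context {R : realType} (P : probability R R) (Pr : probability (sample_space R) R).
Hypothesis HPr : infinite_product P Pr.
Hypothesis atomless : forall x : R, P [set x] = 0%E.
Variable xi : R -> R.
Hypothesis mxi : measurable_fun [set: R] xi.
Hypothesis xi_law : forall A, measurable A -> P (xi @^-1` A) = normal_prob 0 1 A.

Let F : choiceType := set_type (@bv_ball R).
Definition haar_coef (f : F) (i : nat) : R := hcoef P (set_val f) (hlev i) (hoff i).

Let bvP (f : F) : (sup_norm (set_val f) + p_variation 1 (set_val f) <= 1)%E.
Proof. by have [] := set_valP f. Qed.

Lemma haar_coef_sum (f : F) l : \sum_(k < 2 ^ l) `|haar_coef f ((2 ^ l).-1 + k)%N| <= (5 / 7) ^+ l.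
Proof.
have [bf f1 [e [e0 fe sume]]] := bv_oscillation P (bvP f).
apply: le_trans (hcoef_sum_le atomless bf fe sume l).
by apply: ler_sum => k _; rewrite /haar_coef !(hidx (ltn_ord k)).1 (hidx (ltn_ord k)).2.
Qed.

Let mY := measurable_gauss_coord mxi.
Let G := series_process haar_coef (gauss_coord xi).
Definition bridge_law : probability (uniform_borel F) R := series_law haar_coef_sum Pr mY.

Let cov (f g : F) : R := \int[P]_y (set_val f y * set_val g y) -
  \int[P]_y set_val f y * \int[P]_y set_val g y.

Variables (m : nat) (f : 'I_m -> F) (a : 'I_m -> R).
Let S (z : uniform_borel F) : R := \sum_(i < m) a i * (z : {uniform F -> R}) (f i).
Let v : R := \sum_(i < m) \sum_(k < m) a i * a k * cov (f i) (f k).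
(** The coefficients of [S] as a linear form in the Gaussian coordinates. *)
Let A (i : nat) : R := \sum_(k < m) a k * haar_coef (f k) i.

(** Expanding the squares leaves sums of products of Haar coefficients of two functions, which tend
    to their covariance by [haar_covariance]. *)
Let cvg_variance : \sum_(i < (2 ^ L).-1) A i ^+ 2 @[L --> \oo] --> v.
Proof.
have -> : (fun L => \sum_(i < (2 ^ L).-1) A i ^+ 2) = (fun L =>
    \sum_(i < m) \sum_(k < m) a i * a k *
      \sum_(q < (2 ^ L).-1) haar_coef (f i) q * haar_coef (f k) q).
  apply/funext => L.
  transitivity (\sum_(q < (2 ^ L).-1) \sum_(i < m) \sum_(k < m)
      a i * a k * (haar_coef (f i) q * haar_coef (f k) q)).
    apply: eq_bigr => q _; rewrite /A expr2 big_distrl/=; apply: eq_bigr => i _.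
    by rewrite big_distrr/=; apply: eq_bigr => k _; ring.
  rewrite exchange_big/=; apply: eq_bigr => i _.
  by rewrite exchange_big/=; apply: eq_bigr => k _; rewrite mulr_sumr.
apply: cvg_sum => i; apply: cvg_sum => k; apply: cvgMl_tmp.
apply/cvgrPdist_le => e e0.
have [bf f1 [ef [ef0 fef sumef]]] := bv_oscillation P (bvP (f i)).
have [bg g1 _] := bv_oscillation P (bvP (f k)).
have h : `|2^-1 : R| < 1 by rewrite ger0_norm; lra.
have /cvgrPdist_le/(_ e e0) := cvg_expr h; apply: filterS => L.
rewrite sub0r normrN exprVn ger0_norm ?invr_ge0// => Le; apply: le_trans Le.
apply: le_trans (haar_covariance atomless L bf ef0 fef sumef bg g1).
rewrite le_eqVlt; apply/orP; left; apply/eqP; congr (`|_ - _|).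
rewrite (big_levels (fun q => haar_coef (f i) q * haar_coef (f k) q)).
apply: eq_bigr => l _; apply: eq_bigr => q _.
by rewrite /haar_coef !(hidx (ltn_ord q)).1 !(hidx (ltn_ord q)).2.
Qed.

Let v_ge0 : 0 <= v.
Proof.
apply: (cvgr_to_ge cvg_variance); apply: nearW => L.
by apply: sumr_ge0 => i _; exact: sqr_ge0.
Qed.

Lemma measurable_eval (g : F) : measurable_fun [set: uniform_borel F]
  (fun z : uniform_borel F => (z : {uniform F -> R}) g).
Proof.
apply: (@measurability _ _ _ _ _ _ (@RGenOpens.G R)); first exact: RGenOpens.measurableE.
move=> _ [_ [x [y ->]] <-]; rewrite setTI; apply: sub_sigma_algebra.
rewrite openE => z /=; rewrite in_itv/= => /andP[xz zy].
apply/nbhs_uniform; exists (Num.min (z g - x) (y - z g)).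
  by rewrite lt_min !subr_gt0 xz.
move=> z' /(_ g) /=; rewrite lt_min !ltr_distl => /andP[/andP[? ?] /andP[? ?]].
by rewrite in_itv/=; apply/andP; split; lra.
Qed.

Let mS : measurable_fun [set: uniform_borel F] S.
Proof.
apply: measurable_sum => i; apply: measurable_funM => //; exact: measurable_eval.
Qed.

(** Truncations of the series are finite Gaussian sums with an explicit transform; dominated
    convergence and [cvg_variance] pass to the limit. *)
Let cos_S al b : \int[image_law bridge_law mS]_y cos (al * y + b) =
  expR (- (al ^+ 2 * v / 2)) * cos b.
Proof.
have bc := bm_gauss_cos al b.
have mG := measurable_series_process haar_coef_sum mY.
have bcS : bounded_measurable (fun z => cos (al * S z + b)) := bm_comp mS bc.
rewrite (exp_image_law _ mS bc); transitivity (\int[Pr]_x cos (al * S (G x) + b)).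
  exact: (exp_image_law Pr mG bcS).
pose good : set (sample_space R) := \bigcup_m [set x | box m%:R (gauss_coord xi x)].
have mgood : measurable good.
  by apply: bigcupT_measurable => q; exact: measurable_in_box.
have Pbad : Pr (~` good) = 0%E.
  apply/eqP; rewrite eq_le measure_ge0 andbT; apply/lee_addgt0Pr => e e0.
  have [q Hq] := tail_gauss_coord HPr mxi xi_law e0.
  rewrite add0e; apply: le_trans Hq; apply: le_measure; rewrite ?inE.
  - exact: measurableC.
  - by apply: measurableC; exact: measurable_in_box.
  - by move=> x /= nx xq; apply: nx; exists q.
pose lin L x := \sum_(i < (2 ^ L).-1) A i * gauss_coord xi x i.
have mlin L : measurable_fun [set: sample_space R] (lin L).
  apply: measurable_sum => i; apply: measurable_funM => //; exact: mY.
(* The indicator makes the truncations converge at every point, also where the process takes its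
   default value 0, and changes them on a null set only. *)
pose X L x := (\1_good x : R) * lin L x.
have mX L : measurable_fun [set: sample_space R] (X L).
  by apply: measurable_funM => //; exact: measurable_indic.
have linE L x : lin L x = \sum_(k < m) a k * partial haar_coef L (gauss_coord xi x) (f k).
  rewrite /lin; under eq_bigr do rewrite /A mulr_suml.
  rewrite exchange_big/=; apply: eq_bigr => k _; rewrite /partial mulr_sumr.
  by apply: eq_bigr => i _; rewrite mulrA.
have cvgX x : X L x @[L --> \oo] --> S (G x).
  rewrite /X indicE; case: (boolP (x \in good)) => [/set_mem[q _ xq]|nx].
    under eq_fun do rewrite mul1r linE.
    rewrite /S /G (series_processE haar_coef xq).
    apply: cvg_sum => k; apply: cvgMl_tmp; exact: (cvg_partial haar_coef_sum (ler0n R q) xq).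
  rewrite /S /G /series_process; case: pselect => [[q xq]|nb].
    by exfalso; move/negP: nx; apply; apply/mem_set; exists q.
  rewrite big1 => [|k _]; last by rewrite mulr0.
  by under eq_fun do rewrite mul0r; exact: cvg_cst.
have bcX L : bounded_measurable (fun x => cos (al * X L x + b)) := bm_comp (mX L) bc.
have EX L : \int[Pr]_x cos (al * X L x + b) =
    expR (- (al ^+ 2 * (\sum_(i < (2 ^ L).-1) A i ^+ 2) / 2)) * cos b.
  rewrite (_ : al ^+ 2 * _ = \sum_(i < (2 ^ L).-1) (al * A i) ^+ 2); last first.
    by rewrite mulr_sumr; apply: eq_bigr => i _; rewrite exprMn.
  rewrite -(cos_gauss_coord HPr mxi xi_law _ (fun i => al * A i)).
  have lE x : \sum_(i < (2 ^ L).-1) al * A i * gauss_coord xi x i = al * lin L x.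
    by rewrite mulr_sumr; apply: eq_bigr => i _; rewrite mulrA.
  under [RHS]eq_Rintegral do rewrite lE.
  apply: (exp_eq_null (N := ~` good)) => //.
  - exact: (bm_comp (mlin L) bc).
  - exact: measurableC.
  - by move=> x /contrapT gx; rewrite /X indicE mem_set// mul1r.
have c1 : \int[Pr]_x cos (al * X L x + b) @[L --> \oo] -->
    \int[Pr]_x cos (al * S (G x) + b).
  apply: (exp_dominated (M := 1)).
  - by move=> L; exact: (bcX L).1.
  - by move=> L x; rewrite ler_norml cos_geN1 cos_le1.
  - move=> x; apply: continuous_cvg; first exact: continuous_cos.
    by apply: cvgD; [apply: cvgMl_tmp; exact: cvgX|exact: cvg_cst].
have c2 : \int[Pr]_x cos (al * X L x + b) @[L --> \oo] -->
    expR (- (al ^+ 2 * v / 2)) * cos b; last exact: (cvg_unique _ c1 c2).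
under eq_fun do rewrite EX.
apply: cvgMr_tmp; apply: continuous_cvg; first exact: continuous_expR.
apply: cvgN; apply: cvgMr_tmp; apply: cvgMl_tmp; exact: cvg_variance.
Qed.

Lemma bridge_law_sum :
  [/\ gaussian_law (fun B => bridge_law [set z | B (S z)]),
      (\int[bridge_law]_z (S z ^+ 2)%:E = v%:E)%E
    & bridge_law.-integrable [set: _] (EFin \o S) /\ (\int[bridge_law]_z (S z)%:E = 0)%E].
Proof.
have [h1 h2 h3] := gaussian_of_cosine v_ge0 cos_S.
have mS2 : measurable_fun [set: R] (fun y : R => (y ^+ 2)%:E).
  exact/measurable_EFinP/measurable_funX.
have E2 : (\int[bridge_law]_z (S z ^+ 2)%:E = v%:E)%E.
  rewrite -h2; apply/esym/(ge0_integral_image_law bridge_law mS mS2) => y.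
  by rewrite lee_fin sqr_ge0.
have iS : bridge_law.-integrable [set: uniform_borel F] (EFin \o S).
  apply: (@le_integrable _ _ _ bridge_law setT measurableT _
      (EFin \o (fun z => 1 + S z ^+ 2))).
  - exact/measurable_EFinP.
  - move=> z _ /=; rewrite lee_fin [leRHS]ger0_norm ?addr_ge0 ?sqr_ge0//.
    have := sqr_ge0 (`|S z| - 1); have := sqr_ge0 (S z); rewrite -real_normK ?num_real//.
    by have := normr_ge0 (S z); nra.
  rewrite (_ : _ \o _ = (EFin \o cst 1) \+ (EFin \o (fun z => S z ^+ 2))); last by [].
  apply: integrableD => //; first exact: (bm_integrable _ (bm_cst 1)).
  apply/integrableP; split; first by apply/measurable_EFinP; exact: measurable_funX.
  under eq_integral do rewrite /= ger0_norm ?sqr_ge0//.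
  by rewrite E2 ltry.
split=> //; split=> //.
rewrite -h3; apply/esym; apply: (integral_image_law (X := S)) => //.
Qed.

End law_of_the_series.

(** Turns the second moments of linear combinations, which [bridge_law_sum] provides, into mixed
    moments. *)
Lemma integral_polarization d (T : measurableType d) (R : realType)
    (Q : probability T R) (u w : T -> R) (U W C : R) :
  measurable_fun [set: T] u -> measurable_fun [set: T] w ->
  (\int[Q]_x (u x ^+ 2)%:E = U%:E)%E -> (\int[Q]_x (w x ^+ 2)%:E = W%:E)%E ->
  (\int[Q]_x ((u x + w x) ^+ 2)%:E = (U + W + 2 * C)%:E)%E ->
  (\int[Q]_x (u x * w x)%:E = C%:E)%E.
Proof.
move=> mu mw hu hw huw.
have sqr_int (f : T -> R) (V : R) : measurable_fun [set: T] f ->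
    (\int[Q]_x (f x ^+ 2)%:E = V%:E)%E ->
    Q.-integrable [set: T] (EFin \o (fun x => f x ^+ 2)).
  move=> mf hf; apply/integrableP; split.
    by apply/measurable_EFinP; exact: measurable_funX.
  by under eq_integral do rewrite /= ger0_norm ?sqr_ge0//; rewrite hf ltry.
have iu := sqr_int _ _ mu hu; have iw := sqr_int _ _ mw hw.
have iuw := sqr_int _ _ (measurable_funD mu mw) huw.
have -> : (\int[Q]_x (u x * w x)%:E = \int[Q]_x ((2^-1)%:E *
    (((u x + w x) ^+ 2)%:E - (u x ^+ 2)%:E - (w x ^+ 2)%:E)))%E.
  by apply: eq_integral => x _; rewrite -!EFinB -EFinM; congr EFin; field.
rewrite integralZl//; last by apply: integrableB => //; exact: integrableB.
rewrite integralB//; last exact: integrableB.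
rewrite integralB// huw hu hw -!EFinB -EFinM; congr EFin.
by field.
Qed.

Lemma covariance_bm (R : realType) (P : probability R R) (f g : R -> R) :
  bounded_measurable f -> bounded_measurable g ->
  covariance P f g = (\int[P]_y (f y * g y) - \int[P]_y f y * \int[P]_y g y)%:E.
Proof.
move=> bf bg; rewrite !unlock.
set a := fine _; set b := fine _.
have aE : a = \int[P]_y f y by [].
have bE : b = \int[P]_y g y by [].
have -> : (\int[P]_y (((f \- cst a) * (g \- cst b)) y)%:E)%E =
    (\int[P]_y (f y * g y - (b * f y + a * g y - a * b)))%:E.
  rewrite -exp_EFin; last first.
    apply: (bmB (bmM bf bg)); apply: (bmB (bmD (bmZ b bf) (bmZ a bg))); exact: bm_cst.
  by apply: eq_integral => y _; congr EFin; rewrite -[LHS]/((f y - a) * (g y - b)); ring.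
congr EFin; rewrite (expB _ (bmM bf bg) (bmB (bmD (bmZ b bf) (bmZ a bg)) (bm_cst _))).
rewrite (expB _ (bmD (bmZ b bf) (bmZ a bg)) (bm_cst _)).
rewrite (expD _ (bmZ b bf) (bmZ a bg)) exp_cst (expZ _ _ bf) (expZ _ _ bg) -aE -bE.
by ring.
Qed.

Lemma law_of_GP_bridge (R : realType) (P : probability R R)
    (Pr : probability (sample_space R) R) (HPr : infinite_product P Pr)
    (atomless : forall x : R, P [set x] = 0%E) (xi : R -> R)
    (mxi : measurable_fun [set: R] xi) :
  (forall A, measurable A -> P (xi @^-1` A) = normal_prob 0 1 A) ->
  law_of_GP (F := @bv_ball R) P (bridge_law Pr atomless mxi).
Proof.
move=> xi_law; set gamma := bridge_law _ _ _.
have H := bridge_law_sum HPr atomless mxi xi_law.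
have bF (f : @bv_ball R) : bounded_measurable (set_val f).
  by have [_ /(bv_oscillation P)[]] := set_valP f.
have sq (f : @bv_ball R) : (\int[gamma]_(z in setT) ((z : {uniform @bv_ball R -> R}) f ^+ 2)%:E =
    (\int[P]_y (set_val f y * set_val f y) - \int[P]_y set_val f y * \int[P]_y set_val f y)%:E)%E.
  have [_ + _] := H 1%N (fun=> f) (fun=> 1).
  rewrite !big_ord1 !mul1r => <-; apply: eq_integral => z _.
  by rewrite big_ord1 mul1r.
split.
- by move=> m f a; have [] := H m f a.
- move=> f; have [_ _ [_]] := H 1%N (fun=> f) (fun=> 1).
  move=> E; rewrite expectation.unlock -[RHS]E; apply: eq_integral => z _.
  by rewrite big_ord1 mul1r.
- move=> f g; rewrite covariance_bm// expectation.unlock.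
  apply: (integral_polarization _ _ (sq f) (sq g)).
  + exact: measurable_eval.
  + exact: measurable_eval.
  have [_ + _] := H 2%N (fun i => if i == ord0 then f else g) (fun=> 1).
  rewrite !big_ord_recl !big_ord0 /= !mul1r !addr0 => E.
  transitivity (\int[gamma]_z ((\sum_(i < 2) 1 * (z : {uniform @bv_ball R -> R}) (if i == ord0 then f else g)) ^+ 2)%:E)%E.
    by apply: eq_integral => z _; rewrite !big_ord_recl big_ord0 /= !mul1r addr0.
  rewrite E; congr EFin.
  have -> : \int[P]_y (set_val g y * set_val f y) = \int[P]_y (set_val f y * set_val g y).
    by apply: eq_Rintegral => y _; rewrite mulrC.
  by ring.
Qed.

(** * From the wavelet process to the empirical process *)

Lemma mu_ext_cover d (T : measurableType d) (R : realType) (P : probability T R)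
    (E : set T) (r : \bar R) : (mu_ext P E < r)%E ->
  exists2 B : set T, measurable B /\ (P B < r)%E & E `<=` B.
Proof.
move=> /ereal_inf_lt[_ [A [mA EA] <-] Ar].
exists (\bigcup_k A k) => //; split; first exact: bigcupT_measurable.
apply: le_lt_trans Ar; apply: generalized_Boole_inequality => //.
exact: bigcupT_measurable.
Qed.

Section approximation.
Context {R : realType} (P : probability R R) (Pr : probability (sample_space R) R).
Hypothesis HPr : infinite_product P Pr.
Hypothesis atomless : forall x : R, P [set x] = 0%E.
Variables (phi : R -> R) (B1 B2 : R) (j : nat -> nat).
Hypothesis mphi : measurable_fun [set: R] phi.
Hypothesis phib : exists M, forall y, `|phi y| <= M.
Hypothesis Hsupp : forall x, x \notin `]B1, B2] -> phi x = 0.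
Hypothesis cdf_small : forall e : R, 0 < e -> \forall n \near \oo,
  (mu_ext Pr [set x | e%:E < (Num.sqrt n%:R)%:E * cdf_dist phi (j n) n x] <= e%:E)%E.

Local Notation F := (@bv_ball R).

Lemma wemp_process_nu n x (f : F) (e : R) :
  ((Num.sqrt n%:R)%:E * cdf_dist phi (j n) n x <= e%:E)%E ->
  `|wemp_process P phi j n x f - nu P n x (set_val f)| <= e.
Proof.
move=> cdf_e; have [_ fbv] := set_valP f.
rewrite /wemp_process /nu -mulrBr -lee_fin; apply: le_trans cdf_e.
rewrite normrM ger0_norm ?sqrtr_ge0// EFinM lee_wpmul2l ?lee_fin ?sqrtr_ge0//.
rewrite (_ : _ - _ - _ = wemp phi (j n) n x (set_val f) - emp n x (set_val f)); last by ring.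
exact: (bv_functional_cdf_dist mphi phib Hsupp).
Qed.

(** The wavelet process is close to ν_n by [cdf_small], and ν_n to its Haar expansion by
    [empirical_haar_approx], taken with finest level [l], the integer part of log_2 n. *)
Lemma wemp_process_approx (e : R) : 0 < e -> exists l1, forall L, (l1 <= L)%N ->
  exists n0, forall n, (n0 <= n)%N ->
  exists2 B : set (sample_space R), measurable B /\ (Pr B <= e%:E)%E &
    forall x, ~ B x -> forall f : F,
      `|wemp_process P phi j n x f - partial (haar_coef P) L (haar_coord P n x) f| <= e.
Proof.
move=> e0; pose r := e / 4; have r0 : 0 < r by rewrite divr_gt0.
(* This gives 30 (25/28)^L ≤ r, which covers both the truncation error 10 (25/28)^L and the
   probability 24 (512/625)^L. *)
have [l1 Hl1] := geometric_small 3 r0.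
(* Since n ≤ 2 · 2^l, the condition n ≥ K makes 4 r^-4 / 2^l and 2 √n / 2^l at most r. *)
exists l1 => L l1L; pose delta := r; pose K := 8 * delta ^- 4 / r + (4 / r) ^+ 2 + 1.
have : \forall n \near \oo, [/\ K <= n%:R, (2 ^ L <= n)%N &
    (mu_ext Pr [set x | (r%:E < (Num.sqrt n%:R)%:E * cdf_dist phi (j n) n x)%E] <= r%:E)%E].
  near=> n; split; near: n; [exact: nbhs_infty_ger|exact: nbhs_infty_ge|exact: cdf_small].
move=> [n0 _ Hn0]; exists n0 => n /Hn0 /= [Kn Ln cdf_n].
have n_gt0 : (0 < n)%N by apply: leq_trans Ln; rewrite expn_gt0.
pose l := trunc_log 2 n.
have /andP[ln nl] := trunc_log_bounds (isT : (1 < 2)%N) n_gt0.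
have Ll : (L <= l)%N by exact: trunc_log_max.
have [B [mB PB] HB] := empirical_haar_approx HPr atomless n_gt0 Ll ln r0.
(* The event need not be measurable, so it is covered by a measurable one; 2 r instead of r leaves
   the strict room that a cover requires. *)
have [|B' [mB' PB'] HB'] := @mu_ext_cover _ _ _ Pr
    [set x | (r%:E < (Num.sqrt n%:R)%:E * cdf_dist phi (j n) n x)%E] (2 * r)%:E.
  by apply: (le_lt_trans cdf_n); rewrite lte_fin; lra.
have d4 : 0 <= r ^- 4 by rewrite invr_ge0 exprn_ge0// ltW.
have n0R : 0 < n%:R :> R by rewrite ltr0n.
have twol : n%:R <= 2 * 2 ^+ l :> R by rewrite -exprS -natrX ler_nat ltnW.
have l0 : 0 < 2 ^+ l :> R by rewrite exprn_gt0.
have K1 : 8 * delta ^- 4 / r <= n%:R.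
  by apply: le_trans Kn; rewrite /K -addrA lerDl addr_ge0// sqr_ge0.
have K2 : (4 / r) ^+ 2 <= n%:R.
  apply: le_trans Kn; rewrite /K -addrA addrCA lerDl addr_ge0//.
  by rewrite divr_ge0 ?mulr_ge0// ltW.
have b1 : 4 * r ^- 4 / 2 ^+ l <= r.
  rewrite ler_pdivrMr//; move: K1; rewrite ler_pdivrMr// /delta => K1.
  have := ler_wpM2r (ltW r0) twol; lra.
have b2 : 2 * Num.sqrt n%:R / 2 ^+ l <= r.
  rewrite ler_pdivrMr//; set s := Num.sqrt n%:R.
  have s2 : s ^+ 2 = n%:R by rewrite sqr_sqrtr// ltW.
  have s0 : 0 < s by rewrite sqrtr_gt0.
  have sr : 4 / r <= s.
    rewrite -(@ler_pXn2r _ 2) ?nnegrE ?s2//; first by rewrite divr_ge0// ltW.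
    exact: ltW.
  move: sr; rewrite ler_pdivrMr// => sr.
  have := ler_wpM2r (ltW s0) sr; rewrite mulrAC -expr2 s2 => h.
  have := ler_wpM2r (ltW r0) twol; lra.
have q1 := Hl1 L l1L.
have q0 : 0 <= (25 / 28) ^+ L :> R by rewrite exprn_ge0//; lra.
have q2 : (512 / 625) ^+ L <= (25 / 28) ^+ L :> R by apply: lerXn2r; rewrite ?nnegrE; lra.
exists (B `|` B').
  split; first exact: measurableU.
  apply: (le_trans (measureU2 Pr mB mB')); rewrite (_ : e = 2 * r + 2 * r); last first.
    by rewrite /r; field.
  rewrite EFinD leeD ?(ltW PB')//; apply: (le_trans PB); rewrite lee_fin; lra.
move=> x nBB f; have nB : ~ B x by move=> Bx; apply: nBB; left.
have h1 : `|wemp_process P phi j n x f - nu P n x (set_val f)| <= r.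
  apply: wemp_process_nu; rewrite leNgt; apply/negP => ltr.
  by apply: nBB; right; exact: HB'.
have [_ fbv] := set_valP f.
have h2 := HB _ nB _ fbv.
rewrite (_ : _ - _ = (wemp_process P phi j n x f - nu P n x (set_val f)) +
   (nu P n x (set_val f) - partial (haar_coef P) L (haar_coord P n x) f)); last by ring.
rewrite (le_trans (ler_normD _ _))//.
have : `|nu P n x (set_val f) - partial (haar_coef P) L (haar_coord P n x) f| <=
  10 * (25 / 28) ^+ L + r + 2 * Num.sqrt n%:R / 2 ^+ l by exact: h2.
have : e = 4 * r by rewrite /r; field.
by move=> -> h3; lra.
Unshelve. all: by end_near. Qed.

End approximation.

Lemma has_density_atomless (R : realType) (P : probability R R) (p0 : R -> R) :
  has_density P p0 -> forall x : R, P [set x] = 0%E.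
Proof.
move=> [mp0 p00 PE] x; rewrite PE; last exact: measurable_set1.
exact: integral_set1.
Qed.

Lemma bounded_fun_bound (R : realType) (f : R -> R) :
  bounded_fun f -> exists M : R, forall y, `|f y| <= M.
Proof.
move=> [M [_ HM]]; exists (M + 1) => y; apply: (HM (M + 1)) => //.
by rewrite ltrDl.
Qed.

Section wemp_bounded.
Context {R : realType} (phi : R -> R) (B1 B2 : R).
Local Notation mu := (@lebesgue_measure R).
Hypothesis mphi : measurable_fun [set: R] phi.
Hypothesis phib : exists M, forall y, `|phi y| <= M.
Hypothesis Hsupp : forall x, x \notin `]B1, B2] -> phi x = 0.

(** As |f| ≤ 1 on the ball, the L^1 norm of the density estimate bounds all the integrals at
    once. *)
Lemma wemp_process_linf (P : probability R R) (j : nat -> nat) n x :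
  linf (wemp_process P (F := @bv_ball R) phi j n x).
Proof.
have iw := wdensity_integrable mphi phib Hsupp (j n) n x.
exists (Num.sqrt n%:R * (\int[mu]_y `|wdensity phi (j n) n x y| + 1)) => f.
have [mf fbv] := set_valP f.
have [bf f1 _] := bv_oscillation P fbv.
rewrite /wemp_process normrM ger0_norm ?sqrtr_ge0// ler_wpM2l ?sqrtr_ge0//.
rewrite (le_trans (ler_normB _ _))// lerD//.
  have mw : measurable_fun [set: R] (wdensity phi (j n) n x).
    by apply/measurable_EFinP; exact: measurable_int iw.
  have ifw : mu.-integrable [set: R] (EFin \o (fun y => set_val f y * wdensity phi (j n) n x y)).
    apply: le_integrable iw => //; first by apply/measurable_EFinP; exact: measurable_funM.
    by move=> y _ /=; rewrite lee_fin normrM ler_piMl ?f1.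
  rewrite /wemp (le_trans (le_normr_Rintegral _ ifw))//.
  apply: le_Rintegral => //; [exact: (integrable_norm ifw)|exact: (integrable_norm iw)|].
  by move=> y _; rewrite normrM ler_piMl ?f1.
rewrite (le_trans (exp_abs P bf))// -(exp_cst P 1).
by apply: exp_le => //; [exact: bm_abs|exact: bm_cst].
Qed.

End wemp_bounded.

Lemma natr_half_pow_small (R : realType) (e : R) : 0 < e ->
  \forall j \near \oo, j%:R * 2 ^- j <= e.
Proof.
move=> e0.
have b (j : nat) : j%:R <= 2 * (3 / 2) ^+ j :> R.
  suff : 1 + j%:R / 2 <= (3 / 2) ^+ j :> R by lra.
  elim: j => [|j IH]; first by rewrite mul0r addr0 expr0.
  rewrite exprS -natr1; have : 0 <= j%:R :> R by []. lra.
have h : `|3 / 4 : R| < 1 by rewrite ger0_norm; lra.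
have /cvgrPdist_le/(_ (e / 2)) : (3 / 4) ^+ n @[n --> \oo] --> (0 : R) by exact: cvg_expr.
rewrite divr_gt0// => /(_ isT); apply: filterS => j.
rewrite sub0r normrN ger0_norm; last by rewrite exprn_ge0//; lra.
move=> je; apply: (@le_trans _ _ (2 * (3 / 2) ^+ j * 2 ^- j)).
  by rewrite ler_wpM2r// invr_ge0 exprn_ge0.
rewrite -mulrA -exprVn -exprMn (_ : 3 / 2 * 2^-1 = 3 / 4); last by field.
lra.
Qed.

(** Apply the exponential inequality at the fixed level e: the threshold tends to 0, so e is
    eventually allowed, while the minimum in the exponent tends to infinity. *)
Lemma cdf_dist_small (R : realType) (Pr : probability (sample_space R) R)
    (phi : R -> R) (d t L Lambda0 : R) (j : nat -> nat) :
  0 < L -> 0 < Lambda0 ->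
  cdf_exponential_inequality Pr phi d t L Lambda0 ->
  (forall n, (0 < n)%N -> (0 < j n)%N /\ admissible_level d n (j n)) ->
  j n @[n --> \oo] --> \oo ->
  Num.sqrt n%:R * 2 `^ (- ((j n)%:R * (t + 1))) @[n --> \oo] --> (0 : R) ->
  forall e : R, 0 < e -> \forall n \near \oo,
  (mu_ext Pr [set x | e%:E < (Num.sqrt n%:R)%:E * cdf_dist phi (j n) n x] <= e%:E)%E.
Proof.
move=> L0 Lam0 HE Hj joo thr e e0.
have eL : 0 < e / Lambda0 by rewrite divr_gt0.
have n1 : \forall n \near \oo, (0 < n)%N by exact: nbhs_infty_gt.
have n2 : \forall n \near \oo, Num.sqrt ((j n)%:R * 2 ^- (j n)) <= e / Lambda0.
  have : \forall n \near \oo, (j n)%:R * 2 ^- (j n) <= (e / Lambda0) ^+ 2.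
    apply: joo (natr_half_pow_small _); by rewrite exprn_gt0.
  apply: filterS => n jn; rewrite -[leRHS](ger0_norm (ltW eL)) -sqrtr_sqr.
  by rewrite ler_sqrt// exprn_ge0// ltW.
have n3 : \forall n \near \oo,
    Num.sqrt n%:R * 2 `^ (- ((j n)%:R * (t + 1))) <= e / Lambda0.
  have /cvgrPdist_le/(_ _ eL) := thr; apply: filterS => n.
  by rewrite sub0r normrN; exact: le_trans (ler_norm _).
pose K := L ^+ 2 / e.
have n4 : \forall n \near \oo, K <= 2 ^+ j n * e ^+ 2.
  have : \forall n \near \oo, K / e ^+ 2 <= (j n)%:R.
    exact: joo (nbhs_infty_ger _).
  apply: filterS => n; rewrite ler_pdivrMr ?exprn_gt0// => /le_trans; apply.
  rewrite ler_wpM2r ?sqr_ge0// -natrX ler_nat ltnW//; exact: ltn_expl.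
have n5 : \forall n \near \oo, K <= Num.sqrt n%:R * e.
  have : \forall n \near \oo, (K / e) ^+ 2 <= n%:R by exact: nbhs_infty_ger.
  apply: filterS => n Kn; rewrite -ler_pdivrMr//.
  have K0 : 0 <= K / e by rewrite !divr_ge0 ?sqr_ge0// ltW.
  by rewrite -(ger0_norm K0) -sqrtr_sqr ler_sqrt.
near=> n.
have n_gt0 : (0 < n)%N by near: n.
have [j0 jadm] := Hj n n_gt0.
apply: (le_trans (HE n (j n) e n_gt0 j0 jadm _)).
  rewrite -ler_pdivlMl// mulrC ge_max; apply/andP; split; near: n; exact.
rewrite lee_fin; set y := Num.min _ _.
have Ky : K <= y by rewrite le_min; apply/andP; split; near: n; exact.
have K0 : 0 < K by rewrite divr_gt0// exprn_gt0.
have y0 : 0 < y by exact: lt_le_trans Ky.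
rewrite expRN -ler_pdivlMl// -[leLHS]mul1r ler_pdivrMr ?expR_gt0//.
have := expR_ge1Dx (y / L); set E := expR _ => HE1.
have h : L / e <= y / L by rewrite ler_pdivlMr// mulrAC -expr2.
have : e / L * (L / e) <= e / L * E.
  by rewrite ler_wpM2l// ?divr_ge0 ?ltW//; lra.
have -> : e / L * (L / e) = 1 by field; rewrite !gt_eqF.
by rewrite [L^-1 * e]mulrC.
Unshelve. all: by end_near. Qed.

Theorem corollary3 (R : realType)
  (phi psi : R -> R)
  (Hphi : father_wavelet phi) (Hpsi : mother_wavelet phi psi)
  (p : R) (Hp : 1 <= p) (Hpvar : (p_variation p phi < +oo)%E)
  (B1 B2 : R) (Hsupp : forall x, x \notin `]B1, B2] -> phi x = 0)
  (T : nat) (Hcond : condition1 T phi psi)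
  (t : R)
  (* the wavelet pair used to define the Besov space of p0, when t > 0 *)
  (SB : nat) (phiB psiB : R -> R)
  (d : R) (Hd : 0 < d)
  (* constants depending only on the norm of p0, and on phi, d fixed above *)
  (L Lambda0 : \bar R -> R)
  (P : probability R R) (p0 : R -> R) (Hp0 : has_density P p0)
  (Ht : (t = 0 /\ (sup_norm p0 < +oo)%E) \/
        [/\ 0 < t, t < T%:R + 1, besov_pair t SB phiB psiB
          & besov phiB psiB t +oo%E +oo%E p0])
  (Pr : probability (sample_space R) R) (HPr : infinite_product P Pr)
  (HL : 0 < L (sup_norm p0))
  (HLambda0 : 0 < Lambda0 (smoothness_norm phiB psiB t p0))
  (HE : cdf_exponential_inequality Pr phi d t
          (L (sup_norm p0)) (Lambda0 (smoothness_norm phiB psiB t p0))) :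
  (forall (n j : nat) (lambda : R), (0 < n)%N -> (0 < j)%N ->
     admissible_level d n j ->
     Lambda0 (smoothness_norm phiB psiB t p0) * threshold t n j <= lambda ->
     (mu_ext Pr [set x |
         lambda%:E < (Num.sqrt n%:R)%:E * class_dist phi j n x bv_ball_rc] <=
      (L (sup_norm p0) *
         expR (- (Num.min (2 ^+ j * lambda ^+ 2) (Num.sqrt n%:R * lambda)
                  / L (sup_norm p0))))%:E)%E)
  /\
  (forall j : nat -> nat,
     (forall n, (0 < n)%N -> (0 < j n)%N /\ admissible_level d n (j n)) ->
     nondecreasing_seq j -> j n @[n --> \oo] --> \oo ->
     Num.sqrt n%:R * 2 `^ (- ((j n)%:R * (t + 1))) @[n --> \oo] --> (0 : R) ->
     exists gamma : probability (uniform_borel (R := R) (@bv_ball R)) R,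
       law_of_GP P gamma /\
       cvg_in_law Pr (wemp_process P (F := @bv_ball R) phi j) gamma).
Proof.
have [[bphi _] _ _] := Hcond.
have phib := bounded_fun_bound bphi.
have mphi : measurable_fun [set: R] phi.
  have [+ _ _ _] := Hphi; move=> /(@sub_Lfun_mfun _ _ _ _ _); rewrite inE.
  by [].
have atomless := has_density_atomless Hp0.
split.
  (* The comparison of distances holds for every sample, so the event of the class is contained in
     that of the distribution functions and the outer measure is monotone. *)
  move=> n j lambda n0 j0 jadm lam.
  apply: le_trans (HE n j lambda n0 j0 jadm lam); apply: le_mu_ext => x /= /lt_le_trans; apply.
  rewrite lee_wpmul2l ?lee_fin ?sqrtr_ge0//.
  by apply: (class_dist_le_cdf_dist mphi phib Hsupp) => f [].
move=> j Hj _ joo thr.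
(* Applied to each observation, [xi] gives independent standard normal variables, which drive the
   limiting series. *)
have [xi [mxi law_xi]] := quantile_transform (Q := centered_normal 1) atomless
  (normal_prob_atomless 0 1).
have xi_law A : measurable A -> P (xi @^-1` A) = normal_prob 0 1 A by exact: law_xi.
exists (bridge_law Pr atomless mxi); split; first exact: law_of_GP_bridge.
apply: (cvg_in_law_series (haar_coef_sum atomless) (V := haar_coord P)).
- by move=> n i; exact: (bm_haar_coord P n i).1.
- exact: (tail_gauss_coord HPr mxi xi_law).
- by move=> N a b; exact: (cvg_cos_haar_coord HPr atomless mxi xi_law).
- by move=> N e e0; exact: (tight_coords HPr atomless mxi xi_law).
- by move=> n w; exact: (wemp_process_linf mphi phib Hsupp).
- move=> e e0; apply: (wemp_process_approx HPr atomless mphi phib Hsupp) => //.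
  exact: (cdf_dist_small HL HLambda0 HE Hj joo thr).
Qed.
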